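(* Let $k$ be a field of characteristic different from $2$ and $3$ and let $$C\colon y^2=F(x)=G_1(x)^2+\lambda_1H_1(x)^3=G_2(x)^2+\lambda_2H_2(x)^3$$ be a genus $2$ curve over $k$, where $F\in k[x]$ has degree $6$, $G_1,G_2\in k[x]$, $\lambda_1,\lambda_2\in k^\times$, and $H_1,H_2\in k[x]$ are quadratic monic polynomials with $H_1\neq H_2$. For $i\in\{1,2\}$ let $D_i$ be the effective degree $2$ divisor on $C$ described by the vanishing of $y-G_i(x)$ and $H_i(x)$, and let $T_i=[D_i-\kappa]\in\operatorname{Pic}(C/k)[3]$, where $\kappa$ is an effective canonical divisor. Let $\alpha_1,\alpha_2,\alpha_3$ be the cube roots of $\lambda_2/\lambda_1$ in an algebraic closure of $k$. Then $e_3(T_1,T_2)=1$ if and only if none of the polynomials $H_1-\alpha_iH_2$ ($i=1,2,3$) divides $G_2-G_1$.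
   Context: $\operatorname{Pic}(C/k)$ is the group of linear equivalence classes of $k$-rational divisors on $C$, and $\operatorname{Pic}(C/k)[3]$ is its $3$-torsion. $e_3\colon J[3]\times J[3]\to\mu_3$ is the Weil pairing on the $3$-torsion of the Jacobian $J$ of $C$, with values in the cube roots of unity. Divisibility is that of polynomials in $x$ over the algebraic closure of $k$. One has $(G_2-G_1)(G_2+G_1)=\lambda_1(H_1-\alpha_1H_2)(H_1-\alpha_2H_2)(H_1-\alpha_3H_2)$.
   Formalization: ''Divides'' is read for binary forms (H_1−α_iH_2 of degree 2, G_2−G_1 of degree 3), i.e. the quotient has degree at most 1; with plain polynomial divisibility the claim fails, e.g. λ_1=λ_2=1, G_1=−3x, H_1=x²+2, G_2=3x²+3, H_2=x²−1. *)

(* Defs.v *)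
From mathcomp Require Export all_boot all_order all_algebra all_field.
From mathcomp Require Export boolp classical_sets.
From mathcomp.multinomials Require Export freeg.

Set Implicit Arguments.
Unset Strict Implicit.
Unset Printing Implicit Defensive.

Import Order.TTheory GRing.Theory Num.Theory.
Local Open Scope ring_scope.

(* The smooth projective curve C : y^2 = F(x) over an algebraically closed
   field K, for F of degree 6, with its two points at infinity.  The
   definitions make sense for every polynomial F; they describe C when F has
   degree 6 and is separable and K has characteristic different from 2. *)
Section Curve.

Variables (K : closedFieldType) (F : {poly K}).

(* The modulus Y^2 - F over K(x).  For F separable of positive degree it is
   irreducible, so that the quotient ring is the function field K(C). *)
Definition curve_eq : {poly {fraction {poly K}}} := 'X^2 - (tofrac F)%:P.

Definition funfield : Type := {poly %/ curve_eq}.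

Definition poly_fun (p : {poly K}) : funfield := qpolyC curve_eq (tofrac p).
Definition const_fun (c : K) : funfield := poly_fun c%:P.
Definition x_fun : funfield := poly_fun 'X.
Definition y_fun : funfield := qpolyX curve_eq.

(* An affine point is a solution (a, b) of b^2 = F(a).  With x' = 1/x and
   y' = y/x^3 the curve reads y'^2 = x'^6 F(1/x'), whose points over x' = 0
   are the (0, s) where s^2 is the coefficient of x^6 in F. *)
Definition affine_point := {ab : K * K | ab.2 ^+ 2 == F.[ab.1]}.
Definition infinite_point := {s : K | s ^+ 2 == F`_6}.
Definition point := (affine_point + infinite_point)%type.

Definition coords (P : point) : funfield * funfield :=
  match P with
  | inl _ => (x_fun, y_fun)
  | inr _ => (x_fun^-1, y_fun / x_fun ^+ 3)
  end.

Definition center (P : point) : K * K :=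
  match P with
  | inl ab => val ab
  | inr s => (0, val s)
  end.

(* A bivariate p : {poly {poly K}} has the first coordinate as its inner
   variable and the second one as its outer variable.  The functions
   regular in the chart of P are the chart_fun P p, and chart_val P p is the
   value of chart_fun P p at P. *)
Definition chart_fun (P : point) (p : {poly {poly K}}) : funfield :=
  (map_poly (fun q : {poly K} => (map_poly const_fun q).[(coords P).1]) p)
    .[(coords P).2].

Definition chart_val (P : point) (p : {poly {poly K}}) : K :=
  p.[(center P).2%:P].[(center P).1].

Definition uniformizer (P : point) : funfield :=
  if (center P).2 != 0 then (coords P).1 - const_fun (center P).1
  else (coords P).2.

(* f = t^n * (unit of the local ring at P); junk value 0 at f = 0. *)
Definition is_ord (P : point) (f : funfield) (n : int) : Prop :=
  exists u v : {poly {poly K}},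
    [/\ chart_val P u != 0, chart_val P v != 0 &
        chart_fun P v * f = uniformizer P ^ n * chart_fun P u].

Definition ord (P : point) (f : funfield) : int :=
  xget 0 [set n | is_ord P f n]%classic.

(* Junk value 0 when f has a pole at P. *)
Definition is_value (P : point) (f : funfield) (c : K) : Prop :=
  exists u v : {poly {poly K}},
    [/\ chart_val P v != 0, chart_fun P v * f = chart_fun P u &
        c = chart_val P u / chart_val P v].

Definition value (P : point) (f : funfield) : K :=
  xget 0 [set c | is_value P f c]%classic.

Definition divisor := {freeg point / int}.

Definition effective_divisor (D : divisor) : Prop := forall P, 0 <= coeff P D.

Definition div_of (f : funfield) (D : divisor) : Prop :=
  f != 0 /\ forall P, coeff P D = ord P f.

Definition principal (D : divisor) : Prop := exists f, div_of f D.

Definition divclass (D : divisor) : set divisor :=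
  [set E | principal (E - D)]%classic.

Definition derivation (d : funfield -> funfield) : Prop :=
  [/\ forall f g, d (f + g) = d f + d g,
      forall f g, d (f * g) = d f * g + f * d g &
      forall c, d (const_fun c) = 0].

(* The nonzero rational differentials w correspond to the nonzero K-linear
   derivations d of K(C) through w(d) = 1.  If t is a uniformizer at P, then
   w = dt / d(t), so the order of w at P is - ord_P (d(t)). *)
Definition canonical_divisor (W : divisor) : Prop :=
  exists d, [/\ derivation d, exists f, d f != 0 &
    forall P, coeff P W = - ord P (d (uniformizer P))].

(* The subscheme of C cut out by f and g (where f and g are regular), as a
   divisor: its multiplicity at P is the smaller of the orders of vanishing
   of f and g at P.  A pole counts as non-vanishing. *)
Definition common_zeros (f g : funfield) (D : divisor) : Prop :=
  forall P, coeff P D = Num.min (Num.max 0 (ord P f)) (Num.max 0 (ord P g)).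

Definition eval_div (f : funfield) (D : divisor) : K :=
  \prod_(P <- dom D) value P f ^ coeff P D.

(* e_n(S, T) = f(B) / g(A) for A in S and B in T with disjoint supports,
   div f = n A and div g = n B.  By Weil reciprocity this does not depend on
   the choices; the junk value is 0, which is not a root of unity. *)
Definition is_weil (n : nat) (S T : set divisor) (z : K) : Prop :=
  exists A B f g,
    [/\ S A /\ T B, (forall P, coeff P A = 0 \/ coeff P B = 0),
        div_of f (A *+ n), div_of g (B *+ n) &
        z = eval_div f B / eval_div g A].

Definition weil_pairing (n : nat) (S T : set divisor) : K :=
  xget 0 [set z | is_weil n S T z]%classic.

End Curve.

(* Divisibility of p, as a binary form of degree m, into q, as a binary form
   of degree n: the quotient is a form of degree n - m.  For p of exact degree
   m and q of degree at most n this is p %| q; if p has smaller degree, its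
   roots at infinity have to be roots of q as well. *)
Definition form_dvd (K : fieldType) (m n : nat) (p q : {poly K}) : Prop :=
  exists r : {poly K}, (size r <= (n - m).+1)%N /\ q = r * p.

(* Main.v *)
(* Let [inf] be the sum of the two points at infinity, a canonical divisor.  Then
   [3 (D_i - inf)] is the divisor of [f_i = y - G_i], since the norm of [f_i] down to
   [K(x)] is [- lambda_i H_i ^ 3].  Weil reciprocity, written as "the product over all
   points of the tame symbols of two functions is 1", holds against [x - a] by comparing
   each fiber of [x] with the norm, hence against polynomials in [x].  Two functions
   [p + q y] and [p' + q' y] become, after multiplication by [q'] and [q], functions that
   differ by a polynomial, and the Steinberg relation reduces them to that case.

   Let [n_i] be the multiplicity of [D_i - inf] at a point, and [c_i] the leading
   coefficient of [f_i] there.  The symbol [(-1) ^ (n_1 n_2) c_1 ^ n_2 / c_2 ^ n_1] is a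
   cube root of the tame symbol of [f_1] and [f_2], and by reciprocity the product of these
   symbols over all points is [e_3(T_1, T_2)], with no need to make supports disjoint.
   Put [h = G_2 - G_1] and [s = G_2 + G_1].  If [H_1], [H_2] and [h] have no common root,
   the product is [(lambda_2 / lambda_1) Res(H_2, h) / Res(H_1, h)].  Each root of [h],
   possibly at infinity, lies on exactly one [H_1 - alpha_i H_2], and [H_1 = alpha_i H_2]
   there; so the product is the one of the [alpha_i ^ (1 - m_i)], where [m_i] counts the
   roots of [h] on [H_1 - alpha_i H_2].  As [m_i <= 2] and [m_1 + m_2 + m_3 = 3], it is 1
   exactly when no [m_i] is 2, that is, when no [H_1 - alpha_i H_2] divides [h].
   If there is a common root [r], the involution [y -> - y] replaces [T_2] by [- T_2] and
   [h] by [- s].  Since [s] does not vanish at [r] while all [H_1 - alpha_i H_2] do, none of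
   them divides [s], and the pairing is 1 by the first case.  None divides [h] either: in
   [h s = lambda_1 (H_1 - alpha_1 H_2) (H_1 - alpha_2 H_2) (H_1 - alpha_3 H_2)] the linear
   quotient would vanish twice at [r]. *)

From HB Require Import structures.
From Pilot Require Import Defs.
From mathcomp Require Import all_boot all_order all_algebra all_field.
From mathcomp Require Import boolp classical_sets.
From mathcomp.multinomials Require Import freeg.
From mathcomp Require Import qpoly ring lra zify.
Set Implicit Arguments.
Unset Strict Implicit.
Unset Printing Implicit Defensive.

Import Order.TTheory GRing.Theory Num.Theory.
Local Open Scope ring_scope.

(** * Function field *)

(** As [weil_pairing] is a choice with default value 0, two facts give its value: all admissible
    data yield the product of the local symbols, and some admissible data exist. For the first,
    admissible functions are [f_1] and [f_2] times constants and cubes. A cube changes the local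
    symbols by honest tame symbols, with product 1; a constant changes them by powers of it, with
    product 1 because the exponents are the coefficients of a divisor of degree 0. For the second,
    [D_1 - inf] and [D_2 - inf] always share the points at infinity, and [D_1] and [D_2] may meet.
    Adding the divisor of [1 / (x - c)] moves [D_2 - inf] off infinity; if [D_1] and [D_2] meet,
    subtracting the divisor of [H_1] turns [D_1 - inf] into [inf] minus the conjugate of [D_1]. Any
    other canonical divisor differs from [inf] by a principal one: a derivation is a function times
    the one with [x -> 2 y] and [y -> F'], which is dual to [dx / (2 y)], a differential with
    divisor [inf]. *)

Lemma fraction_quotient (R : idomainType) (a : {fraction R}) :
  exists p q, q != 0 /\ a = FracField.tofrac p / FracField.tofrac q.
Proof.
exists (frac (repr a)).1, (frac (repr a)).2; split; first exact: denom_ratioP.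
suff E : a * FracField.tofrac (frac (repr a)).2 = FracField.tofrac (frac (repr a)).1.
  by rewrite -E mulfK // tofrac_eq0 denom_ratioP.
rewrite -{1}[a]reprK; unlock FracField.tofrac; rewrite -[LHS]FracField.pi_mul /FracField.mulf.
apply/eqP; rewrite FracField.equivf_def.
have d0 := denom_ratioP (repr a).
rewrite (numer_Ratio _ (oner_neq0 _)) (denom_Ratio _ (oner_neq0 _)).
by rewrite !numden_Ratio ?mulr1 ?oner_neq0 // mulrC.
Qed.

Section FunctionField.
Variables (K : closedFieldType) (F : {poly K}).
Local Notation L := (funfield F).
Local Notation base := (qpolyC (curve_eq F)).

Lemma monic_curve_eq : curve_eq F \is monic.
Proof.
by rewrite monicE lead_coefDl ?lead_coefXn // size_polyXn size_polyN ltnS size_polyC; case: (_ != 0).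
Qed.

Lemma size_curve_eq : size (curve_eq F) = 3%N.
Proof.
by rewrite size_polyDl ?size_polyXn // size_polyN size_polyC; case: (_ != 0).
Qed.

(** The type [{poly %/ p}] is the quotient by [mk_monic p], which is ['X] unless [p] is monic of
    size greater than 1; here it is the intended modulus. *)
Lemma mk_curve_eq : mk_monic (curve_eq F) = curve_eq F.
Proof. by rewrite /mk_monic size_curve_eq monic_curve_eq. Qed.

HB.instance Definition _ :=
  GRing.RMorphism.copy (@poly_fun K F) (base \o @FracField.tofrac _).
HB.instance Definition _ :=
  GRing.RMorphism.copy (@const_fun K F) (@poly_fun K F \o polyC).

Lemma poly_funC c : poly_fun F c%:P = const_fun F c. Proof. by []. Qed.
Lemma poly_funX : poly_fun F 'X = x_fun F. Proof. by []. Qed.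

Lemma poly_funM p q : poly_fun F (p * q) = poly_fun F p * poly_fun F q.
Proof. exact: rmorphM. Qed.
Lemma poly_funD p q : poly_fun F (p + q) = poly_fun F p + poly_fun F q.
Proof. exact: rmorphD. Qed.
Lemma poly_funB p q : poly_fun F (p - q) = poly_fun F p - poly_fun F q.
Proof. exact: rmorphB. Qed.
Lemma poly_funN p : poly_fun F (- p) = - poly_fun F p. Proof. exact: rmorphN. Qed.
Lemma poly_funXn p n : poly_fun F (p ^+ n) = poly_fun F p ^+ n. Proof. exact: rmorphXn. Qed.
Lemma poly_fun0 : poly_fun F 0 = 0. Proof. exact: rmorph0. Qed.
Lemma poly_fun1 : poly_fun F 1 = 1. Proof. exact: rmorph1. Qed.

Lemma y_fun_sqr : y_fun F ^+ 2 = poly_fun F F.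
Proof.
rewrite /y_fun /qpolyX -rmorphXn /=; apply: val_inj => /=.
rewrite mk_curve_eq.
have -> : 'X^2 = 1 * curve_eq F + (FracField.tofrac F)%:P :> {poly {fraction {poly K}}}.
  by rewrite mul1r /curve_eq subrK.
rewrite Pdiv.RingMonic.rmodp_addl_mul_small ?monic_curve_eq //.
by rewrite size_curve_eq size_polyC; case: (_ != 0).
Qed.

Lemma base_decomp (f : L) : f = base (val f)`_0 + base (val f)`_1 * y_fun F.
Proof.
have sf : (size (val f) <= 2)%N.
  by rewrite -ltnS (leq_trans (size_mk_monic f)) // mk_curve_eq size_curve_eq.
apply: val_inj => /=.
rewrite !Pdiv.RingMonic.rmodp_mulmr ?monic_mk_monic //.
rewrite Pdiv.CommonRing.rmodp_small; last first.
  apply: (@leq_trans 3); last by rewrite mk_curve_eq size_curve_eq.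
  by rewrite ltnS mul_polyC (leq_trans (size_scale_leq _ _)) // size_polyX.
apply/polyP => i; rewrite coefD coefC coefCM coefX.
case: i => [|[|i]] /=; rewrite ?mulr0 ?mulr1 ?addr0 ?add0r //.
by rewrite nth_default // (leq_trans sf).
Qed.

Lemma base_indep a b : base a + base b * y_fun F = 0 -> a = 0 /\ b = 0.
Proof.
move/(congr1 val) => /=.
rewrite !Pdiv.RingMonic.rmodp_mulmr ?monic_mk_monic //.
rewrite Pdiv.CommonRing.rmodp_small; last first.
  apply: (@leq_trans 3); last by rewrite mk_curve_eq size_curve_eq.
  by rewrite ltnS mul_polyC (leq_trans (size_scale_leq _ _)) // size_polyX.
rewrite -/(0 : {poly {fraction {poly K}}}) => /polyP E.
move: (E 0%N) (E 1%N); rewrite !coef0 !coefD !coefCM !coefC !coefX /=.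
by rewrite !mulr0 !mulr1 !addr0 add0r.
Qed.

Lemma base_inj : injective base.
Proof. exact: fmorph_inj. Qed.

Lemma poly_fun_inj : injective (poly_fun F).
Proof. by move=> p q /base_inj/eqP; rewrite tofrac_eq => /eqP. Qed.

Definition conj_fun (f : L) : L := base (val f)`_0 - base (val f)`_1 * y_fun F.

Lemma conj_funE a b : conj_fun (base a + base b * y_fun F) = base a - base b * y_fun F.
Proof.
rewrite /conj_fun; set f := base a + _.
have [ea eb] : a - (val f)`_0 = 0 /\ b - (val f)`_1 = 0.
  apply: base_indep; rewrite !rmorphB mulrBl addrACA -opprD -base_decomp.
  by rewrite /f subrr.
by move/eqP: ea; move/eqP: eb; rewrite !subr_eq0 => /eqP -> /eqP ->.
Qed.

Lemma conj_fun_is_zmod_morphism : zmod_morphism conj_fun.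
Proof.
move=> f g; rewrite /conj_fun /= !coefB !rmorphB /=; ring.
Qed.

Lemma conj_fun_base a : conj_fun (base a) = base a.
Proof. by have := conj_funE a 0; rewrite !rmorph0 !mul0r addr0 subr0. Qed.

Lemma conj_fun_is_monoid_morphism : monoid_morphism conj_fun.
Proof.
split=> [|f g]; first by rewrite -(rmorph1 base) conj_fun_base.
rewrite (base_decomp f) (base_decomp g).
move: (val f)`_0 (val f)`_1 (val g)`_0 (val g)`_1 => a b c d.
set t := FracField.tofrac F.
have yy : y_fun F ^+ 2 = base t by exact: y_fun_sqr.
have -> : (base a + base b * y_fun F) * (base c + base d * y_fun F) =
    base (a * c + b * d * t) + base (a * d + b * c) * y_fun F.
  by rewrite !qpolyCD !qpolyCM -yy; ring.
apply: etrans (conj_funE (a * c + b * d * t) (a * d + b * c)) _.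
apply: etrans (esym (f_equal2 *%R (conj_funE a b) (conj_funE c d))).
by rewrite !qpolyCD !qpolyCM -yy; ring.
Qed.

HB.instance Definition _ :=
  GRing.isZmodMorphism.Build L L conj_fun conj_fun_is_zmod_morphism.
HB.instance Definition _ :=
  GRing.isMonoidMorphism.Build L L conj_fun conj_fun_is_monoid_morphism.

Lemma conj_fun_poly p : conj_fun (poly_fun F p) = poly_fun F p.
Proof. exact: conj_fun_base. Qed.

Lemma conj_fun_y : conj_fun (y_fun F) = - y_fun F.
Proof. by have := conj_funE 0 1; rewrite !rmorph0 !rmorph1 !mul1r add0r sub0r. Qed.

Lemma conj_funD f g : conj_fun (f + g) = conj_fun f + conj_fun g.
Proof. exact: rmorphD. Qed.

Lemma conj_funM f g : conj_fun (f * g) = conj_fun f * conj_fun g.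
Proof. exact: rmorphM. Qed.

Lemma conj_fun1 : conj_fun 1 = 1.
Proof. exact: rmorph1. Qed.

Lemma conj_funX f n : conj_fun (f ^+ n) = conj_fun f ^+ n.
Proof. exact: rmorphXn. Qed.

Opaque conj_fun.

Lemma conj_fun_unit f : f \is a GRing.unit -> conj_fun f \is a GRing.unit.
Proof.
move=> fu; have : conj_fun f * conj_fun f^-1 \is a GRing.unit.
  by rewrite -conj_funM mulrV // conj_fun1 unitr1.
by rewrite unitrM => /andP[cu _]; exact: cu.
Qed.

Lemma conj_funV f : f \is a GRing.unit -> conj_fun f^-1 = (conj_fun f)^-1.
Proof.
move=> fu; apply: (mulrI (conj_fun_unit fu)).
have -> : conj_fun f * conj_fun f^-1 = 1 by rewrite -conj_funM mulrV // conj_fun1.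
by rewrite mulrV // conj_fun_unit.
Qed.

Hypothesis F_sep : separable_poly F.
Hypothesis F_gt1 : (1 < size F)%N.

Lemma F_neq0 : F != 0.
Proof. by rewrite -size_poly_gt0 (ltn_trans _ F_gt1). Qed.

Lemma F_simple_root r : root F r -> ~~ root F^`() r.
Proof.
by move=> rF; rewrite rootE; apply: coprimep_root rF; move: F_sep; rewrite unlock.
Qed.

Lemma mup_simple r : root F r -> mup r F = 1%N.
Proof.
move=> rF; apply/eqP; rewrite eqn_leq mup_geq ?F_neq0 // expr1.
rewrite dvdp_XsubCl rF andbT mup_leq ?F_neq0 //; apply/negP => /dvdpP[q Fq].
have /negP[] := F_simple_root rF; apply/eqP.
have : ('X - r%:P).[r] = 0 by rewrite hornerXsubC subrr.
move: ('X - r%:P) Fq => s Fq s0.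
by rewrite Fq expr2 !derivM !(hornerM, hornerD) s0 !(mulr0, mul0r, addr0).
Qed.

(** In [p ^ 2 = q ^ 2 * F] a simple root of [F] would have even multiplicity on the left and odd
    multiplicity on the right. *)
Lemma F_nonsquare (a : {fraction {poly K}}) : a ^+ 2 != FracField.tofrac F.
Proof.
apply/eqP; have [p [q [q0 ->]]] := fraction_quotient a.
rewrite expr_div_n => /(canRL (divfK _)).
rewrite expf_neq0 ?tofrac_eq0 // -!rmorphXn -rmorphM /= => /(_ isT) /eqP.
rewrite tofrac_eq => /eqP pq.
have [r rF] : exists r, root F r by apply/closed_rootP; rewrite neq_ltn F_gt1 orbT.
have p0 : p != 0.
  by apply: contra_neq q0 => p0; move/esym/eqP: pq;
     rewrite p0 expr0n /= mulf_eq0 expf_eq0 (negbTE F_neq0) => /eqP.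
move/(congr1 (mup r)): pq; rewrite !expr2 !mupM ?mulf_neq0 ?F_neq0 //.
rewrite mup_simple //; lia.
Qed.

(** The quotient is only given as a ring with units, and this lemma stands in for a field structure.
    The inverse comes from the norm [a ^ 2 - b ^ 2 * F], which is nonzero because [F] is not a
    square in [K(x)]. *)
Lemma funfield_unitE (f : L) : (f \is a GRing.unit) = (f != 0).
Proof.
apply/idP/idP => [|f0]; first by apply: contraTneq => ->; rewrite unitr0.
have fE := base_decomp f; move: (val f)`_0 (val f)`_1 fE => a b fE.
have N0 : a ^+ 2 - b ^+ 2 * FracField.tofrac F != 0.
  apply: contra_neq f0 => N0; rewrite fE.
  have [b0|b0] := eqVneq b 0.
    move: N0; rewrite b0 expr0n /= mul0r subr0 => /eqP.
    by rewrite expf_eq0 /= => /eqP ->; rewrite !rmorph0 mul0r addr0.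
  have /eqP[] := F_nonsquare (a / b).
  by rewrite expr_div_n; apply: (canLR (mulfK _)); rewrite ?expf_neq0 // mulrC;
    apply/eqP; rewrite -subr_eq0 N0.
have : (f * (base a - base b * y_fun F)) \is a GRing.unit.
  have -> : f * (base a - base b * y_fun F) = base (a ^+ 2 - b ^+ 2 * FracField.tofrac F).
    have -> : base (a ^+ 2 - b ^+ 2 * FracField.tofrac F)
        = base a ^+ 2 - base b ^+ 2 * y_fun F ^+ 2.
      by rewrite y_fun_sqr -!rmorphXn -rmorphM -rmorphB.
    rewrite fE; ring.
  by rewrite rmorph_unit // unitfE.
by rewrite unitrM => /andP[].
Qed.

Lemma poly_fun_unit p : (poly_fun F p \is a GRing.unit) = (p != 0).
Proof. by rewrite funfield_unitE -(inj_eq poly_fun_inj) rmorph0. Qed.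

Lemma funfield_quotient (f : L) : exists p q s,
  s != 0 /\ f * poly_fun F s = poly_fun F p + poly_fun F q * y_fun F.
Proof.
rewrite (base_decomp f); move: (val f)`_0 (val f)`_1 => a b.
have [p [q [q0 ->]]] := fraction_quotient a.
have [r [s [s0 ->]]] := fraction_quotient b.
exists (p * s), (r * q), (q * s); split; first exact: mulf_neq0.
have E x u v : x * FracField.tofrac u = FracField.tofrac v ->
    base x * poly_fun F u = poly_fun F v.
  by rewrite /poly_fun => <-; rewrite rmorphM.
rewrite mulrDl [X in _ + X]mulrAC (E _ _ (p * s)); last first.
  by rewrite !rmorphM mulrA divfK ?tofrac_eq0.
rewrite (E _ _ (r * q)) // [q * s]mulrC.
by rewrite !rmorphM mulrA divfK ?tofrac_eq0.
Qed.

End FunctionField.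

(** * Charts *)

Section Charts.
Variables (K : closedFieldType) (F : {poly K}).
Local Notation L := (funfield F).
Hypothesis F_sep : separable_poly F.
Hypothesis F_size : size F = 7%N.
Hypothesis K_two : 2%:R != 0 :> K.

(* Unification would otherwise compute in the quotient ring and not return. *)
Opaque poly_fun const_fun x_fun y_fun conj_fun.

Lemma F_gt1 : (1 < size F)%N. Proof. by rewrite F_size. Qed.
Local Notation unitE := (funfield_unitE F_sep F_gt1).

Definition xeval (X : L) : {poly K} -> L := fun q => (map_poly (const_fun F) q).[X].
HB.instance Definition _ X :=
  GRing.RMorphism.copy (xeval X) (horner_eval X \o map_poly (const_fun F)).

Lemma xevalC X c : xeval X c%:P = const_fun F c.
Proof. by rewrite /xeval map_polyC hornerC. Qed.

Lemma xevalX X : xeval X 'X = X.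
Proof. by rewrite /xeval map_polyX hornerX. Qed.

Lemma xevalB X p q : xeval X (p - q) = xeval X p - xeval X q. Proof. exact: rmorphB. Qed.
Lemma xevalM X p q : xeval X (p * q) = xeval X p * xeval X q. Proof. exact: rmorphM. Qed.
Lemma xevalXn X p n : xeval X (p ^+ n) = xeval X p ^+ n. Proof. exact: rmorphXn. Qed.
Lemma xeval0 X : xeval X 0 = 0. Proof. exact: rmorph0. Qed.

Lemma xeval_XsubC X c : xeval X ('X - c%:P) = X - const_fun F c.
Proof. by rewrite rmorphB /= xevalX xevalC. Qed.

Lemma xeval_x p : xeval (x_fun F) p = poly_fun F p.
Proof.
elim/poly_ind: p => [|p c IH]; first by rewrite !rmorph0.
by rewrite !rmorphD !rmorphM /= IH xevalX xevalC poly_funC poly_funX.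
Qed.

Definition reverse_poly n (p : {poly K}) := \poly_(i < n.+1) p`_(n - i).

Lemma xeval_xV n (p : {poly K}) : (size p <= n.+1)%N ->
  x_fun F ^+ n * xeval (x_fun F)^-1 (reverse_poly n p) = poly_fun F p.
Proof.
have xu : x_fun F \is a GRing.unit by rewrite -poly_funX poly_fun_unit ?F_gt1 ?polyX_eq0.
move=> sp; have pE : p = \poly_(i < n.+1) p`_i.
  apply/polyP => i; rewrite coef_poly; case: ltnP => // ni.
  by rewrite nth_default // (leq_trans sp).
rewrite [in RHS]pE /reverse_poly !poly_def !rmorph_sum /= mulr_sumr.
rewrite (reindex_inj rev_ord_inj) /=; apply: eq_bigr => i _.
rewrite subSS subKn -1?ltnS //.
rewrite -!mul_polyC !rmorphM !rmorphXn /= xevalC xevalX poly_funC poly_funX.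
rewrite mulrCA; congr (_ * _); rewrite exprVn.
by rewrite -exprB ?leq_subr // subKn // -ltnS.
Qed.

Definition nonconst (X : L) := forall c, X != const_fun F c.

Lemma xeval_unit X p : nonconst X -> p != 0 -> xeval X p \is a GRing.unit.
Proof.
move=> Xnc p0; have [rs ->] := closed_field_poly_normal p.
rewrite -mul_polyC rmorphM /= xevalC unitrM; apply/andP; split.
  by rewrite rmorph_unit // unitfE lead_coef_eq0.
rewrite rmorph_prod; apply: rpred_prod => r _.
by rewrite /= xeval_XsubC unitE subr_eq0 Xnc.
Qed.

Lemma nonconst_x : nonconst (x_fun F).
Proof.
move=> c; rewrite -poly_funX -poly_funC (inj_eq (@poly_fun_inj _ F)).
by rewrite -subr_eq0 polyXsubC_eq0.
Qed.

Lemma x_fun_unit : x_fun F \is a GRing.unit.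
Proof. by rewrite -poly_funX poly_fun_unit ?F_gt1 ?polyX_eq0. Qed.

Lemma nonconst_xV : nonconst (x_fun F)^-1.
Proof.
move=> c; apply/eqP => xc.
have : x_fun F * const_fun F c = 1 by rewrite -xc mulrV // x_fun_unit.
rewrite -poly_funX -poly_funC -rmorphM -(rmorph1 (poly_fun F)).
move/poly_fun_inj/(congr1 (fun p => p.[0])); rewrite !hornerE => /eqP.
by rewrite eq_sym oner_eq0.
Qed.

Lemma y_fun_unit : y_fun F \is a GRing.unit.
Proof.
have : y_fun F ^+ 2 \is a GRing.unit by rewrite y_fun_sqr poly_fun_unit ?F_gt1 // -size_poly_gt0 F_size.
by rewrite unitrX_pos.
Qed.

(** The right-hand side of the equation for [Y ^ 2] in the chart of [P]; at infinity, with
    [X = 1 / x] and [Y = y / x ^ 3], it is [X ^ 6 * F (1 / X)]. *)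
Definition chart_poly (P : Defs.point F) := if P is inl _ then F else reverse_poly 6 F.

Implicit Types P : Defs.point F.

Local Notation cX P := (coords P).1.
Local Notation cY P := (coords P).2.
Local Notation c1 P := (center P).1.
Local Notation c2 P := (center P).2.

Lemma chart_nonconst P : nonconst (cX P).
Proof. by case: P => ? /=; [exact: nonconst_x | exact: nonconst_xV]. Qed.

Lemma coords_sqr P : cY P ^+ 2 = xeval (cX P) (chart_poly P).
Proof.
case: P => p /=; first by rewrite xeval_x y_fun_sqr.
rewrite expr_div_n y_fun_sqr -(xeval_xV (n := 6)) ?F_size // -exprM mulrAC.
by rewrite mulrV ?mul1r // unitrX // x_fun_unit.
Qed.

Lemma center_sqr P : c2 P ^+ 2 = (chart_poly P).[c1 P].
Proof.
case: P => [[[a b] /= /eqP]|[s /= /eqP]] // ->.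
by rewrite horner_coef0 coef_poly.
Qed.

Lemma cY_unit P : cY P \is a GRing.unit.
Proof.
case: P => p /=; first exact: y_fun_unit.
by rewrite unitrM unitrV y_fun_unit unitrX // x_fun_unit.
Qed.

Lemma conj_x : conj_fun (x_fun F) = x_fun F.
Proof. by rewrite -poly_funX conj_fun_poly. Qed.

Lemma conj_const c : conj_fun (const_fun F c) = const_fun F c.
Proof. by rewrite -poly_funC conj_fun_poly. Qed.

Lemma conj_cX P : conj_fun (cX P) = cX P.
Proof.
case: P => p /=; first exact: conj_x.
by rewrite conj_funV ?x_fun_unit // conj_x.
Qed.

Lemma conj_cY P : conj_fun (cY P) = - cY P.
Proof.
case: P => p /=; first exact: conj_fun_y.
by rewrite conj_funM conj_funV ?unitrX ?x_fun_unit // conj_funX conj_x conj_fun_y mulNr.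
Qed.

Lemma conj_xeval P q : conj_fun (xeval (cX P) q) = xeval (cX P) q.
Proof.
elim/poly_ind: q => [|p c IH]; first by rewrite (rmorph0 (xeval _)) (rmorph0 (@conj_fun K F)).
by rewrite rmorphD rmorphM /= conj_funD conj_funM IH xevalX xevalC conj_cX conj_const.
Qed.

Lemma xeval_inj P : injective (xeval (cX P)).
Proof.
move=> p q /eqP; rewrite -subr_eq0 -rmorphB /=; apply: contraTeq.
rewrite -subr_eq0 => /(xeval_unit (@chart_nonconst P)).
by rewrite unitE.
Qed.

(** Conjugation fixes [X] and negates [Y], so the relation and its conjugate add up to
    [2 * a = 0]. *)
Lemma chart_indep P a b : xeval (cX P) a + xeval (cX P) b * cY P = 0 -> a = 0 /\ b = 0.
Proof.
move=> E; have := congr1 (@conj_fun K F) E.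
rewrite conj_funD conj_funM (rmorph0 (@conj_fun K F)) !conj_xeval conj_cY mulrN => E'.
have a0 : a = 0.
  have : xeval (cX P) (2%:R%:P * a) = 0.
    rewrite rmorphM /= polyC_natr rmorph_nat mulr_natl mulr2n -[RHS]addr0 -{1}E -E'.
    ring.
  rewrite -(rmorph0 (xeval (cX P))) => /xeval_inj/eqP.
  by rewrite mulf_eq0 polyC_eq0 (negbTE K_two) => /eqP.
split=> //; move: E; rewrite a0 rmorph0 add0r => /(congr1 (fun z => z / cY P)).
rewrite mulrK ?cY_unit // mul0r -(rmorph0 (xeval (cX P))); exact: xeval_inj.
Qed.

Lemma chart_fun_is_zmod_morphism P : zmod_morphism (chart_fun P).
Proof. exact: (rmorphB (horner_eval (cY P) \o map_poly (xeval (cX P)))). Qed.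

Lemma chart_fun_is_monoid_morphism P : monoid_morphism (chart_fun P).
Proof.
split; first exact: (rmorph1 (horner_eval (cY P) \o map_poly (xeval (cX P)))).
exact: (rmorphM (horner_eval (cY P) \o map_poly (xeval (cX P)))).
Qed.

HB.instance Definition _ P := GRing.isZmodMorphism.Build {poly {poly K}} L
  (chart_fun P) (chart_fun_is_zmod_morphism P).
HB.instance Definition _ P := GRing.isMonoidMorphism.Build {poly {poly K}} L
  (chart_fun P) (chart_fun_is_monoid_morphism P).

HB.instance Definition _ (P : Defs.point F) := GRing.RMorphism.copy (chart_val P)
  (horner_eval (center P).1 \o horner_eval (center P).2%:P).

Lemma chart_funE P p : chart_fun P p = (map_poly (xeval (cX P)) p).[cY P].
Proof. by []. Qed.
Lemma chart_funC P a : chart_fun P a%:P = xeval (cX P) a.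
Proof. by rewrite chart_funE map_polyC hornerC. Qed.
Lemma chart_funX P : chart_fun P 'X = cY P.
Proof. by rewrite chart_funE map_polyX hornerX. Qed.
Lemma chart_valC (P : Defs.point F) a : chart_val P a%:P = a.[c1 P].
Proof. by rewrite /chart_val hornerC. Qed.
Lemma chart_valX (P : Defs.point F) : chart_val P 'X = c2 P.
Proof. by rewrite /chart_val hornerX hornerC. Qed.

Lemma chart_funD P p q : chart_fun P (p + q) = chart_fun P p + chart_fun P q.
Proof. exact: rmorphD. Qed.
Lemma chart_funB P p q : chart_fun P (p - q) = chart_fun P p - chart_fun P q.
Proof. exact: rmorphB. Qed.
Lemma chart_funN P p : chart_fun P (- p) = - chart_fun P p.
Proof. exact: rmorphN. Qed.
Lemma chart_valN P p : chart_val P (- p) = - chart_val P p.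
Proof. exact: rmorphN. Qed.
Lemma chart_fun0 P : chart_fun P 0 = 0. Proof. exact: rmorph0. Qed.
Lemma chart_funM P p q : chart_fun P (p * q) = chart_fun P p * chart_fun P q.
Proof. exact: rmorphM. Qed.
Lemma chart_funXn P p n : chart_fun P (p ^+ n) = chart_fun P p ^+ n.
Proof. exact: rmorphXn. Qed.
Lemma chart_fun1 P : chart_fun P 1 = 1. Proof. exact: rmorph1. Qed.
Lemma chart_valD P p q : chart_val P (p + q) = chart_val P p + chart_val P q.
Proof. exact: rmorphD. Qed.
Lemma chart_valB P p q : chart_val P (p - q) = chart_val P p - chart_val P q.
Proof. exact: rmorphB. Qed.
Lemma chart_valM P p q : chart_val P (p * q) = chart_val P p * chart_val P q.
Proof. exact: rmorphM. Qed.
Lemma chart_valXn P p n : chart_val P (p ^+ n) = chart_val P p ^+ n.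
Proof. exact: rmorphXn. Qed.
Lemma chart_val1 P : chart_val P 1 = 1. Proof. exact: rmorph1. Qed.

(** Division by [Y ^ 2 - chart_poly P], which vanishes both as a function and at the center. Since
    the remainder is unique by [chart_indep], the value at [P] depends only on the function and not
    on the polynomial that represents it. *)
Lemma chart_reduce P p : exists a b,
  chart_fun P p = xeval (cX P) a + xeval (cX P) b * cY P /\
  chart_val P p = a.[c1 P] + b.[c1 P] * c2 P.
Proof.
pose d : {poly {poly K}} := 'X^2 - (chart_poly P)%:P.
have szC : (size (- (chart_poly P)%:P)%R < 3)%N.
  by rewrite size_polyN size_polyC; case: (_ != 0).
have dm : d \is monic.
  by rewrite monicE lead_coefDl ?lead_coefXn // size_polyXn.
have sd : size d = 3%N by rewrite size_polyDl ?size_polyXn.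
have := Pdiv.RingMonic.rdivp_eq dm p.
set q := Pdiv.CommonRing.rdivp _ _; set r := Pdiv.CommonRing.rmodp _ _ => pE.
have sr : (size r <= 2)%N by rewrite -ltnS -sd Pdiv.CommonRing.ltn_rmodp monic_neq0.
have rE : r = (r`_0)%:P + (r`_1)%:P * 'X.
  apply/polyP => i; rewrite coefD coefC coefCM coefX.
  case: i => [|[|i]] /=; rewrite ?mulr0 ?mulr1 ?addr0 ?add0r //.
  by rewrite nth_default // (leq_trans sr).
have df : chart_fun P d = 0.
  by rewrite rmorphB rmorphXn /= chart_funX chart_funC coords_sqr subrr.
have dv : chart_val P d = 0.
  by rewrite rmorphB rmorphXn /= chart_valX chart_valC center_sqr subrr.
exists r`_0, r`_1; rewrite pE !rmorphD !rmorphM /= df dv !mulr0 !add0r.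
rewrite [in chart_fun P r]rE [in chart_val P r]rE.
by rewrite !rmorphD !rmorphM /= chart_funX chart_valX !chart_funC !chart_valC.
Qed.

Lemma chart_val0 P p : chart_fun P p = 0 -> chart_val P p = 0.
Proof.
have [a [b [-> ->]]] := chart_reduce P p.
by move/chart_indep => [-> ->]; rewrite !horner0 mul0r addr0.
Qed.

Lemma chart_val_eq P p q : chart_fun P p = chart_fun P q -> chart_val P p = chart_val P q.
Proof.
by move/eqP; rewrite -subr_eq0 -rmorphB => /eqP/chart_val0/eqP; rewrite rmorphB /= subr_eq0 => /eqP.
Qed.

Lemma chart_fun_unit P p : chart_val P p != 0 -> chart_fun P p \is a GRing.unit.
Proof. by rewrite unitE; apply: contra_neq; exact: chart_val0. Qed.

Lemma chart_quotient P (f : L) : exists a b s,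
  s != 0 /\ f * xeval (cX P) s = xeval (cX P) a + xeval (cX P) b * cY P.
Proof.
have [p [q [s [s0 E]]]] := funfield_quotient f.
case: P => P /=; first by exists p, q, s; rewrite !xeval_x.
pose n := maxn (size p) (maxn (size q) (size s)).
have sE (r : {poly K}) : (size r <= n)%N -> poly_fun F r = x_fun F ^+ n * xeval (x_fun F)^-1 (reverse_poly n r).
  by move=> sr; rewrite xeval_xV // leqW.
have [sp sq ss] : [/\ size p <= n, size q <= n & size s <= n]%N by rewrite /n; split; lia.
(* With [X = 1 / x] one has [y = x ^ 3 * Y]; dividing the relation by [x ^ n * x ^ 3] puts a factor
   [X ^ 3] on the terms without [Y]. *)
exists ('X^3 * reverse_poly n p), (reverse_poly n q), ('X^3 * reverse_poly n s).
have xu := x_fun_unit; split.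
  apply: mulf_neq0; first by rewrite monic_neq0 ?monicXn.
  apply: contra_neq s0 => s0; apply: (@poly_fun_inj _ F).
  by rewrite sE // s0 (rmorph0 (xeval _)) (rmorph0 (poly_fun F)) mulr0.
move: E; rewrite !sE // => E.
have xnu : x_fun F ^+ n \is a GRing.unit by rewrite unitrX.
have x3u : x_fun F ^+ 3 \is a GRing.unit by rewrite unitrX.
apply: (mulrI xnu); apply: (mulrI x3u).
have xM a : xeval (x_fun F)^-1 ('X^3 * a) = (x_fun F ^+ 3)^-1 * xeval (x_fun F)^-1 a.
  by rewrite (rmorphM (xeval _)) (rmorphXn (xeval _)) /= xevalX exprVn.
rewrite !xM.
have -> (z w : L) : x_fun F ^+ 3 * (x_fun F ^+ n * (z * ((x_fun F ^+ 3)^-1 * w))) =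
  (x_fun F ^+ 3 / x_fun F ^+ 3) * (z * (x_fun F ^+ n * w)) by ring.
rewrite E mulrV // mul1r.
set A := xeval _ _; set B := xeval _ _; rewrite -[LHS]mul1r -(mulrV x3u).
ring.
Qed.

End Charts.

(** * Leading terms and tame symbols *)

Section LeadingTerms.
Variables (K : closedFieldType) (F : {poly K}).
Local Notation L := (funfield F).
Hypothesis F_sep : separable_poly F.
Hypothesis F_size : size F = 7%N.
Hypothesis K_two : 2%:R != 0 :> K.
Implicit Types (P : Defs.point F) (f g : L) (n m : int) (c d : K).

Opaque poly_fun const_fun x_fun y_fun conj_fun.

Local Notation unitE := (funfield_unitE F_sep (F_gt1 F_size)).
Local Notation cX P := (coords P).1.
Local Notation cY P := (coords P).2.
Local Notation c1 P := (center P).1.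
Local Notation c2 P := (center P).2.

Definition unif_poly P : {poly {poly K}} :=
  if c2 P != 0 then ('X - (c1 P)%:P)%:P else 'X.

Lemma chart_fun_unif P : chart_fun P (unif_poly P) = uniformizer P.
Proof.
rewrite /unif_poly /uniformizer; case: ifP => _; last exact: chart_funX.
by rewrite chart_funC xeval_XsubC.
Qed.

Lemma chart_val_unif P : chart_val P (unif_poly P) = 0.
Proof.
rewrite /unif_poly; case: (eqVneq (c2 P) 0) => /= [c20|_].
  by rewrite chart_valX.
by rewrite chart_valC hornerXsubC subrr.
Qed.

Lemma uniformizer_unit P : uniformizer P \is a GRing.unit.
Proof.
rewrite /uniformizer; case: ifP => _; last exact: cY_unit.
by rewrite unitE subr_eq0 chart_nonconst.
Qed.

Lemma uniformizerXz_unit P n : uniformizer P ^ n \is a GRing.unit.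
Proof. exact/unitrXz/uniformizer_unit. Qed.

Lemma uniformizerD P n m : uniformizer P ^ (n + m) = uniformizer P ^ n * uniformizer P ^ m.
Proof. exact/exprzDr/uniformizer_unit. Qed.

(* [f = c t ^ n + (higher order terms)] at [P], for the uniformizer [t] of [Defs]. *)
Definition lead P f n c := exists u v,
  [/\ chart_val P u != 0, chart_val P v != 0,
      chart_fun P v * f = uniformizer P ^ n * chart_fun P u &
      c = chart_val P u / chart_val P v].

Lemma lead_uniq P f n m c d : lead P f n c -> lead P f m d -> n = m /\ c = d.
Proof.
move=> [u [v [u0 v0 E ->]]] [u' [v' [u0' v0' E' ->]]].
have uu := @chart_fun_unit _ _ F_sep F_size K_two P _.
have key : uniformizer P ^ n * (chart_fun P u * chart_fun P v') =
           uniformizer P ^ m * (chart_fun P u' * chart_fun P v).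
  by rewrite mulrA -E mulrA -E'; ring.
(* After division by [t ^ i] the left side does not vanish at [P], while the right side keeps a
   positive power of [t]. *)
have aux (i j : int) (a b : {poly {poly K}}) : chart_val P a != 0 -> (i < j) ->
    uniformizer P ^ i * chart_fun P a = uniformizer P ^ j * chart_fun P b -> False.
  move=> a0 ij; have [k kE] : exists k : nat, j = i + k.+1%:Z.
    by exists (absz (j - i)).-1; lia.
  rewrite kE uniformizerD -mulrA => /(mulrI (uniformizerXz_unit P i)).
  rewrite -chart_fun_unif -exprnP -chart_funXn -chart_funM => /(chart_val_eq F_sep F_size K_two).
  rewrite chart_valM chart_valXn chart_val_unif expr0n /= mul0r => a0'.
  by rewrite a0' eqxx in a0.
have nm : n = m.
  move: key; rewrite -!chart_funM; case: (ltgtP n m) => // nm.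
    by move/aux => -[] //; rewrite chart_valM mulf_neq0.
  by move/esym/aux => -[] //; rewrite chart_valM mulf_neq0.
split=> //; move: key; rewrite nm => /(mulrI (uniformizerXz_unit P m)).
rewrite -!chart_funM => /(chart_val_eq F_sep F_size K_two); rewrite !chart_valM => key.
by apply/eqP; rewrite eqr_div //; apply/eqP.
Qed.

Lemma lead_unit P f n c : lead P f n c -> f \is a GRing.unit.
Proof.
move=> [u [v [u0 v0 E _]]].
have : chart_fun P v * f \is a GRing.unit.
  by rewrite E unitrM uniformizerXz_unit chart_fun_unit.
by rewrite unitrM => /andP[].
Qed.

Lemma lead_neq0 P f n c : lead P f n c -> c != 0.
Proof. by move=> [u [v [u0 v0 _ ->]]]; rewrite mulf_neq0 ?invr_eq0. Qed.

Lemma leadM P f g n m c d : lead P f n c -> lead P g m d -> lead P (f * g) (n + m) (c * d).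
Proof.
move=> [u [v [u0 v0 E ->]]] [u' [v' [u0' v0' E' ->]]].
exists (u * u'), (v * v'); rewrite !chart_funM !chart_valM !mulf_neq0 //; split=> //.
  by rewrite mulrACA E E' uniformizerD; ring.
by rewrite mulf_div.
Qed.

Lemma leadV P f n c : lead P f n c -> lead P f^-1 (- n) c^-1.
Proof.
move=> lf; have fu := lead_unit lf; have [u [v [u0 v0 E ->]]] := lf.
exists v, u; split=> //; last by rewrite invf_div.
apply: (mulIr fu); rewrite mulrVK //; apply: (mulrI (uniformizerXz_unit P n)).
by rewrite -E !mulrA -uniformizerD subrr expr0z mul1r.
Qed.

Lemma lead_regular P p : chart_val P p != 0 -> lead P (chart_fun P p) 0 (chart_val P p).
Proof.
move=> p0; exists p, 1; rewrite chart_fun1 chart_val1; split=> //.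
- exact: oner_neq0.
- by rewrite divr1.
Qed.

Lemma lead1 P : lead P 1 0 1.
Proof.
have := @lead_regular P 1; rewrite chart_fun1 chart_val1.
by apply; exact: oner_neq0.
Qed.

Lemma leadX P f n c k : lead P f n c -> lead P (f ^+ k) (n * k%:Z) (c ^+ k).
Proof.
move=> lf; elim: k => [|k IH]; first by rewrite !expr0 mulr0; exact: lead1.
by rewrite !exprS intS mulrDr mulr1; apply: leadM.
Qed.

Lemma lead_uniformizer P : lead P (uniformizer P) 1 1.
Proof.
exists 1, 1; rewrite !chart_fun1 !chart_val1; split=> //.
- exact: oner_neq0.
- exact: oner_neq0.
- by rewrite mul1r mulr1 expr1z.
- by rewrite divr1.
Qed.

(** At a point with [Y = 0] the equation becomes [Y ^ 2 = E * (X - c)] with [E] invertible there. So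
    [X - c] has order 2 with respect to the uniformizer [Y], and leading coefficient [1 / E (c)]. At
    infinity [Y = 0] is impossible, as the coefficient of [x ^ 6] in [F] is nonzero. *)
Lemma chart_simple_root P : c2 P = 0 -> exists E,
  chart_poly P = E * ('X - (c1 P)%:P) /\ E.[c1 P] = (chart_poly P)^`().[c1 P] /\ E.[c1 P] != 0.
Proof.
move=> c20; have rP : root (chart_poly P) (c1 P) by rewrite rootE -center_sqr c20 expr0n.
have /factor_theorem[E EP] := rP; exists E; split=> //.
have EE : E.[c1 P] = (chart_poly P)^`().[c1 P].
  by rewrite EP derivM derivXsubC mulr1 hornerD hornerM hornerXsubC subrr mulr0 add0r.
split=> //; rewrite EE; case: P c20 rP {E EP EE} => [p|[s /= sP]] /=.
  by move=> _ /(F_simple_root F_sep).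
move=> s0; move: sP; rewrite s0 expr0n /= eq_sym => F6.
have /eqP := F_neq0 (F_gt1 F_size); case; apply/eqP.
by rewrite -lead_coef_eq0 lead_coefE F_size.
Qed.

Definition ramif P : nat := if c2 P == 0 then 2 else 1.
Definition XsubC_lc P : K := if c2 P == 0 then ((chart_poly P)^`().[c1 P])^-1 else 1.

Lemma lead_XsubC P : lead P (cX P - const_fun F (c1 P)) (ramif P)%:Z (XsubC_lc P).
Proof.
rewrite /ramif /XsubC_lc; case: (eqVneq (c2 P) 0) => [c20|c20]; last first.
  by have := lead_uniformizer P; rewrite /uniformizer c20.
have [E [EP [EE E0]]] := chart_simple_root c20.
exists 1, E%:P; rewrite chart_fun1 chart_val1 chart_valC; split=> //.
- exact: oner_neq0.
- rewrite chart_funC -xeval_XsubC -xevalM -EP -(coords_sqr F_sep F_size) mulr1.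
  by rewrite /uniformizer c20 eqxx.
- by rewrite EE div1r.
Qed.

Lemma lead_xeval P (p q : {poly K}) k : p = ('X - (c1 P)%:P) ^+ k * q -> q.[c1 P] != 0 ->
  lead P (xeval (cX P) p) (ramif P * k)%N%:Z (XsubC_lc P ^+ k * q.[c1 P]).
Proof.
move=> -> q0; rewrite xevalM xevalXn xeval_XsubC PoszM -[X in lead _ _ X]addr0.
apply: leadM; first exact: leadX (lead_XsubC P).
rewrite -chart_funC -chart_valC; apply: lead_regular; by rewrite chart_valC.
Qed.

Lemma lead_xeval_exists P (p : {poly K}) : p != 0 -> exists n c, lead P (xeval (cX P) p) n c.
Proof.
move=> p0; have [k [q q0 E]] := multiplicity_XsubC p (c1 P).
by eexists; eexists; apply: (@lead_xeval P p q k); rewrite 1?mulrC //; move: q0; rewrite p0.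
Qed.

(** If the function vanishes at [P], there are two cases. At a ramification point [a] vanishes and
    [b] does not, and [E * (X - c) = Y ^ 2] exhibits a simple zero. Elsewhere the conjugate
    [a - b * Y] has value [- 2 * b * Y], which is nonzero, so the order is that of the norm, a
    polynomial in [X]. *)
Lemma coprime_lead_exists P a b : coprimep a b ->
  exists n c, lead P (xeval (cX P) a + xeval (cX P) b * cY P) n c.
Proof.
move=> cab; set f := _ + _.
have root_ab : a.[c1 P] = 0 -> b.[c1 P] != 0.
  by move=> /eqP ar; apply: coprimep_root cab ar.
pose p := a%:P + b%:P * 'X.
have fE : f = chart_fun P p by rewrite chart_funD chart_funM chart_funX !chart_funC.
have vE : chart_val P p = a.[c1 P] + b.[c1 P] * c2 P.
  by rewrite chart_valD chart_valM chart_valX !chart_valC.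
have [v0|v0] := eqVneq (chart_val P p) 0; last first.
  by exists 0, (chart_val P p); rewrite fE; apply: lead_regular.
have aE : a.[c1 P] = - (b.[c1 P] * c2 P) by apply/eqP; rewrite -addr_eq0 -vE v0.
have [c20|c20] := eqVneq (c2 P) 0.
  have a0 : a.[c1 P] = 0 by rewrite aE c20 mulr0 oppr0.
  have [E [EP [_ E0]]] := chart_simple_root c20.
  have /factor_theorem[a' aE'] : root a (c1 P) by rewrite rootE a0.
  pose u := a'%:P * 'X + (b * E)%:P.
  exists 1, (chart_val P u / E.[c1 P]); exists u, E%:P.
  rewrite !chart_valC; split=> //.
    rewrite chart_valD chart_valM chart_valX !chart_valC c20 mulr0 add0r hornerM.
    by rewrite mulf_neq0 // root_ab.
  rewrite /uniformizer c20 eqxx /= expr1z chart_funC chart_funD chart_funM chart_funX !chart_funC.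
  rewrite /f mulrDr aE' !xevalM.
  have -> : xeval (cX P) E * (xeval (cX P) a' * xeval (cX P) ('X - (c1 P)%:P)) =
     xeval (cX P) a' * (cY P * cY P).
    by rewrite -expr2 (coords_sqr F_sep F_size) EP xevalM; ring.
  ring.
have b0 : b.[c1 P] != 0.
  by apply/eqP => b0; move: (root_ab); rewrite aE b0 mul0r oppr0 eqxx => /(_ erefl).
pose p' := a%:P - b%:P * 'X.
have v0' : chart_val P p' != 0.
  rewrite chart_valB chart_valM chart_valX !chart_valC aE -opprD oppr_eq0.
  by rewrite -mulr2n -mulr_natl !mulf_neq0.
have fp' : f * chart_fun P p' = xeval (cX P) (a ^+ 2 - b ^+ 2 * chart_poly P).
  rewrite chart_funB chart_funM chart_funX !chart_funC xevalB (xevalM _ (b ^+ 2)) !xevalXn.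
  by rewrite -(coords_sqr F_sep F_size) /f; ring.
have fu : f \is a GRing.unit.
  rewrite unitE; apply/eqP => /(chart_indep F_sep F_size K_two)[_ b00].
  by rewrite b00 horner0 eqxx in b0.
have N0 : a ^+ 2 - b ^+ 2 * chart_poly P != 0.
  have : f * chart_fun P p' \is a GRing.unit by rewrite unitrM fu chart_fun_unit.
  by rewrite fp' unitE; apply: contra_neq => ->; rewrite xeval0.
have [n [c lN]] := lead_xeval_exists P N0.
exists (n + - 0), (c * (chart_val P p')^-1).
have -> : f = xeval (cX P) (a ^+ 2 - b ^+ 2 * chart_poly P) * (chart_fun P p')^-1.
  by rewrite -fp' mulrK // chart_fun_unit.
by apply: leadM lN _; apply: leadV; apply: lead_regular.
Qed.

Lemma lead_exists P f : f \is a GRing.unit -> exists n c, lead P f n c.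
Proof.
move=> fu; have [a [b [s [s0 E]]]] := chart_quotient F_sep F_size K_two P f.
have su : xeval (cX P) s \is a GRing.unit by rewrite (xeval_unit F_sep F_size) //; apply: chart_nonconst.
have ab0 : gcdp a b != 0.
  apply: contraTneq fu => /eqP; rewrite gcdp_eq0 => /andP[/eqP a0 /eqP b0].
  move: E; rewrite a0 b0 !xeval0 mul0r addr0 => fs0.
  by rewrite -(mulrK su f) fs0 mul0r unitr0.
have [n [c lg]] := lead_xeval_exists P ab0.
have cab : coprimep (a %/ gcdp a b) (b %/ gcdp a b).
  apply: coprimep_div_gcd; apply: contra_neqT ab0; rewrite negb_or !negbK => /andP[/eqP-> /eqP->].
  by rewrite gcdp0.
have [m [d lab]] := coprime_lead_exists P cab.
have [k [e ls]] := lead_xeval_exists P s0.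
exists (n + m + - k), (c * d * e^-1).
have -> : f = xeval (cX P) (gcdp a b) * (xeval (cX P) (a %/ gcdp a b) +
    xeval (cX P) (b %/ gcdp a b) * cY P) * (xeval (cX P) s)^-1.
  rewrite mulrDr mulrA -!xevalM ![gcdp a b * _]mulrC !divpK ?dvdp_gcdl ?dvdp_gcdr //.
  by rewrite -E mulrK.
by apply: leadM (leadM lg lab) (leadV ls).
Qed.

End LeadingTerms.

(** * Formal properties of the tame symbol *)

Section Symbol.
Variable K : fieldType.
Implicit Types (a b : int) (x y : K).

(* The tame symbol of functions of orders [a] and [b] with leading coefficients [x] and [y]. *)
Definition symb a b x y : K := (-1) ^ (a * b) * x ^ b / y ^ a.

Lemma N1_neq0 : (-1 : K) != 0.
Proof. by rewrite oppr_eq0 oner_neq0. Qed.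

Lemma symb_neq0 a b x y : x != 0 -> y != 0 -> symb a b x y != 0.
Proof. by move=> x0 y0; rewrite !mulf_neq0 ?invr_eq0 ?expfz_neq0 ?N1_neq0. Qed.

Lemma symbMl a a' b x x' y : x != 0 -> x' != 0 -> y != 0 ->
  symb (a + a') b (x * x') y = symb a b x y * symb a' b x' y.
Proof.
move=> x0 x0' y0; rewrite /symb mulrDl !expfzDr ?N1_neq0 // expfzMl invfM.
move: (_ ^ _) (_ ^ _) (_ ^ _) (_ ^ _) (_ ^ _)^-1 (_ ^ _)^-1 => A B C D E G.
ring.
Qed.

Lemma invr_N1z a : ((-1) ^ a)^-1 = (-1) ^ a :> K.
Proof. by rewrite invr_expz -exprz_inv invrN1. Qed.

Lemma N1z_sqr a : (-1) ^ (a * a) = (-1) ^ a :> K.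
Proof.
case: a => n; first by rewrite -PoszM -!exprnP -signr_odd -[RHS]signr_odd oddM andbb.
rewrite NegzE mulrNN -PoszM -[in RHS]invr_N1z invr_expz opprK -!exprnP.
by rewrite -signr_odd -[RHS]signr_odd oddM andbb.
Qed.

Lemma symbC a b x y : symb b a y x = (symb a b x y)^-1.
Proof.
rewrite /symb !invfM invrK invr_N1z [b * a]mulrC.
exact: mulrAC.
Qed.

End Symbol.

Section TameSymbols.
Variables (K : closedFieldType) (F : {poly K}).
Local Notation L := (funfield F).
Hypothesis F_sep : separable_poly F.
Hypothesis F_size : size F = 7%N.
Hypothesis K_two : 2%:R != 0 :> K.
Implicit Types (P : Defs.point F) (f g : L) (n m : int) (c d : K).

Opaque poly_fun const_fun x_fun y_fun conj_fun.

Local Notation lead_uniq := (lead_uniq F_sep F_size K_two).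
Local Notation leadM := (leadM F_sep F_size).
Local Notation leadV := (leadV F_sep F_size K_two).
Local Notation lead_exists := (lead_exists F_sep F_size K_two).

Definition lc P f : K := xget 0 [set c | exists n, lead P f n c]%classic.

Lemma lead_ord P f n c : lead P f n c -> ord P f = n.
Proof.
move=> lf; apply: xget_unique => [|m /= [u [v [u0 v0 E]]]].
  by case: lf => u [v [u0 v0 E _]]; exists u, v.
by apply: (lead_uniq (d := c) _ lf).1; exists u, v; split; first 3 last.
Qed.

Lemma lead_lc P f n c : lead P f n c -> lc P f = c.
Proof.
move=> lf; apply: xget_unique => [|d /= [m lf']]; first by exists n.
exact: (lead_uniq lf' lf).2.
Qed.

Lemma leadP P f : f \is a GRing.unit -> lead P f (ord P f) (lc P f).
Proof.
by move=> /(lead_exists P)[n [c lf]]; rewrite (lead_ord lf) (lead_lc lf).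
Qed.

Lemma lc_neq0 P f : f \is a GRing.unit -> lc P f != 0.
Proof. by move/(leadP P)/lead_neq0. Qed.

Lemma lead_value P f c : lead P f 0 c -> value P f = c.
Proof.
move=> [u [v [u0 v0 E cE]]]; rewrite expr0z mul1r in E.
apply: xget_unique => [|d /= [u' [v' [v0' E' ->]]]]; first by exists u, v.
have : chart_fun P (u' * v) = chart_fun P (u * v').
  by rewrite !chart_funM -E -E'; ring.
move/(chart_val_eq F_sep F_size K_two); rewrite !chart_valM cE => key.
by apply/eqP; rewrite eqr_div //; apply/eqP.
Qed.

Section Units.
Variable P : Defs.point F.

Lemma ordM f g : f \is a GRing.unit -> g \is a GRing.unit ->
  ord P (f * g) = ord P f + ord P g.
Proof. by move=> fu gu; apply: lead_ord (leadM (leadP P fu) (leadP P gu)). Qed.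

Lemma lcM f g : f \is a GRing.unit -> g \is a GRing.unit ->
  lc P (f * g) = lc P f * lc P g.
Proof. by move=> fu gu; apply: lead_lc (leadM (leadP P fu) (leadP P gu)). Qed.

Lemma ordV f : f \is a GRing.unit -> ord P f^-1 = - ord P f.
Proof. by move=> fu; apply: lead_ord (leadV (leadP P fu)). Qed.

Lemma ord1 : ord P 1 = 0.
Proof. exact: lead_ord (lead1 P). Qed.

Lemma lc1 : lc P 1 = 1.
Proof. exact: lead_lc (lead1 P). Qed.

Lemma ordX f k : f \is a GRing.unit -> ord P (f ^+ k) = ord P f * k%:Z.
Proof. by move=> fu; apply: lead_ord (leadX F_sep F_size k (leadP P fu)). Qed.

Lemma lcX f k : f \is a GRing.unit -> lc P (f ^+ k) = lc P f ^+ k.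
Proof. by move=> fu; apply: lead_lc (leadX F_sep F_size k (leadP P fu)). Qed.

Lemma lead_const c : c != 0 -> lead P (const_fun F c) 0 c.
Proof.
move=> c0; rewrite -(xevalC (coords P).1) -chart_funC.
have cv : chart_val P c%:P%:P = c by rewrite chart_valC hornerC.
by rewrite -{2}cv; apply: lead_regular; rewrite cv.
Qed.

Lemma ord_const c : c != 0 -> ord P (const_fun F c) = 0.
Proof. by move/lead_const/lead_ord. Qed.

Lemma lc_const c : c != 0 -> lc P (const_fun F c) = c.
Proof. by move/lead_const/lead_lc. Qed.

Lemma lead_one_minus f n c : 0 < n -> lead P f n c -> lead P (1 - f) 0 1.
Proof.
move=> n0 [u [v [u0 v0 E _]]]; have [k kE] : exists k : nat, n = k.+1%:Z by exists (absz n).-1; lia.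
have vE : chart_val P (v - unif_poly P ^+ k.+1 * u) = chart_val P v.
  by rewrite chart_valB chart_valM chart_valXn chart_val_unif expr0n mul0r subr0.
exists (v - unif_poly P ^+ k.+1 * u), v; rewrite vE; split=> //.
  by rewrite expr0z mul1r mulrBr mulr1 E kE chart_funB chart_funM chart_funXn chart_fun_unif.
by rewrite divff.
Qed.

Lemma lead_one_minus_pole f n c : n < 0 -> lead P f n c -> lead P (1 - f) n (- c).
Proof.
move=> n0 [u [v [u0 v0 E cE]]].
have [k kE] : exists k : nat, n = - k.+1%:Z by exists (absz n).-1; lia.
have uE : chart_val P (unif_poly P ^+ k.+1 * v - u) = - chart_val P u.
  by rewrite chart_valB chart_valM chart_valXn chart_val_unif expr0n mul0r sub0r.
exists (unif_poly P ^+ k.+1 * v - u), v; rewrite uE oppr_eq0; split=> //; last by rewrite cE mulNr.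
rewrite chart_funB chart_funM chart_funXn chart_fun_unif mulrBr mulr1 E mulrBr.
by rewrite mulrA exprnP -(uniformizerD F_sep F_size) kE addNr expr0z mul1r.
Qed.

Definition tame f g : K := symb (ord P f) (ord P g) (lc P f) (lc P g).

Lemma tame_neq0 f g : f \is a GRing.unit -> g \is a GRing.unit -> tame f g != 0.
Proof. by move=> fu gu; rewrite symb_neq0 ?lc_neq0. Qed.

Lemma tameMl f f' g : f \is a GRing.unit -> f' \is a GRing.unit -> g \is a GRing.unit ->
  tame (f * f') g = tame f g * tame f' g.
Proof. by move=> fu fu' gu; rewrite /tame ordM // lcM // symbMl ?lc_neq0. Qed.

Lemma tameC f g : tame g f = (tame f g)^-1.
Proof. exact: symbC. Qed.

Lemma tame_const c g : c != 0 -> tame (const_fun F c) g = c ^ ord P g.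
Proof.
by move=> c0; rewrite /tame ord_const // lc_const // /symb mul0r !expr0z mul1r divr1.
Qed.

(** The relation [{f, f} = {-1, f}] of symbols: the leading coefficients cancel, and [n * n] has the
    parity of [n]. *)
Lemma tame_self f : f \is a GRing.unit -> tame f f = tame (const_fun F (-1)) f.
Proof.
move=> fu; rewrite tame_const ?N1_neq0 // /tame /symb mulfK ?expfz_neq0 ?lc_neq0 //.
exact: N1z_sqr.
Qed.

(** If [f] vanishes at [P], then [g] has order 0 and value 1 there, and symmetrically. If [f] has a
    pole, then [g] has the same order and the opposite leading coefficient, and the two signs
    [(-1) ^ (n * n)] and [(-1) ^ n] cancel. If both orders are 0, nothing is left. *)
Lemma tame_steinberg f g : f \is a GRing.unit -> g \is a GRing.unit -> f + g = 1 ->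
  tame f g = 1.
Proof.
move=> fu gu fg; have gE : g = 1 - f by rewrite -fg [f + g]addrC addrK.
have fE : f = 1 - g by rewrite -fg addrK.
have lf := leadP P fu; have lg := leadP P gu.
have aux (h h' : L) : h \is a GRing.unit -> h' = 1 - h -> 0 < ord P h -> tame h h' = 1.
  move=> hu h'E h0; have := lead_one_minus h0 (leadP P hu); rewrite -h'E => lh'.
  by rewrite /tame (lead_ord lh') (lead_lc lh') /symb mulr0 !expr0z exp1rz mul1r divr1.
case: (ltgtP (ord P f) 0) => f0.
- have := lead_one_minus_pole f0 lf; rewrite -gE => lg'.
  rewrite /tame (lead_ord lg') (lead_lc lg') /symb [(- lc P f) ^ _]expNrz N1z_sqr.
  by rewrite divff // mulf_neq0 ?expfz_neq0 ?lc_neq0 ?N1_neq0.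
- exact: aux.
- case: (ltgtP (ord P g) 0) => g0.
  + have := lead_one_minus_pole g0 lg; rewrite -fE => /lead_ord gf.
    by rewrite f0 in gf; rewrite -gf ltxx in g0.
  + by rewrite tameC aux // invr1.
  + by rewrite /tame f0 g0 /symb mulr0 !expr0z mul1r divr1.
Qed.

End Units.
End TameSymbols.

(** * Products over all points, with almost all factors equal to 1 *)

Section FiniteProducts.
Variables (T : choiceType) (K : fieldType).
Implicit Types (phi psi : T -> K) (c d : K).

(* The product of [phi] over all of [T] exists and is [c]. *)
Definition evprod phi c := exists S : seq T,
  [/\ uniq S, forall x, x \notin S -> phi x = 1 & \prod_(x <- S) phi x = c].

Lemma prod_support phi (S U : seq T) : uniq S -> uniq U -> {subset S <= U} ->
  (forall x, x \notin S -> phi x = 1) -> \prod_(x <- U) phi x = \prod_(x <- S) phi x.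
Proof.
move=> uS uU SU phi1; rewrite (bigID (mem S)) /= [X in _ * X]big1 ?mulr1; last by move=> x /phi1.
rewrite -big_filter; apply: perm_big; apply: uniq_perm; rewrite ?filter_uniq //.
by move=> x; rewrite mem_filter; apply: andb_idr => /SU.
Qed.

Lemma evprod2 phi psi c d : evprod phi c -> evprod psi d -> exists S : seq T,
  [/\ uniq S, forall x, x \notin S -> phi x = 1 /\ psi x = 1,
   \prod_(x <- S) phi x = c & \prod_(x <- S) psi x = d].
Proof.
move=> [S [uS S1 Sc]] [U [uU U1 Ud]]; exists (undup (S ++ U)); split.
- exact: undup_uniq.
- by move=> x; rewrite mem_undup mem_cat negb_or => /andP[/S1 ? /U1 ?].
- by rewrite -Sc; apply: prod_support; rewrite ?undup_uniq // => x; rewrite mem_undup mem_cat => ->.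
- by rewrite -Ud; apply: prod_support; rewrite ?undup_uniq // => x; rewrite mem_undup mem_cat orbC => ->.
Qed.

Lemma evprod_uniq phi c d : evprod phi c -> evprod phi d -> c = d.
Proof. by move=> /evprod2/[apply] -[S [_ _ <- <-]]. Qed.

Lemma eq_evprod phi psi c : phi =1 psi -> evprod phi c -> evprod psi c.
Proof.
move=> E [S [uS S1 Sc]]; exists S; split=> // [x /S1|]; first by rewrite E.
by rewrite -Sc; apply: eq_bigr => x _; rewrite E.
Qed.

Lemma evprodM phi psi c d : evprod phi c -> evprod psi d ->
  evprod (fun x => phi x * psi x) (c * d).
Proof.
move=> /evprod2/[apply] -[S [uS S1 <- <-]]; exists S; split=> // [x /S1[-> ->]|].
  by rewrite mulr1.
exact: big_split.
Qed.

Lemma evprodV phi c : evprod phi c -> evprod (fun x => (phi x)^-1) c^-1.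
Proof.
move=> [S [uS S1 <-]]; exists S; split=> // [x /S1 ->|]; first by rewrite invr1.
exact: prodfV.
Qed.

Lemma evprod1 : evprod (fun _ => 1) 1.
Proof. by exists [::]; rewrite big_nil. Qed.

End FiniteProducts.

(** * Weil reciprocity *)

Section Fibers.
Variables (K : closedFieldType) (F : {poly K}).
Local Notation L := (funfield F).
Hypothesis F_sep : separable_poly F.
Hypothesis F_size : size F = 7%N.
Hypothesis K_two : 2%:R != 0 :> K.
Implicit Types (P Q : Defs.point F) (f : L) (n : int) (c r : K).

Opaque poly_fun const_fun x_fun y_fun conj_fun.

Local Notation lead_ord := (lead_ord F_sep F_size K_two).
Local Notation lead_lc := (lead_lc F_sep F_size K_two).
Local Notation leadP := (leadP F_sep F_size K_two).
Local Notation cX P := (coords P).1.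
Local Notation c1 P := (center P).1.
Local Notation c2 P := (center P).2.

Lemma conj_affine_on (ab : K * K) : ab.2 ^+ 2 == F.[ab.1] -> (- ab.2) ^+ 2 == F.[ab.1].
Proof. by rewrite sqrrN. Qed.

Lemma conj_infinite_on (s : K) : s ^+ 2 == F`_6 -> (- s) ^+ 2 == F`_6.
Proof. by rewrite sqrrN. Qed.

Definition conj_point P : Defs.point F :=
  match P with
  | inl ab => inl (exist _ ((val ab).1, - (val ab).2) (conj_affine_on (valP ab)))
  | inr s => inr (exist _ (- val s) (conj_infinite_on (valP s)))
  end.

Definition is_affine P : bool := if P is inl _ then true else false.

Lemma coords_conj P : coords (conj_point P) = coords P.
Proof. by case: P. Qed.

Lemma center_conj P : center (conj_point P) = (c1 P, - c2 P).
Proof. by case: P => [[[a b] p]|[s p]] //=; rewrite oppr0. Qed.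

Lemma point_eq P Q : is_affine P = is_affine Q -> center P = center Q -> P = Q.
Proof.
case: P Q => [[[a b] p]|[s p]] [[[a' b'] p']|[s' p']] //= _.
  by case=> ea eb; congr inl; apply: val_inj; rewrite /= ea eb.
by case=> es; congr inr; apply: val_inj.
Qed.

Lemma conj_point_fixed P : c2 P = 0 -> conj_point P = P.
Proof.
move=> c20; apply: point_eq; first by case: P {c20}.
by rewrite center_conj c20 oppr0 -[0 in LHS]c20 -surjective_pairing.
Qed.

Lemma conj_chart_fun P p : conj_fun (chart_fun P p) = chart_fun P (p \Po (- 'X)).
Proof.
elim/poly_ind: p => [|p a IH]; first by rewrite comp_poly0 chart_fun0 (rmorph0 (@conj_fun K F)).
rewrite comp_polyD comp_polyM comp_polyX comp_polyC !chart_funD !chart_funM conj_funD conj_funM IH.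
rewrite chart_funX !chart_funC (conj_xeval F_sep F_size) (conj_cY F_sep F_size).
by rewrite chart_funN chart_funX.
Qed.

Lemma chart_val_conj P p : chart_val P (p \Po (- 'X)) = chart_val (conj_point P) p.
Proof.
by rewrite /chart_val center_conj horner_comp hornerN hornerX /= polyCN.
Qed.

Lemma chart_fun_conj_point P p : chart_fun (conj_point P) p = chart_fun P p.
Proof. by rewrite !chart_funE coords_conj. Qed.

Lemma N1z_sign (R : unitRingType) n : (-1) ^ n = (-1) ^+ (absz n) :> R.
Proof. by case: n => n //; rewrite NegzE -invr_expz abszN -exprnP -signr_odd invr_sign. Qed.

(** Conjugation carries functions regular at [conj_point P] to functions regular at [P]. It fixes
    the uniformizer [X - c] but negates the uniformizer [Y] of a ramification point, hence the sign
    there. *)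
Lemma lead_conj P f n c : lead (conj_point P) f n c ->
  lead P (conj_fun f) n (if c2 P == 0 then (-1) ^ n * c else c).
Proof.
move=> [u [v [u0 v0]]]; rewrite !chart_fun_conj_point => E ->.
have := congr1 (@conj_fun K F) E; rewrite !conj_funM !conj_chart_fun.
set u' := u \Po _; set v' := v \Po _ => E'.
have u'0 : chart_val P u' != 0 by rewrite chart_val_conj.
have v'0 : chart_val P v' != 0 by rewrite chart_val_conj.
have tu := uniformizer_unit F_sep F_size (conj_point P).
have conjz (t : L) : t \is a GRing.unit -> conj_fun (t ^ n) = conj_fun t ^ n.
  by move=> tu'; case: n {E E'} => n; rewrite ?NegzE -?invr_expz -!exprnP ?conj_funV ?conj_funX ?unitrX.
rewrite conjz // in E'.
have [c20|c20] := eqVneq (c2 P) 0.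
  have tE : conj_fun (uniformizer (conj_point P)) = - uniformizer P.
    rewrite /uniformizer center_conj coords_conj /= c20 oppr0 eqxx /=.
    exact: (conj_cY F_sep F_size).
  exists ((-1) ^+ (absz n) * u'), v'.
  have s1 : chart_val P ((-1) ^+ (absz n)) = (-1) ^+ (absz n).
    by rewrite chart_valXn chart_valN chart_val1.
  have s2 : chart_fun P ((-1) ^+ (absz n)) = (-1) ^+ (absz n).
    by rewrite chart_funXn chart_funN chart_fun1.
  rewrite chart_valM s1 chart_funM s2 !mulf_neq0 ?signr_eq0 //; split; [by [] | by [] | |].
    by rewrite E' tE expNrz N1z_sign; ring.
  by rewrite N1z_sign !chart_val_conj mulrA.
have tE : conj_fun (uniformizer (conj_point P)) = uniformizer P.
  rewrite /uniformizer center_conj coords_conj /= oppr_eq0 c20.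
  by rewrite -(xeval_XsubC (cX P)) (conj_xeval F_sep F_size).
rewrite tE in E'; exists u', v'; split.
- exact: u'0.
- exact: v'0.
- exact: E'.
by rewrite /u' /v' !chart_val_conj.
Qed.

Lemma ord_conj P f : f \is a GRing.unit -> ord P (conj_fun f) = ord (conj_point P) f.
Proof. by move=> fu; have := lead_conj (leadP (conj_point P) fu) => /lead_ord. Qed.

Lemma lc_conj P f : f \is a GRing.unit -> c2 P != 0 -> lc P (conj_fun f) = lc (conj_point P) f.
Proof. by move=> fu /negbTE c20; have := lead_conj (leadP (conj_point P) fu); rewrite c20 => /lead_lc. Qed.

Lemma lc_conj_ramified P f : f \is a GRing.unit -> c2 P = 0 ->
  lc P (conj_fun f) = (-1) ^ (ord P f) * lc P f.
Proof.
move=> fu c20; have := lead_conj (leadP (conj_point P) fu).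
by rewrite c20 eqxx conj_point_fixed // => /lead_lc.
Qed.

Lemma sqrt_exists c : exists b, b ^+ 2 = c.
Proof.
have /closed_rootP[b] : size ('X^2 - c%:P) != 1%N.
  by rewrite size_polyDl size_polyXn // size_polyN size_polyC; case: (_ != 0).
by rewrite rootE !hornerE subr_eq0 => /eqP; exists b.
Qed.

Lemma affine_point_exists r : exists P, is_affine P && (c1 P == r).
Proof.
by have [b /eqP bE] := sqrt_exists F.[r]; exists (inl (exist _ (r, b) bE)); rewrite /= eqxx.
Qed.

Lemma infinite_point_exists : exists P, ~~ is_affine P.
Proof. by have [b /eqP bE] := sqrt_exists F`_6; exists (inr (exist _ b bE)). Qed.

Definition orbit_of P : seq (Defs.point F) :=
  if c2 P == 0 then [:: P] else [:: P; conj_point P].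

(** A ramification point is listed only once: orders at it are taken with respect to [Y], so that
    [x - r] already has order 2 there. *)
Definition fiber r : seq (Defs.point F) := orbit_of (xchoose (affine_point_exists r)).
Definition infinite_fiber : seq (Defs.point F) := orbit_of (xchoose infinite_point_exists).

Lemma orbit_of_uniq P : uniq (orbit_of P).
Proof.
rewrite /orbit_of; case: ifP => //= /negbT c20; rewrite inE andbT.
apply: contra_neq c20 => /(congr1 (fun Q => c2 Q)); rewrite center_conj /= => /eqP.
by rewrite -addr_eq0 -mulr2n -mulr_natl mulf_eq0 (negbTE K_two) => /eqP.
Qed.

Lemma mem_orbit_of P Q : (Q \in orbit_of P) = (is_affine Q == is_affine P) && (c1 Q == c1 P).
Proof.
have aP : is_affine (conj_point P) = is_affine P by case: P.
apply/idP/andP => [|[/eqP aff /eqP cQ]].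
  rewrite /orbit_of; case: ifP => _; rewrite !inE; first by move/eqP->; rewrite !eqxx.
  by case/orP => /eqP ->; rewrite ?aP ?center_conj !eqxx.
have : c2 Q ^+ 2 == c2 P ^+ 2.
  rewrite !center_sqr cQ; case: P Q aff {aP cQ} => ? [] //.
rewrite eqf_sqr => /orP[/eqP e|/eqP e].
  have -> : Q = P by apply: point_eq => //; rewrite [center Q]surjective_pairing cQ e -surjective_pairing.
  by rewrite /orbit_of; case: ifP; rewrite !inE eqxx.
have -> : Q = conj_point P.
  by apply: point_eq; rewrite ?aP // center_conj [center Q]surjective_pairing cQ e.
rewrite /orbit_of; case: eqP => [c20|]; last by rewrite !inE eqxx orbT.
by rewrite conj_point_fixed // !inE eqxx.
Qed.

Lemma mem_fiber r Q : (Q \in fiber r) = is_affine Q && (c1 Q == r).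
Proof.
by have /andP[aP /eqP cP] := xchooseP (affine_point_exists r); rewrite mem_orbit_of aP cP eqb_id.
Qed.

Lemma c1_infinite P : ~~ is_affine P -> c1 P = 0.
Proof. by case: P. Qed.

Lemma mem_infinite_fiber Q : (Q \in infinite_fiber) = ~~ is_affine Q.
Proof.
have aP := xchooseP infinite_point_exists.
rewrite mem_orbit_of (negbTE aP) (c1_infinite aP) eqbF_neg.
by apply: andb_idr => /c1_infinite ->.
Qed.

Lemma c2_infinite P : ~~ is_affine P -> c2 P != 0.
Proof.
case: P => [//|[s /= sP]] _; apply: contra_neq (F_neq0 (F_gt1 F_size)) => s0.
move: sP; rewrite s0 expr0n /= eq_sym => /eqP F6.
by apply/eqP; rewrite -lead_coef_eq0 lead_coefE F_size F6.
Qed.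

Lemma evprod_fibers (phi : Defs.point F -> K) (rs : seq K) : uniq rs ->
  (forall P, is_affine P -> c1 P \notin rs -> phi P = 1) ->
  evprod phi ((\prod_(r <- rs) \prod_(P <- fiber r) phi P) * \prod_(P <- infinite_fiber) phi P).
Proof.
move=> urs phi1.
have affine_part : evprod (fun P => if is_affine P then phi P else 1)
    (\prod_(r <- rs) \prod_(P <- fiber r) phi P).
  have E : evprod (fun P => if is_affine P && (c1 P \in rs) then phi P else 1)
      (\prod_(r <- rs) \prod_(P <- fiber r) phi P).
    elim: rs urs {phi1} => [|r rs IH] /=.
      by move=> _; rewrite big_nil; apply: eq_evprod (evprod1 _ _) => P; rewrite andbF.
    move=> /andP[rrs urs]; rewrite big_cons.
    have E : evprod (fun P => if is_affine P && (c1 P == r) then phi P else 1)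
        (\prod_(P <- fiber r) phi P).
      exists (fiber r); split; first exact: orbit_of_uniq.
        by move=> P; rewrite mem_fiber => /negbTE ->.
      by rewrite !big_seq; apply: eq_bigr => P; rewrite mem_fiber => ->.
    apply: eq_evprod (evprodM E (IH urs)) => P; rewrite inE.
    case: (is_affine P) => //=; rewrite ?mulr1 //.
    by have [->|] := eqVneq (c1 P) r; rewrite ?(negbTE rrs) ?mulr1 //= mul1r.
  apply: eq_evprod E => P; case: ifP => [/andP[-> _]//|]; case: ifP => //= aP /negbT c1P.
  by rewrite phi1.
have infinite_part : evprod (fun P => if is_affine P then 1 else phi P)
    (\prod_(P <- infinite_fiber) phi P).
  exists infinite_fiber; split; first exact: orbit_of_uniq.
    by move=> P; rewrite mem_infinite_fiber negbK => ->.
  by rewrite !big_seq; apply: eq_bigr => P; rewrite mem_infinite_fiber => /negbTE ->.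
apply: eq_evprod (evprodM affine_part infinite_part) => P.
by case: ifP; rewrite ?mulr1 ?mul1r.
Qed.

End Fibers.

(** * Orders and tame symbols along a fiber of x, compared with the norm *)

Section Norms.
Variables (K : closedFieldType) (F : {poly K}).
Local Notation L := (funfield F).
Hypothesis F_sep : separable_poly F.
Hypothesis F_size : size F = 7%N.
Hypothesis K_two : 2%:R != 0 :> K.
Implicit Types (P Q : Defs.point F) (f g : L) (m : int) (a r : K) (p q N : {poly K}).

Opaque poly_fun const_fun x_fun y_fun conj_fun.

Local Notation lead_ord := (lead_ord F_sep F_size K_two).
Local Notation lead_lc := (lead_lc F_sep F_size K_two).
Local Notation leadP := (leadP F_sep F_size K_two).
Local Notation leadM := (leadM F_sep F_size).
Local Notation ordM := (ordM F_sep F_size K_two).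
Local Notation lcM := (lcM F_sep F_size K_two).
Local Notation cX P := (coords P).1.
Local Notation c1 P := (center P).1.
Local Notation c2 P := (center P).2.

Lemma ord_regular P (p : {poly {poly K}}) : chart_fun P p \is a GRing.unit -> 0 <= ord P (chart_fun P p).
Proof.
move=> pu; have [u [v [u0 v0 E _]]] := leadP P pu.
case: (leP 0 (ord P (chart_fun P p))) => // n0.
have [k kE] : exists k : nat, ord P (chart_fun P p) = - k.+1%:Z.
  by exists (absz (ord P (chart_fun P p))).-1; lia.
move: E; rewrite kE -invr_expz => E.
have tu : uniformizer P ^+ k.+1 \is a GRing.unit.
  by rewrite unitrX // (uniformizer_unit F_sep F_size).
have : chart_fun P (unif_poly P ^+ k.+1 * (v * p)) = chart_fun P u.
  rewrite !chart_funM chart_funXn chart_fun_unif E mulrA -exprnP mulrV // mul1r //.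
move/(chart_val_eq F_sep F_size K_two); rewrite chart_valM chart_valXn chart_val_unif.
by rewrite expr0n mul0r => /esym/eqP; rewrite (negbTE u0).
Qed.

Lemma xeval_affine P p : is_affine P -> xeval (cX P) p = poly_fun F p.
Proof. by case: P => // P _; rewrite xeval_x. Qed.

Definition affine_fun p q : L := poly_fun F p + poly_fun F q * y_fun F.
Definition norm_poly p q : {poly K} := p ^+ 2 - q ^+ 2 * F.

Lemma affine_fun_regular P p q : is_affine P ->
  affine_fun p q = chart_fun P (p%:P + q%:P * 'X).
Proof.
case: P => // P _; rewrite chart_funD chart_funM chart_funX !chart_funC /=.
by rewrite !xeval_x.
Qed.

Lemma conj_affine_fun p q : conj_fun (affine_fun p q) = affine_fun p (- q).
Proof.
by rewrite /affine_fun conj_funD conj_funM !conj_fun_poly conj_fun_y mulrN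
  poly_funN mulNr.
Qed.

Lemma affine_fun_norm p q : affine_fun p q * conj_fun (affine_fun p q) = poly_fun F (norm_poly p q).
Proof.
rewrite conj_affine_fun /affine_fun poly_funN mulNr.
rewrite poly_funB (poly_funM _ (q ^+ 2)) !poly_funXn /= -y_fun_sqr.
ring.
Qed.

Lemma affine_fun_unit p q : (affine_fun p q \is a GRing.unit) = (norm_poly p q != 0).
Proof.
rewrite -(poly_fun_unit F_sep (F_gt1 F_size)) -affine_fun_norm unitrM.
apply/idP/andP => [fu|[]//]; split=> //; exact: conj_fun_unit.
Qed.

Lemma orbit_ord P f : f \is a GRing.unit -> c2 P != 0 ->
  \sum_(Q <- orbit_of P) ord Q f = ord P (f * conj_fun f).
Proof.
move=> fu c20; rewrite /orbit_of (negbTE c20) !big_cons big_nil addr0.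
by rewrite ordM ?conj_fun_unit // (ord_conj F_sep F_size K_two).
Qed.

Lemma orbit_lc P f : f \is a GRing.unit -> c2 P != 0 ->
  \prod_(Q <- orbit_of P) lc Q f = lc P (f * conj_fun f).
Proof.
move=> fu c20; rewrite /orbit_of (negbTE c20) !big_cons big_nil mulr1.
by rewrite lcM ?conj_fun_unit // (lc_conj F_sep F_size K_two).
Qed.

Lemma ord_ramified P f : f \is a GRing.unit -> c2 P = 0 ->
  ord P (f * conj_fun f) = ord P f * 2.
Proof.
move=> fu c20; rewrite ordM ?conj_fun_unit // (ord_conj F_sep F_size K_two) //.
by rewrite conj_point_fixed //; lia.
Qed.

Lemma lc_ramified P f : f \is a GRing.unit -> c2 P = 0 ->
  lc P (f * conj_fun f) = (-1) ^ ord P f * lc P f ^+ 2.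
Proof.
move=> fu c20; rewrite lcM ?conj_fun_unit // (lc_conj_ramified F_sep F_size K_two) //.
by rewrite mulrCA expr2.
Qed.

Section AffineFiber.
Variables (r : K) (p q N : {poly K}) (m : nat).
Hypothesis N_eq : norm_poly p q = ('X - r%:P) ^+ m * N.
Hypothesis N_r : N.[r] != 0.
Let g := affine_fun p q.

Lemma fiber_unit : g \is a GRing.unit.
Proof.
rewrite affine_fun_unit N_eq mulf_neq0 ?expf_neq0 ?polyXsubC_eq0 //.
by apply: contraNneq N_r => ->; rewrite horner0.
Qed.

Lemma lead_norm P : is_affine P -> c1 P = r ->
  lead P (g * conj_fun g) (ramif P * m)%N%:Z (XsubC_lc P ^+ m * N.[r]).
Proof.
move=> aP cP; rewrite affine_fun_norm -(xeval_affine _ aP) -cP.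
by apply: (lead_xeval F_sep F_size) => //; rewrite cP.
Qed.

Lemma lead_XsubC_affine P : is_affine P -> c1 P = r ->
  lead P (poly_fun F ('X - r%:P)) (ramif P)%:Z (XsubC_lc P).
Proof.
move=> aP cP; rewrite -(xeval_affine _ aP) xeval_XsubC -cP.
exact: lead_XsubC.
Qed.

(** The orders of [g] at a point and at its conjugate add up to the order of the norm. At a
    ramification point the norm has order [2 * m], which is twice the order of [g]. *)
Lemma fiber_ord : \sum_(P <- fiber F r) ord P g = m%:Z.
Proof.
have /andP[aP /eqP cP] := xchooseP (affine_point_exists F r); rewrite /fiber.
set P := xchoose _ in aP cP *; have gu := fiber_unit.
have oN := lead_ord (lead_norm aP cP).
have [c20|c20] := eqVneq (c2 P) 0; last first.
  by rewrite orbit_ord // oN /ramif (negbTE c20) mul1n.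
rewrite /orbit_of c20 eqxx big_cons big_nil addr0.
move: oN; rewrite ord_ramified // /ramif c20 eqxx; lia.
Qed.

(** The right side is the tame symbol at [r], on the projective line, of [x - r] and the norm of
    [g]. At a ramification point the constant [XsubC_lc P] enters the leading coefficients of both
    [x - r] and the norm and cancels, and the sign [(-1) ^ m] is the one of [lc_ramified]. *)
Lemma fiber_tame :
  \prod_(P <- fiber F r) tame P (poly_fun F ('X - r%:P)) g = (-1) ^+ m / N.[r].
Proof.
have := fiber_ord; have /andP[aP /eqP cP] := xchooseP (affine_point_exists F r); rewrite /fiber.
set P := xchoose _ in aP cP *; have gu := fiber_unit.
have lN := lead_lc (lead_norm aP cP).
have lx := lead_XsubC_affine aP cP.
have [c20|c20] := eqVneq (c2 P) 0; last first.
  have P'a : is_affine (conj_point P) by case: P aP {cP lN lx c20}.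
  have lx' : lead (conj_point P) (poly_fun F ('X - r%:P)) (ramif (conj_point P))%:Z (XsubC_lc (conj_point P)).
    by apply: lead_XsubC_affine => //; rewrite center_conj.
  move: lN lx lx'; rewrite -orbit_lc // /ramif /XsubC_lc center_conj /= oppr_eq0 (negbTE c20) expr1n mul1r.
  rewrite /orbit_of (negbTE c20) !big_cons !big_nil addr0 !mulr1 => lN lx lx' o.
  rewrite /tame (lead_ord lx) (lead_lc lx) (lead_ord lx') (lead_lc lx') /symb !exp1rz !mul1r !mulr1 !expr1z.
  by rewrite mulrACA -expfzDr ?N1_neq0 // -invfM o lN.
rewrite /orbit_of c20 eqxx !big_cons !big_nil addr0 mulr1 => o.
move: lN lx; rewrite lc_ramified // /ramif c20 eqxx => lN lx.
rewrite /tame (lead_ord lx) (lead_lc lx) /symb o.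
have k0 := lead_neq0 lx.
have l0 := lc_neq0 F_sep F_size K_two P gu.
have -> : (-1) ^ (2%:Z * m%:Z) = 1 :> K
  by rewrite -exprz_exp (_ : (-1) ^ 2%:Z = 1) ?exp1rz // -exprnP sqrrN expr1n.
move: lN; rewrite o mul1r -!exprnP.
have -> : (-1) ^+ m = ((-1) ^+ m)^-1 :> K by rewrite invr_sign.
move=> lN; have -> : lc P g ^+ 2 = (-1) ^+ m * (XsubC_lc P ^+ m * N.[r]).
  by rewrite -lN mulVKf // signr_eq0.
rewrite !invfM mulrCA [X in _ * X]mulrA divff ?mul1r // expf_neq0 //.
Qed.

End AffineFiber.

Section InfiniteFiber.

Lemma uniformizer_infinite P : ~~ is_affine P -> uniformizer P = (x_fun F)^-1.
Proof.
move=> iP; rewrite /uniformizer (c2_infinite F_size iP) (c1_infinite iP).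
by case: P iP => // P _ /=; rewrite -poly_funC poly_fun0 subr0.
Qed.

Lemma lead_x_infinite P : ~~ is_affine P -> lead P (x_fun F) (-1) 1.
Proof.
move=> iP; have := leadV F_sep F_size K_two (lead_uniformizer P).
by rewrite uniformizer_infinite // invrK invr1.
Qed.

Lemma lead_XsubC_infinite P a : ~~ is_affine P -> lead P (poly_fun F ('X - a%:P)) (-1) 1.
Proof.
move=> iP; have xu := x_fun_unit F_sep F_size.
have vE : chart_val P (1 - (a%:P * 'X)%:P) = 1.
  by rewrite chart_valB chart_val1 chart_valC hornerM hornerX (c1_infinite iP) mulr0 subr0.
have -> : poly_fun F ('X - a%:P) = x_fun F * chart_fun P (1 - (a%:P * 'X)%:P).
  rewrite chart_funB chart_fun1 chart_funC xevalM xevalC xevalX.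
  have -> : cX P = (x_fun F)^-1 by case: P iP {vE}.
  rewrite poly_funB /= poly_funC poly_funX mulrBr mulr1 mulrCA.
  by rewrite mulrV // mulr1.
rewrite -[X in lead _ _ X]addr0 -[X in lead _ _ _ X]mulr1; apply: leadM.
  exact: lead_x_infinite.
by have := @lead_regular _ _ P (1 - (a%:P * 'X)%:P); rewrite vE oner_neq0; exact.
Qed.

Lemma lead_poly_infinite P N : ~~ is_affine P -> N != 0 ->
  lead P (poly_fun F N) (- (size N).-1%:Z) (lead_coef N).
Proof.
move=> iP; have [zs NE] := closed_field_poly_normal N => N0.
have l0 : lead_coef N != 0 by rewrite lead_coef_eq0.
have sz : size N = (size zs).+1 by rewrite NE size_scale // size_prod_XsubC.
have lz : lead P (poly_fun F (\prod_(z <- zs) ('X - z%:P))) (- (size zs)%:Z) 1.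
  elim: zs {NE sz} => [|z zs IH]; first by rewrite big_nil poly_fun1; exact: lead1.
  rewrite big_cons poly_funM -[X in lead _ _ _ X]mulr1 /= intS opprD.
  by apply: leadM => //; apply: lead_XsubC_infinite.
rewrite sz [in poly_fun F N]NE -mul_polyC poly_funM /=.
rewrite -[X in lead _ _ X]add0r -[X in lead _ _ _ X]mulr1; apply: leadM lz.
by rewrite poly_funC; apply: lead_const.
Qed.

Variables (p q : {poly K}).
Hypothesis N0 : norm_poly p q != 0.
Let g := affine_fun p q.

Lemma infinite_fiber_ord :
  \sum_(P <- infinite_fiber F) ord P g = - (size (norm_poly p q)).-1%:Z.
Proof.
have iP := xchooseP (infinite_point_exists F); rewrite /infinite_fiber; set P := xchoose _ in iP *.
have gu : g \is a GRing.unit by rewrite affine_fun_unit.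
rewrite orbit_ord // ?(c2_infinite F_size) // affine_fun_norm.
exact: lead_ord (lead_poly_infinite iP N0).
Qed.

(** Again the tame symbol of [x - a] and the norm on the projective line, now at infinity: [x - a]
    has order -1 and leading coefficient 1, and the order of the norm is minus its degree. *)
Lemma infinite_fiber_tame a :
  \prod_(P <- infinite_fiber F) tame P (poly_fun F ('X - a%:P)) g =
  (-1) ^+ (size (norm_poly p q)).-1 * lead_coef (norm_poly p q).
Proof.
have := infinite_fiber_ord.
have iP := xchooseP (infinite_point_exists F); rewrite /infinite_fiber; set P := xchoose _ in iP *.
have c20 := c2_infinite F_size iP.
have gu : g \is a GRing.unit by rewrite affine_fun_unit.
have iP' : ~~ is_affine (conj_point P) by case: P iP {c20}.
have := orbit_lc gu c20; rewrite affine_fun_norm (lead_lc (lead_poly_infinite iP N0)).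
rewrite /orbit_of (negbTE c20) !big_cons !big_nil addr0 !mulr1 => lE oE.
have lx := lead_XsubC_infinite a iP; have lx' := lead_XsubC_infinite a iP'.
rewrite /tame (lead_ord lx) (lead_lc lx) (lead_ord lx') (lead_lc lx') /symb.
rewrite !exp1rz !mulr1 !invr_expz !opprK !expr1z mulrACA lE -expfzDr ?N1_neq0 //.
by rewrite -mulrDr oE mulrNN mul1r.
Qed.

End InfiniteFiber.

End Norms.

(** * Reciprocity against constants and against x - a *)

Lemma prod_expz (T : Type) (K : fieldType) (x : K) (s : seq T) (D : T -> int) : x != 0 ->
  \prod_(t <- s) x ^ D t = x ^ (\sum_(t <- s) D t).
Proof.
move=> x0; elim: s => [|t s IH]; first by rewrite !big_nil expr0z.
by rewrite !big_cons IH expfzDr.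
Qed.

Section Reciprocity.
Variables (K : closedFieldType) (F : {poly K}).
Local Notation L := (funfield F).
Hypothesis F_sep : separable_poly F.
Hypothesis F_size : size F = 7%N.
Hypothesis K_two : 2%:R != 0 :> K.
Implicit Types (P Q : Defs.point F) (g : L) (a c d r : K) (p q N : {poly K}).

Opaque poly_fun const_fun x_fun y_fun conj_fun.

Local Notation c1 P := (center P).1.

Lemma evprod_affine (D : Defs.point F -> int) (zs : seq K) (phi : K -> K) :
  (forall r, \sum_(P <- fiber F r) D P = (count_mem r zs)%:Z) ->
  (forall P, is_affine P -> 0 <= D P) -> (forall z, z \in zs -> phi z != 0) ->
  evprod (fun P => if is_affine P then phi (c1 P) ^ D P else 1) (\prod_(z <- zs) phi z).
Proof.
move=> DE D0 phi0.
(* On a fiber outside [zs] the values of [D] are nonnegative with sum 0. *)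
have D1 P : is_affine P -> c1 P \notin zs -> D P = 0.
  move=> aP cP; have := DE (c1 P); rewrite (count_memPn cP) => /eqP.
  rewrite big_seq_cond psumr_eq0; last by move=> Q; rewrite andbT mem_fiber => /andP[/D0].
  by move=> /allP/(_ P); rewrite mem_fiber aP eqxx => /(_ isT)/eqP.
have := @evprod_fibers _ F K_two (fun P => if is_affine P then phi (c1 P) ^ D P else 1) (undup zs).
rewrite undup_uniq => /(_ isT); set c := (X in evprod _ X) => E.
suff -> : \prod_(z <- zs) phi z = c.
  by apply: E => P aP; rewrite mem_undup aP => cP; rewrite D1 ?expr0z.
rewrite /c [X in _ * X]big1_seq ?mulr1; last first.
  by move=> P /andP[_]; rewrite mem_infinite_fiber => /negbTE ->.
rewrite -big_undup_iterop_count /= big_seq [RHS]big_seq; apply: eq_bigr => r.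
rewrite mem_undup => /phi0 r0; rewrite -[LHS]/(phi r ^+ _) exprnP -DE -prod_expz //.
rewrite big_seq [RHS]big_seq; apply: eq_bigr => P.
by rewrite mem_fiber => /andP[-> /eqP ->].
Qed.

Lemma prod_XsubC_split c a (zs : seq K) : c *: \prod_(z <- zs) ('X - z%:P) =
  ('X - a%:P) ^+ count_mem a zs * (c *: \prod_(z <- zs | z != a) ('X - z%:P)).
Proof.
rewrite -scalerAr; congr (_ *: _); elim: zs => [|z zs IH]; first by rewrite !big_nil mulr1.
rewrite !big_cons IH /=; case: eqVneq => [->|_] /=; first by rewrite add1n exprS mulrA.
by rewrite add0n mulrCA.
Qed.

Lemma prod_XsubC_split_neq0 c a (zs : seq K) : c != 0 ->
  (c *: \prod_(z <- zs | z != a) ('X - z%:P)).[a] != 0.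
Proof.
move=> c0; rewrite hornerZ mulf_neq0 // horner_prod prodf_seq_neq0.
by apply/allP => z _; apply/implyP => za; rewrite hornerXsubC subr_eq0 eq_sym.
Qed.

Lemma affine_fun_ord_ge0 p q P : norm_poly F p q != 0 -> is_affine P -> 0 <= ord P (affine_fun F p q).
Proof.
move=> N0 aP; have := affine_fun_unit F_sep F_size p q; rewrite N0 (affine_fun_regular p q aP).
exact: ord_regular.
Qed.

Section AffineFun.
Variables (p q : {poly K}) (zs : seq K) (c : K).
Hypothesis c0 : c != 0.
Hypothesis N_eq : norm_poly F p q = c *: \prod_(z <- zs) ('X - z%:P).
Let g := affine_fun F p q.

Lemma norm_split_neq0 : norm_poly F p q != 0.
Proof. by rewrite N_eq scaler_eq0 negb_or c0 monic_neq0 // monic_prod_XsubC. Qed.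

Lemma fiber_ord_count r : \sum_(P <- fiber F r) ord P g = (count_mem r zs)%:Z.
Proof.
apply: (fiber_ord F_sep F_size K_two (N := c *: \prod_(z <- zs | z != r) ('X - z%:P))).
  by rewrite N_eq -prod_XsubC_split.
exact: prod_XsubC_split_neq0.
Qed.

Lemma norm_split_size : (size (norm_poly F p q)).-1 = size zs.
Proof. by rewrite N_eq size_scale // size_prod_XsubC. Qed.

Lemma norm_split_lead : lead_coef (norm_poly F p q) = c.
Proof.
rewrite N_eq lead_coefZ (monicP _) ?mulr1 //; exact: monic_prod_XsubC.
Qed.

(** The exponents add up to the degree of the divisor of [g], where the affine points contribute the
    degree of the norm and the points at infinity its opposite. *)
Lemma reciprocity_const d : d != 0 -> evprod (fun P => d ^ ord P g) 1.
Proof.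
move=> d0.
have A := evprod_affine (phi := fun _ => d) fiber_ord_count
  (fun P => affine_fun_ord_ge0 norm_split_neq0) (fun _ _ => d0).
have := @evprod_fibers _ F K_two (fun P => if is_affine P then 1 else d ^ ord P g) [::] isT.
rewrite big_nil mul1r; set e := (X in evprod _ X) => B.
have {}B : evprod (fun P => if is_affine P then 1 else d ^ ord P g) e.
  by apply: B => P ->.
have := evprodM A B.
have -> : \prod_(z <- zs) d * e = 1.
  have -> : e = \prod_(P <- infinite_fiber F) d ^ ord P g.
    rewrite /e big_seq [RHS]big_seq; apply: eq_bigr => P.
    by rewrite mem_infinite_fiber => /negbTE ->.
  rewrite prod_expz // infinite_fiber_ord ?norm_split_neq0 // norm_split_size.
  by rewrite big_const_seq count_predT iter_mulr_1 -invr_expz -exprnP divff // expf_neq0.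
by apply: eq_evprod => P; case: ifP; rewrite ?mulr1 ?mul1r.
Qed.

Lemma reciprocity_XsubC a : evprod (fun P => tame P (poly_fun F ('X - a%:P)) g) 1.
Proof.
(* At an affine point not over [a] the symbol is the value of [x - a] to the power [ord P g]. The
   value 1 at [a] leaves that fiber to [psi], which also takes the points at infinity. *)
pose phi r : K := if r == a then 1 else r - a.
have phi0 r : phi r != 0.
  by rewrite /phi; case: ifP => [_|/negbT ra]; [exact: oner_neq0 | rewrite subr_eq0].
have A := evprod_affine (phi := phi) fiber_ord_count
  (fun P => affine_fun_ord_ge0 norm_split_neq0) (fun z _ => phi0 z).
pose psi P := if is_affine P && (c1 P != a) then 1 else tame P (poly_fun F ('X - a%:P)) g.
have := @evprod_fibers _ F K_two psi [:: a] isT.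
rewrite big_cons big_nil mulr1; set e := (X in evprod _ X) => B.
have {}B : evprod psi e by apply: B => P aP; rewrite inE /psi aP => ->.
have eE : e = (-1) ^+ count_mem a zs / (c *: \prod_(z <- zs | z != a) ('X - z%:P)).[a]
              * ((-1) ^+ size zs * c).
  rewrite -norm_split_size -[in RHS]norm_split_lead.
  rewrite -(infinite_fiber_tame F_sep F_size K_two norm_split_neq0 a).
  rewrite norm_split_lead -(fiber_tame F_sep F_size K_two (p := p) (q := q)); first last.
  - exact: prod_XsubC_split_neq0.
  - by rewrite N_eq -prod_XsubC_split.
  rewrite /e; congr (_ * _); rewrite big_seq [RHS]big_seq; apply: eq_bigr => P.
    by rewrite mem_fiber /psi => /andP[-> ->].
  by rewrite mem_infinite_fiber /psi => /negbTE ->.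
have := evprodM A B.
have -> : \prod_(z <- zs) phi z * e = 1.
  (* The two signs together are one sign for each root other than [a], which turns each [z - a] into
     [a - z]. *)
  have sgn : \prod_(z <- zs) phi z * ((-1) ^+ count_mem a zs * (-1) ^+ size zs) =
      \prod_(z <- zs | z != a) (a - z).
    elim: (zs) => [|z s IH] /=; first by rewrite !big_nil !expr0 !mulr1.
    rewrite !big_cons -IH [phi z]/phi; case: eqVneq => [_|_] /=.
      by rewrite add1n !exprS; ring.
    by rewrite add0n !exprS; ring.
  have hp : (\prod_(z <- zs | z != a) ('X - z%:P)).[a] = \prod_(z <- zs | z != a) (a - z).
    by rewrite horner_prod; apply: eq_bigr => z _; rewrite hornerXsubC.
  rewrite eE hornerZ hp -sgn.
  have s0 : \prod_(z <- zs) phi z != 0 by rewrite prodf_seq_neq0; apply/allP => z _; exact: phi0.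
  move: s0; set A' := \prod_(z <- zs) _ => A0.
  set B' := (-1) ^+ _; set C' := (-1) ^+ _.
  have B0 : B' != 0 by rewrite signr_eq0.
  have C0 : C' != 0 by rewrite signr_eq0.
  field; by rewrite c0 A0 B0 C0.
apply: eq_evprod => P; rewrite /psi /phi; case: (boolP (is_affine P)) => aP /=; last by rewrite mul1r.
have [cP|cP] /= := eqVneq (c1 P) a; first by rewrite exp1rz mul1r.
rewrite mulr1.
have cpa : chart_val P ('X - a%:P)%:P = c1 P - a by rewrite chart_valC hornerXsubC.
have l : lead P (poly_fun F ('X - a%:P)) 0 (c1 P - a).
  by rewrite -(xeval_affine _ aP) -chart_funC -cpa; apply: lead_regular; rewrite cpa subr_eq0.
rewrite /tame (lead_ord F_sep F_size K_two l) (lead_lc F_sep F_size K_two l) /symb.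
by rewrite mul0r !expr0z mul1r divr1.
Qed.

End AffineFun.

End Reciprocity.

(** * Reciprocity for arbitrary functions *)

Section WeilReciprocity.
Variables (K : closedFieldType) (F : {poly K}).
Local Notation L := (funfield F).
Hypothesis F_sep : separable_poly F.
Hypothesis F_size : size F = 7%N.
Hypothesis K_two : 2%:R != 0 :> K.
Implicit Types (P : Defs.point F) (f g h : L) (a c d : K) (p q N : {poly K}).

Opaque poly_fun const_fun x_fun y_fun conj_fun.

Local Notation poly_unit := (poly_fun_unit F_sep (F_gt1 F_size)).
Local Notation tameMl := (tameMl F_sep F_size K_two).

Definition reciprocal f g := evprod (fun P => tame P f g) 1.

Lemma reciprocalC f g : reciprocal f g -> reciprocal g f.
Proof. by move=> /evprodV; rewrite invr1; apply: eq_evprod => P; rewrite [RHS]tameC. Qed.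

Lemma reciprocalMl f f' g : f \is a GRing.unit -> f' \is a GRing.unit -> g \is a GRing.unit ->
  reciprocal f g -> reciprocal f' g -> reciprocal (f * f') g.
Proof.
move=> fu fu' gu /evprodM/[apply]; rewrite mulr1.
by apply: eq_evprod => P; rewrite tameMl.
Qed.

Lemma tame1l P g : tame P 1 g = 1.
Proof. by rewrite /tame (ord1 F_sep F_size K_two) (lc1 F_sep F_size K_two) /symb mul0r !expr0z exp1rz !mul1r invr1. Qed.

Lemma tameVl P f g : f \is a GRing.unit -> g \is a GRing.unit ->
  tame P f^-1 g = (tame P f g)^-1.
Proof.
move=> fu gu; have fVu : f^-1 \is a GRing.unit by rewrite unitrV.
have t0 := tame_neq0 F_sep F_size K_two P fu gu.
by apply: (mulfI t0); rewrite -tameMl // mulrV // tame1l divff.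
Qed.

Lemma reciprocalVl f g : f \is a GRing.unit -> g \is a GRing.unit ->
  reciprocal f g -> reciprocal f^-1 g.
Proof.
by move=> fu gu /evprodV; rewrite invr1; apply: eq_evprod => P; rewrite tameVl.
Qed.

Lemma reciprocalMl_inv f f' g : f \is a GRing.unit -> f' \is a GRing.unit -> g \is a GRing.unit ->
  reciprocal (f * f') g -> reciprocal f' g -> reciprocal f g.
Proof.
move=> fu fu' gu H H'; rewrite -(mulrK fu' f).
by apply: reciprocalMl; rewrite ?unitrM ?unitrV ?fu ?fu' //; apply: reciprocalVl.
Qed.

Lemma affine_fun_poly p : affine_fun F p 0 = poly_fun F p.
Proof. by rewrite /affine_fun poly_fun0 mul0r addr0. Qed.

Lemma unit_quotient f : f \is a GRing.unit -> exists p q s,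
  [/\ s != 0, norm_poly F p q != 0 & f * poly_fun F s = affine_fun F p q].
Proof.
move=> fu; have [p [q [s [s0 E]]]] := funfield_quotient f.
exists p, q, s; split=> //; rewrite -(affine_fun_unit F_sep F_size) /affine_fun -E.
by rewrite unitrM fu poly_unit.
Qed.

(** By multiplicativity a denominator in [K[x]] can be split off from [g], and a polynomial in [x]
    is itself an [affine_fun] with second part 0. *)
Lemma reciprocal_of_affine f : f \is a GRing.unit ->
  (forall p q, norm_poly F p q != 0 -> reciprocal f (affine_fun F p q)) ->
  forall g, g \is a GRing.unit -> reciprocal f g.
Proof.
move=> fu H g gu; have [p [q [s [s0 N0 E]]]] := unit_quotient gu.
have su : poly_fun F s \is a GRing.unit by rewrite poly_unit.
apply: reciprocalC; apply: (reciprocalMl_inv gu su fu); apply: reciprocalC.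
  by rewrite E; apply: H.
rewrite -affine_fun_poly; apply: H.
by rewrite -(affine_fun_unit F_sep F_size) affine_fun_poly.
Qed.

Lemma norm_split N : N != 0 -> exists c zs, c != 0 /\ N = c *: \prod_(z <- zs) ('X - z%:P).
Proof.
move=> N0; have [zs E] := closed_field_poly_normal N.
by exists (lead_coef N), zs; rewrite lead_coef_eq0.
Qed.

Lemma reciprocal_const d g : d != 0 -> g \is a GRing.unit -> reciprocal (const_fun F d) g.
Proof.
move=> d0; apply: reciprocal_of_affine; first by rewrite -poly_funC poly_unit polyC_eq0.
move=> p q /norm_split[c [zs [c0 E]]].
by have := reciprocity_const F_sep F_size K_two c0 E d0; apply: eq_evprod => P; rewrite (tame_const F_sep F_size K_two).
Qed.

Lemma reciprocal_XsubC a g : g \is a GRing.unit -> reciprocal (poly_fun F ('X - a%:P)) g.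
Proof.
apply: reciprocal_of_affine; first by rewrite poly_unit polyXsubC_eq0.
by move=> p q /norm_split[c [zs [c0 E]]]; apply: (reciprocity_XsubC F_sep F_size K_two c0 E).
Qed.

Lemma reciprocal_poly p g : p != 0 -> g \is a GRing.unit -> reciprocal (poly_fun F p) g.
Proof.
move=> /norm_split[c [zs [c0 ->]]] gu.
have cu : poly_fun F c%:P \is a GRing.unit by rewrite poly_unit polyC_eq0.
have zu (s : seq K) : poly_fun F (\prod_(z <- s) ('X - z%:P)) \is a GRing.unit.
  by rewrite poly_unit monic_neq0 // monic_prod_XsubC.
rewrite -mul_polyC poly_funM; apply: (reciprocalMl cu (zu zs) gu).
  by rewrite poly_funC; apply: reciprocal_const.
elim: zs => [|z zs IH].
  rewrite big_nil poly_fun1; apply: eq_evprod (evprod1 _ _) => P.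
  by rewrite tame1l.
have zu1 : poly_fun F ('X - z%:P) \is a GRing.unit by rewrite poly_unit polyXsubC_eq0.
rewrite big_cons poly_funM; apply: (reciprocalMl zu1 (zu zs) gu _ IH).
exact: reciprocal_XsubC.
Qed.

Lemma reciprocal_self f : f \is a GRing.unit -> reciprocal f f.
Proof.
move=> fu; have := reciprocal_const (N1_neq0 K) fu; apply: eq_evprod => P.
by rewrite (tame_self F_sep F_size K_two).
Qed.

(* Two functions whose difference is h satisfy the Steinberg relation after division by h. *)
Lemma reciprocal_steinberg f g h : f \is a GRing.unit -> g \is a GRing.unit ->
  h \is a GRing.unit -> (forall g', g' \is a GRing.unit -> reciprocal h g') ->
  f - g = h -> reciprocal f g.
Proof.
move=> fu gu hu hrec fgh.
have hVu : h^-1 \is a GRing.unit by rewrite unitrV.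
have N1u : const_fun F (-1) \is a GRing.unit.
  by rewrite -poly_funC poly_unit polyC_eq0 N1_neq0.
have gE : - (g * h^-1) = const_fun F (-1) * h^-1 * g.
  by rewrite (rmorphN (const_fun F)) (rmorph1 (const_fun F)); ring.
have S : reciprocal (f * h^-1) (- (g * h^-1)).
  apply: eq_evprod (evprod1 _ _) => P; rewrite (tame_steinberg F_sep F_size K_two) //.
  - by rewrite unitrM fu.
  - by rewrite unitrN unitrM gu.
  - by rewrite -mulrBl fgh mulrV.
have hVrec g' : g' \is a GRing.unit -> reciprocal h^-1 g'.
  by move=> g'u; apply: reciprocalVl => //; apply: hrec.
have S1 : reciprocal f (- (g * h^-1)).
  have ghu : - (g * h^-1) \is a GRing.unit by rewrite unitrN unitrM gu.
  exact: reciprocalMl_inv fu hVu ghu S (hVrec _ ghu).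
apply: reciprocalC; rewrite gE [_ * g]mulrC in S1.
have cu : const_fun F (-1) * h^-1 \is a GRing.unit by rewrite unitrM N1u.
apply: (reciprocalMl_inv gu cu fu (reciprocalC S1)).
apply: (reciprocalMl N1u hVu fu _ (hVrec _ fu)).
exact: reciprocal_const (N1_neq0 K) fu.
Qed.

Lemma reciprocal_diff f g N : f \is a GRing.unit -> g \is a GRing.unit ->
  f - g = poly_fun F N -> reciprocal f g.
Proof.
move=> fu gu E; have [N0|N0] := eqVneq N 0.
  have -> : g = f by apply/esym/eqP; rewrite -subr_eq0 E N0 poly_fun0.
  exact: reciprocal_self.
have Nu : poly_fun F N \is a GRing.unit by rewrite poly_unit.
exact: reciprocal_steinberg fu gu Nu (fun g' g'u => reciprocal_poly N0 g'u) E.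
Qed.

Theorem weil_reciprocity f g : f \is a GRing.unit -> g \is a GRing.unit -> reciprocal f g.
Proof.
move=> fu; apply: reciprocal_of_affine => // p' q' N0'.
have gu : affine_fun F p' q' \is a GRing.unit by rewrite affine_fun_unit.
have [p [q [s [s0 N0 E]]]] := unit_quotient fu.
have su : poly_fun F s \is a GRing.unit by rewrite poly_unit.
apply: (reciprocalMl_inv fu su gu); last exact: reciprocal_poly.
rewrite E {E s s0 su fu f}.
have fu : affine_fun F p q \is a GRing.unit by rewrite affine_fun_unit.
have [q0|q0] := eqVneq q 0.
  by move: fu; rewrite q0 affine_fun_poly poly_unit => p0; apply: reciprocal_poly.
have [q'0|q'0] := eqVneq q' 0.
  move: gu; rewrite q'0 affine_fun_poly poly_unit => p0.
  by apply: reciprocalC; apply: reciprocal_poly.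
have qu : poly_fun F q \is a GRing.unit by rewrite poly_unit.
have q'u : poly_fun F q' \is a GRing.unit by rewrite poly_unit.
have D : affine_fun F p q * poly_fun F q' - affine_fun F p' q' * poly_fun F q =
    poly_fun F (p * q' - p' * q).
  by rewrite poly_funB !poly_funM /affine_fun /=; ring.
apply: (reciprocalMl_inv fu q'u gu); last exact: reciprocal_poly.
have fq'u : affine_fun F p q * poly_fun F q' \is a GRing.unit by rewrite unitrM fu q'u.
apply: reciprocalC; apply: (reciprocalMl_inv gu qu fq'u); last exact: reciprocal_poly.
apply: reciprocalC.
have gqu : affine_fun F p' q' * poly_fun F q \is a GRing.unit by rewrite unitrM gu qu.
exact: reciprocal_diff fq'u gqu D.
Qed.

End WeilReciprocity.

(** * Divisors of functions *)

Section Divisors.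
Variables (K : closedFieldType) (F : {poly K}).
Local Notation L := (funfield F).
Hypothesis F_sep : separable_poly F.
Hypothesis F_size : size F = 7%N.
Hypothesis K_two : 2%:R != 0 :> K.
Implicit Types (P Q : Defs.point F) (f g h u v : L) (n m : int) (a c : K) (p q : {poly K}).

Opaque poly_fun const_fun x_fun y_fun conj_fun.

Local Notation unitE := (funfield_unitE F_sep (F_gt1 F_size)).
Local Notation poly_unit := (poly_fun_unit F_sep (F_gt1 F_size)).
Local Notation lead_ord := (lead_ord F_sep F_size K_two).
Local Notation leadP := (leadP F_sep F_size K_two).
Local Notation ordM := (ordM F_sep F_size K_two).
Local Notation ordV := (ordV F_sep F_size K_two).
Local Notation ordX := (ordX F_sep F_size K_two).
Local Notation c1 P := (center P).1.
Local Notation c2 P := (center P).2.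

Lemma ord_finite f : f \is a GRing.unit -> exists S : seq (Defs.point F),
  uniq S /\ forall P, P \notin S -> ord P f = 0.
Proof.
have aux p q : norm_poly F p q != 0 -> exists S : seq (Defs.point F),
    forall P, P \notin S -> ord P (affine_fun F p q) = 0.
  move=> N0; have [c [zs [c0 E]]] := norm_split N0.
  exists (flatten (map (@fiber _ F) zs) ++ infinite_fiber F) => P.
  rewrite mem_cat negb_or mem_infinite_fiber negbK => /andP[Pz aP].
  have cP : c1 P \notin zs.
    apply: contra Pz => cP; apply/flattenP; exists (fiber F (c1 P)); last by rewrite mem_fiber aP eqxx.
    exact: map_f.
  have := fiber_ord_count F_sep F_size K_two c0 E (c1 P); rewrite (count_memPn cP) => /eqP.
  rewrite big_seq_cond psumr_eq0; last first.
    by move=> Q; rewrite andbT mem_fiber => /andP[/(affine_fun_ord_ge0 F_sep F_size K_two N0)].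
  by move=> /allP/(_ P); rewrite mem_fiber aP eqxx => /(_ isT)/eqP.
move=> fu; have [p [q [s [s0 N0 E]]]] := unit_quotient F_sep F_size fu.
have su : poly_fun F s \is a GRing.unit by rewrite poly_unit.
have Ns0 : norm_poly F s 0 != 0 by rewrite -(affine_fun_unit F_sep F_size) affine_fun_poly.
have [S1 H1] := aux _ _ N0; have [S2 H2] := aux _ _ Ns0.
exists (undup (S1 ++ S2)); split=> [|P]; first exact: undup_uniq.
rewrite mem_undup mem_cat negb_or => /andP[/H1 o1 /H2]; rewrite affine_fun_poly => o2.
by move: o1; rewrite -E ordM // o2 addr0.
Qed.

Lemma divisor_of_finite (D : Defs.point F -> int) (S : seq (Defs.point F)) : uniq S ->
  (forall P, P \notin S -> D P = 0) -> exists E : divisor F, forall P, coeff P E = D P.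
Proof.
move=> uS S0; exists (\sum_(P <- S) << D P *g P >>) => P.
rewrite (raddf_sum (coeff P)); have [PS|PS] := boolP (P \in S).
  rewrite (bigD1_seq P) //= coeffU eqxx mulr1 big1 ?addr0 // => Q QP.
  by rewrite coeffU (negbTE QP) mulr0.
rewrite (S0 P PS) big_seq; apply: big1 => Q QS; rewrite /= coeffU.
by case: eqP => [QP|_]; [rewrite -QP QS in PS | rewrite mulr0].
Qed.

Lemma divisor_exists f : f \is a GRing.unit -> exists D : divisor F, div_of f D.
Proof.
move=> fu; have [S [uS S0]] := ord_finite fu; have [D DE] := divisor_of_finite uS S0.
by exists D; split; first by rewrite -unitE.
Qed.

Lemma common_zeros_exists f g : f \is a GRing.unit -> exists D : divisor F, common_zeros f g D.
Proof.
move=> fu; have [S [uS S0]] := ord_finite fu.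
apply: (divisor_of_finite uS) => P /S0 ->.
by rewrite maxxx minEle; case: ifP => //; rewrite le_max lexx.
Qed.

(** Reciprocity against a constant [d] says that [d ^ n = 1], where [n] is the degree. For [n]
    nonzero, some [d] with [d ^ |n| = 2] would give [2 = 1]. *)
Lemma ord_sum0 f (S : seq (Defs.point F)) : f \is a GRing.unit -> uniq S ->
  (forall P, P \notin S -> ord P f = 0) -> \sum_(P <- S) ord P f = 0.
Proof.
move=> fu uS S0; have H (d : K) : d != 0 -> d ^ (\sum_(P <- S) ord P f) = 1.
  move=> d0; rewrite -prod_expz //; apply: evprod_uniq (_ : evprod (fun P => d ^ ord P f) _).
    by exists S; split=> // P /S0 ->; rewrite expr0z.
  have := reciprocal_const F_sep F_size K_two d0 fu.
  by apply: eq_evprod => P; rewrite (tame_const F_sep F_size K_two).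
move: (\sum_(P <- S) _) H => n H; apply/eqP; apply: contraTT (oner_neq0 K) => n0.
pose k := (absz n).-1.
have kE : absz n = k.+1 by rewrite /k prednK // absz_gt0.
have [d] : exists d : K, root ('X^(k.+1) - 2%:R%:P) d.
  by apply/closed_rootP; rewrite size_polyDl size_polyXn // size_polyN size_polyC K_two.
rewrite rootE !hornerE subr_eq0 => /eqP dk.
have d0 : d != 0 by apply: contraNneq K_two => d0; rewrite -dk d0 expr0n.
have dk1 : d ^+ k.+1 = 1.
  have := H d d0; rewrite -[n]intz /= -kE.
  case: (n) => m /=; first by rewrite intz.
  by rewrite NegzE intz -invr_expz => /(canRL invrK); rewrite invr1.
by rewrite negbK; apply/eqP/(addrI 1); rewrite -mulr2n -dk dk1 addr0.
Qed.

Lemma ord_quotient P f (s t : {poly {poly K}}) : f \is a GRing.unit -> chart_val P s != 0 ->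
  chart_fun P s * f = chart_fun P t ->
  0 <= ord P f /\ (chart_val P t = 0 -> 0 < ord P f).
Proof.
move=> fu s0 E; have su := chart_fun_unit F_sep F_size K_two s0.
have tu : chart_fun P t \is a GRing.unit by rewrite -E unitrM su.
have o : ord P f = ord P (chart_fun P t).
  by rewrite -E ordM // (lead_ord (lead_regular s0)) add0r.
have o0 := ord_regular F_sep F_size K_two tu; rewrite o; split=> // t0.
rewrite lt_def o0 andbT; apply/eqP => o'.
have [u' [v' [u0 v0]]] := leadP P tu; rewrite o' expr0z mul1r -chart_funM => /(chart_val_eq F_sep F_size K_two).
by rewrite chart_valM t0 mulr0 => /esym/eqP; rewrite (negbTE u0).
Qed.

(** With [c] the value of [f] at one point, [f - c] would have a zero there and no pole, against
    [ord_sum0], unless it is 0. *)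
Lemma ord0_const f : f \is a GRing.unit -> (forall P, ord P f = 0) ->
  exists c, c != 0 /\ f = const_fun F c.
Proof.
move=> fu f0; have [P0 _] := infinite_point_exists F.
pose c := lc P0 f; have c0 : c != 0 := lc_neq0 F_sep F_size K_two P0 fu.
exists c; split=> //; apply/eqP; rewrite -subr_eq0; apply/negPn/negP; rewrite -unitE => hu.
have eq P : exists s t, [/\ chart_val P s != 0, chart_fun P s * (f - const_fun F c) = chart_fun P t &
    chart_val P t = (lc P f - c) * chart_val P s].
  have [u [v [u0 v0]]] := leadP P fu; rewrite f0 expr0z mul1r => E cE.
  exists v, (u - c%:P%:P * v); split=> //.
    by rewrite chart_funB chart_funM chart_funC xevalC mulrBr E [in RHS]mulrC.
  by rewrite chart_valB chart_valM chart_valC hornerC mulrBl cE divfK.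
have ge0 P : 0 <= ord P (f - const_fun F c).
  by have [s [t [s0 E _]]] := eq P; have [] := ord_quotient hu s0 E.
have gt0 : 0 < ord P0 (f - const_fun F c).
  have [s [t [s0 E t0]]] := eq P0; have [_] := ord_quotient hu s0 E; apply.
  by rewrite t0 subrr mul0r.
have [S [uS S0]] := ord_finite hu.
have := ord_sum0 hu uS S0; rewrite (bigD1_seq P0) //=; last first.
  by apply/negPn/negP => /S0 e; rewrite e ltxx in gt0.
by apply/eqP; rewrite gt_eqF // ltr_pwDl // sumr_ge0.
Qed.

Lemma same_ord_const f g : f \is a GRing.unit -> g \is a GRing.unit ->
  (forall P, ord P f = ord P g) -> exists c, c != 0 /\ f = const_fun F c * g.
Proof.
move=> fu gu H; have [||c [c0 E]] := @ord0_const (f / g).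
- by rewrite unitrM fu unitrV.
- by move=> P; rewrite ordM ?unitrV // ordV // H subrr.
by exists c; split=> //; rewrite -E mulrVK.
Qed.

(** * Derivations and canonical divisors *)

Section Canonical.
Variable d : L -> L.
Hypothesis d_der : derivation d.

Lemma derD f g : d (f + g) = d f + d g. Proof. by case: d_der. Qed.
Lemma derM f g : d (f * g) = d f * g + f * d g. Proof. by case: d_der. Qed.
Lemma der_const c : d (const_fun F c) = 0. Proof. by case: d_der. Qed.

Lemma der_poly p : d (poly_fun F p) = poly_fun F p^`() * d (x_fun F).
Proof.
elim/poly_ind: p => [|p c IH].
  by rewrite deriv0 poly_fun0 mul0r; have := der_const 0; rewrite -poly_funC polyC0 poly_fun0.
rewrite derivD derivM derivX mulr1 derivC addr0 !poly_funD.
rewrite !poly_funM poly_funC poly_funX derD der_const derM IH addr0; ring.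
Qed.

Lemma two_y_unit : 2%:R * y_fun F \is a GRing.unit.
Proof.
rewrite unitrM (y_fun_unit F_sep F_size) andbT.
have : const_fun F 2%:R \is a GRing.unit by rewrite -poly_funC poly_unit polyC_eq0.
by rewrite (rmorph_nat (const_fun F)).
Qed.

(** The ratio of [d] to the derivation with [x -> 2 y] and [y -> F'], the one dual to the
    differential [dx / (2 y)]. *)
Let h := d (x_fun F) / (2%:R * y_fun F).

Lemma der_x : d (x_fun F) = 2%:R * y_fun F * h.
Proof. by rewrite /h mulrC mulrVK // two_y_unit. Qed.

Lemma der_y : d (y_fun F) = poly_fun F F^`() * h.
Proof.
apply: (mulrI two_y_unit); have := congr1 d (y_fun_sqr F).
rewrite der_poly expr2 derM der_x => E.
have -> : 2%:R * y_fun F * d (y_fun F) = d (y_fun F) * y_fun F + y_fun F * d (y_fun F) by ring.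
rewrite E; ring.
Qed.

Lemma der_nonzero : (exists f, d f != 0) -> h \is a GRing.unit.
Proof.
move=> [f df]; rewrite unitE; apply: contra_neq df => h0.
have dp p : d (poly_fun F p) = 0 by rewrite der_poly der_x h0 !mulr0.
have dy : d (y_fun F) = 0 by rewrite der_y h0 mulr0.
have [p [q [s [s0 E]]]] := funfield_quotient f.
have su : poly_fun F s \is a GRing.unit by rewrite poly_unit.
apply: (mulIr su); have := congr1 d E.
by rewrite derD !derM !dp dy !mulr0 !mul0r !addr0.
Qed.

Lemma der_xV : d (x_fun F)^-1 = - (2%:R * y_fun F * h) * (x_fun F)^-2.
Proof.
have xu := x_fun_unit F_sep F_size; apply: (mulrI xu).
have xx : x_fun F * (x_fun F ^+ 2)^-1 = (x_fun F)^-1.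
  by rewrite expr2 invrM // mulrA mulrV // mul1r.
rewrite mulrCA xx.
have d1 : d 1 = 0 by have := der_const 1; rewrite -poly_funC polyC1 poly_fun1.
have := congr1 d (mulrV xu); rewrite derM d1 der_x => /addr0_eq E.
by apply: etrans (esym E) _; exact: esym (mulNr _ _).
Qed.

Lemma lead_y_affine P : is_affine P -> c2 P != 0 -> ord P (y_fun F) = 0.
Proof.
move=> aP c20; have := @lead_regular _ _ P 'X; rewrite chart_funX chart_valX => /(_ c20)/lead_ord.
by case: P aP {c20}.
Qed.

Lemma ord_y_infinite P : ~~ is_affine P -> ord P (y_fun F) = - 3%:Z.
Proof.
move=> iP; have yu := y_fun_unit F_sep F_size.
have := lead_ord (lead_poly_infinite F_sep F_size K_two iP (F_neq0 (F_gt1 F_size))).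
rewrite -y_fun_sqr ordX // F_size /=; lia.
Qed.

(** The uniformizer is [x - c], [y] or [1 / x], with derivative [2 y h], [F' h] or
    [- 2 y h / x ^ 2]. In the affine cases the factor of [h] does not vanish at [P], in the second
    one because [F] has simple roots; at infinity its order is [-3 + 2 = -1]. *)
Lemma ord_der_uniformizer P : h \is a GRing.unit ->
  ord P (d (uniformizer P)) = ord P h - (if is_affine P then 0 else 1).
Proof.
have := der_xV; have := der_y; have := der_x; clearbody h => dx dy dxV.
move=> hu; have yu := y_fun_unit F_sep F_size; have xu := x_fun_unit F_sep F_size.
have tu : const_fun F 2%:R \is a GRing.unit by rewrite -poly_funC poly_unit polyC_eq0.
have yyh : ord P (2%:R * y_fun F * h) = ord P (y_fun F) + ord P h.
  rewrite -(rmorph_nat (const_fun F)) !ordM ?unitrM ?tu ?yu //.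
  by rewrite (ord_const F_sep F_size K_two) // add0r.
case: ifP => [aP|/negbT iP].
  rewrite subr0 /uniformizer; case: (eqVneq (c2 P) 0) => /= [c20|c20].
    have -> : (coords P).2 = y_fun F by case: P aP {c20 yyh}.
    have r : root F (c1 P).
      rewrite rootE; case: P aP c20 {yyh} => // [[[a b] /= ab]] _ b0.
      by move: ab; rewrite b0 expr0n /= eq_sym.
    have := F_simple_root F_sep r; rewrite rootE -(chart_valC P) => F'0.
    have := lead_ord (lead_regular F'0); rewrite chart_funC xeval_affine // => o.
    have F'u : poly_fun F F^`() \is a GRing.unit.
      by rewrite -(xeval_affine _ aP) -chart_funC (chart_fun_unit F_sep F_size K_two).
    by rewrite dy ordM // o add0r.
  have -> : (coords P).1 = x_fun F by case: P aP {c20 yyh}.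
  rewrite -[_ - _]/(x_fun F + - const_fun F (c1 P)) -(rmorphN (const_fun F)) derD der_const addr0.
  by rewrite dx yyh lead_y_affine // add0r.
rewrite uniformizer_infinite // dxV.
have -> : - (2%:R * y_fun F * h) * (x_fun F)^-2 =
   const_fun F (-1) * (2%:R * y_fun F * h) * (x_fun F ^+ 2)^-1.
  by rewrite (rmorphN (const_fun F)) (rmorph1 (const_fun F)) mulN1r.
have N1u : const_fun F (-1) \is a GRing.unit by rewrite -poly_funC poly_unit polyC_eq0 N1_neq0.
have au : 2%:R * y_fun F * h \is a GRing.unit by rewrite unitrM two_y_unit hu.
have x2u : x_fun F ^+ 2 \is a GRing.unit := unitrX 2 xu.
have x2Vu : (x_fun F ^+ 2)^-1 \is a GRing.unit by rewrite unitrV x2u.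
have ayu : const_fun F (-1) * (2%:R * y_fun F * h) \is a GRing.unit by rewrite unitrM N1u au.
rewrite (ordM P ayu x2Vu) (ordM P N1u au) (ordV P x2u) (ordX P 2 xu).
rewrite (ord_const F_sep F_size K_two) ?N1_neq0 // yyh ord_y_infinite //.
have ox := lead_ord (lead_x_infinite F_sep F_size K_two iP).
rewrite ox; move: (ord P h) => o.
clear; lia.
Qed.

End Canonical.

(** The divisor of [dx / (2 y)] is the sum of the points at infinity, so this sum can replace any
    canonical divisor in a divisor class. *)
Lemma canonical_divisorE (kappa : divisor F) : canonical_divisor kappa ->
  exists h, h \is a GRing.unit /\
    forall P, coeff P kappa = (if is_affine P then 0 else 1) - ord P h.
Proof.
move=> [d [d_der d0 H]]; exists (d (x_fun F) / (2%:R * y_fun F)).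
have hu := der_nonzero d_der d0; split=> // P.
by rewrite H (ord_der_uniformizer d_der P hu); lia.
Qed.

End Divisors.

(** * The Weil pairing as a product of local symbols *)

Section CubeRootSymbol.
Variable K : fieldType.
Implicit Types (a b u v m : int) (x y : K).

Lemma N1z_mul3 m : (-1) ^ (m * 3) = (-1) ^ m :> K.
Proof.
have -> : m * 3 = m + m * 2 by lia.
by rewrite expfzDr ?N1_neq0 // mulrC [m * 2]mulrC -exprz_exp (_ : (-1) ^ 2 = 1)
  ?exp1rz ?mul1r // -exprnP sqrrN expr1n.
Qed.

(* [symb a b x y] is a cube root of [symb (a * 3) (b * 3) x y]; multiplying the two
   functions by cubes changes it by honest symbols. *)
Lemma symb_deform a b u v x1 x2 xu xv c1 c2 :
  x1 != 0 -> x2 != 0 -> xu != 0 -> xv != 0 -> c1 != 0 -> c2 != 0 ->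
  symb (a + u) (b + v) (c1 * x1 * xu ^+ 3) (c2 * x2 * xv ^+ 3) =
  symb a b x1 x2 * symb u (b * 3) xu x2 * symb (a * 3) v x1 xv * symb u v xu xv ^+ 3 *
  (c1 ^ (b + v) / c2 ^ (a + u)).
Proof.
move=> x10 x20 xu0 xv0 c10 c20; rewrite /symb.
have cube x m n : x != 0 -> (x ^+ 3) ^ (m + n) = (x ^ m) ^+ 3 * (x ^ n) ^+ 3 /\ x ^ (m * 3) = (x ^ m) ^+ 3.
  move=> x0; split; last by rewrite -exprz_exp exprnP.
  by rewrite expfzDr ?expf_neq0 //; congr (_ * _); rewrite !exprnP !exprz_exp mulrC.
have [cu1 cu2] := cube xu b v xu0; have [cv1 cv2] := cube xv a u xv0.
have -> : u * (b * 3) = (u * b) * 3 by rewrite mulrA.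
have -> : a * 3 * v = (a * v) * 3 by rewrite mulrAC.
rewrite (expfzMl (c1 * x1)) (expfzMl c1) (expfzMl (c2 * x2)) (expfzMl c2) cu1 cv1 cu2 cv2 !N1z_mul3.
have -> : (a + u) * (b + v) = a * b + a * v + (u * b + u * v) by ring.
rewrite !expfzDr ?N1_neq0 //.
have S m : ((-1) ^ m) ^+ 3 = (-1) ^ m :> K by rewrite exprnP exprz_exp N1z_mul3.
rewrite !exprMn S !exprVn.
have nz x m : x != 0 -> x ^ m != 0 by exact: expfz_neq0.
have := nz _ a x20; have := nz _ u x20.
have := nz _ a xv0; have := nz _ u xv0; have := nz _ a c20; have := nz _ u c20.
move: (x1 ^ b) (x1 ^ v) (x2 ^ a) (x2 ^ u) (xv ^ a) (xv ^ u) (c2 ^ a) (c2 ^ u) (xu ^ b) (xu ^ v)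
  (c1 ^ b) (c1 ^ v) ((-1) ^ (a * b)) ((-1) ^ (a * v)) ((-1) ^ (u * b)) ((-1) ^ (u * v)).
clear; move=> A1 A2 A3 A4 A5 A6 A7 A8 A9 A10 A11 A12 A13 A14 A15 A16 n1 n2 n3 n4 n5 n6.
by field; rewrite n1 n2 n3 n4 n5 n6.
Qed.

End CubeRootSymbol.

Section WeilSymbol.
Variables (K : closedFieldType) (F : {poly K}).
Local Notation L := (funfield F).
Hypothesis F_sep : separable_poly F.
Hypothesis F_size : size F = 7%N.
Hypothesis K_two : 2%:R != 0 :> K.
Implicit Types (P : Defs.point F) (f g h u v w : L) (c : K).

Opaque poly_fun const_fun x_fun y_fun conj_fun.

Local Notation unitE := (funfield_unitE F_sep (F_gt1 F_size)).
Local Notation poly_unit := (poly_fun_unit F_sep (F_gt1 F_size)).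
Local Notation ordM := (ordM F_sep F_size K_two).
Local Notation ordV := (ordV F_sep F_size K_two).
Local Notation ordX := (ordX F_sep F_size K_two).
Local Notation lcM := (lcM F_sep F_size K_two).
Local Notation lcX := (lcX F_sep F_size K_two).

Lemma cube_root_exists c : exists b, b ^+ 3 = c.
Proof.
have /closed_rootP[b] : size ('X^3 - c%:P) != 1%N.
  by rewrite size_polyDl size_polyXn // size_polyN size_polyC; case: (_ != 0).
by rewrite rootE !hornerE subr_eq0 => /eqP; exists b.
Qed.

(** Since three times [b] is principal, [b] has degree 0; in multiplicative form this is reciprocity
    of [f] against a cube root of [c]. *)
Lemma evprod_const c f (b : Defs.point F -> int) : c != 0 -> f \is a GRing.unit ->
  (forall P, ord P f = b P * 3) -> evprod (fun P => c ^ b P) 1.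
Proof.
move=> c0 fu fb; have [d dc] := cube_root_exists c.
have d0 : d != 0 by apply: contraNneq c0 => d0; rewrite -dc d0 expr0n.
have := reciprocal_const F_sep F_size K_two d0 fu; apply: eq_evprod => P.
by rewrite (tame_const F_sep F_size K_two) // fb -dc exprnP exprz_exp mulrC.
Qed.

Variables (f1 f2 : L) (a b : Defs.point F -> int).
Hypothesis f1_unit : f1 \is a GRing.unit.
Hypothesis f2_unit : f2 \is a GRing.unit.
Hypothesis ord_f1 : forall P, ord P f1 = a P * 3.
Hypothesis ord_f2 : forall P, ord P f2 = b P * 3.

Definition weil_symbol P : K := symb (a P) (b P) (lc P f1) (lc P f2).

(** By [symb_deform] the two families of symbols differ by tame symbols and by powers of [c] and
    [d], whose products over all points are 1. So the product of the symbols does not depend on the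
    divisors chosen in the two classes. *)
Lemma evprod_deform u v (c d z : K) : u \is a GRing.unit -> v \is a GRing.unit -> c != 0 -> d != 0 ->
  evprod (fun P => symb (a P + ord P u) (b P + ord P v)
    (c * lc P f1 * lc P u ^+ 3) (d * lc P f2 * lc P v ^+ 3)) z ->
  evprod weil_symbol z.
Proof.
move=> uu vu c0 d0 H.
have u3 : u ^+ 3 \is a GRing.unit := unitrX 3 uu.
have v3 : v ^+ 3 \is a GRing.unit := unitrX 3 vu.
have rec := weil_reciprocity F_sep F_size K_two.
have E1 := rec _ _ uu f2_unit; have E2 := rec _ _ f1_unit vu; have E3 := rec _ _ uu vu.
have fu : f1 * u ^+ 3 \is a GRing.unit by rewrite unitrM f1_unit u3.
have gu : f2 * v ^+ 3 \is a GRing.unit by rewrite unitrM f2_unit v3.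
have of1 P : ord P (f1 * u ^+ 3) = (a P + ord P u) * 3.
  by rewrite (ordM P f1_unit u3) (ordX P 3 uu) ord_f1 mulrDl.
have of2 P : ord P (f2 * v ^+ 3) = (b P + ord P v) * 3.
  by rewrite (ordM P f2_unit v3) (ordX P 3 vu) ord_f2 mulrDl.
have C1 := evprod_const c0 gu of2; have C2 := evprod_const d0 fu of1.
have := evprodM H (evprodV (evprodM E1 (evprodM E2 (evprodM (evprodM E3 (evprodM E3 E3))
  (evprodM C1 (evprodV C2)))))).
rewrite [X in evprod _ X](_ : _ = z); last by rewrite !(mul1r, mulr1, invr1).
apply: eq_evprod => P.
have lc0 := @lc_neq0 _ _ F_sep F_size K_two P.
have l1 := lc0 _ f1_unit; have l2 := lc0 _ f2_unit; have lu := lc0 _ uu; have lv := lc0 _ vu.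
rewrite symb_deform // /weil_symbol /tame !ord_f1 !ord_f2.
have S1 := symb_neq0 (ord P u) (b P * 3) lu l2.
have S2 := symb_neq0 (a P * 3) (ord P v) l1 lv.
have S3 := symb_neq0 (ord P u) (ord P v) lu lv.
have cc := expfz_neq0 (b P + ord P v) c0; have dd := expfz_neq0 (a P + ord P u) d0.
move: S1 S2 S3 cc dd; clear.
move: (symb (ord P u) (b P * 3) (lc P u) (lc P f2)) (symb (a P * 3) (ord P v) (lc P f1) (lc P v))
  (symb (ord P u) (ord P v) (lc P u) (lc P v)) (symb (a P) (b P) (lc P f1) (lc P f2))
  (c ^ (b P + ord P v)) (d ^ (a P + ord P u)) => A1 A2 A3 A4 C D n1 n2 n3 n4 n5.
by field; rewrite n1 n2 n3 n4 n5.
Qed.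

Variables (D1 D2 kappa : divisor F).
Hypothesis D1_eq : forall P, coeff P D1 - (if is_affine P then 0 else 1) = a P.
Hypothesis D2_eq : forall P, coeff P D2 - (if is_affine P then 0 else 1) = b P.
Hypothesis kappa_canonical : canonical_divisor kappa.

Lemma divclass_shift (D A : divisor F) (s : Defs.point F -> int) :
  (forall P, coeff P D - (if is_affine P then 0 else 1) = s P) ->
  divclass (D - kappa) A ->
  exists u, u \is a GRing.unit /\ forall P, coeff P A = s P + ord P u.
Proof.
move=> sE [w [w0 H]]; have [h [hu kE]] := canonical_divisorE F_sep F_size K_two kappa_canonical.
rewrite -unitE in w0; exists (h * w); split=> [|P]; first by rewrite unitrM hu w0.
rewrite (ordM P hu w0) -H -sE !coeffB kE; ring.
Qed.

Lemma divclass_shift_exists (D : divisor F) (s : Defs.point F -> int) u :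
  (forall P, coeff P D - (if is_affine P then 0 else 1) = s P) -> u \is a GRing.unit ->
  exists A, divclass (D - kappa) A /\ forall P, coeff P A = s P + ord P u.
Proof.
move=> sE uu; have [h [hu kE]] := canonical_divisorE F_sep F_size K_two kappa_canonical.
have hVu : h^-1 \is a GRing.unit by rewrite unitrV hu.
have wu : u * h^-1 \is a GRing.unit by rewrite unitrM uu hVu.
have [E HE] := divisor_exists F_sep F_size K_two wu.
exists (D - kappa + E); split.
  by exists (u * h^-1); rewrite addrC addKr.
move=> P; rewrite !coeffD coeffN HE.2 (ordM P uu hVu) (ordV P hu) -sE kE; ring.
Qed.

Lemma evprod_eval_div f (B : divisor F) : evprod (fun P => value P f ^ coeff P B) (eval_div f B).
Proof.
exists (dom B); split=> //; first exact: uniq_dom.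
by move=> P /coeff_outdom ->; rewrite expr0z.
Qed.

Lemma value_ord0 P f : f \is a GRing.unit -> ord P f = 0 -> value P f = lc P f.
Proof.
move=> fu f0; apply: (lead_value F_sep F_size K_two).
by have := leadP F_sep F_size K_two P fu; rewrite f0.
Qed.

(** The functions [f] and [f1 * u ^ 3] both have divisor [3 A], so they differ by a constant, and
    likewise for [g]. As [A] and [B] have disjoint supports, the symbol at each point is the local
    factor of [eval_div f B / eval_div g A]. *)
Lemma is_weil_symbol z : is_weil 3 (divclass (D1 - kappa)) (divclass (D2 - kappa)) z ->
  evprod weil_symbol z.
Proof.
move=> [A [B [f [g [[SA SB] disj [f0 fA] [g0 gB] ->]]]]].
rewrite -!unitE in f0 g0.
have [u [uu Au]] := divclass_shift D1_eq SA; have [v [vu Bv]] := divclass_shift D2_eq SB.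
have u3 : u ^+ 3 \is a GRing.unit := unitrX 3 uu.
have v3 : v ^+ 3 \is a GRing.unit := unitrX 3 vu.
have fu : f1 * u ^+ 3 \is a GRing.unit by rewrite unitrM f1_unit u3.
have gu : f2 * v ^+ 3 \is a GRing.unit by rewrite unitrM f2_unit v3.
have fA' P : ord P f = coeff P A * 3 by rewrite -fA coeffMn mulr_natr.
have gB' P : ord P g = coeff P B * 3 by rewrite -gB coeffMn mulr_natr.
have of1 P : ord P f = ord P (f1 * u ^+ 3).
  by rewrite fA' (ordM P f1_unit u3) (ordX P 3 uu) ord_f1 Au mulrDl.
have of2 P : ord P g = ord P (f2 * v ^+ 3).
  by rewrite gB' (ordM P f2_unit v3) (ordX P 3 vu) ord_f2 Bv mulrDl.
have [c [c0 fE]] := same_ord_const F_sep F_size K_two f0 fu of1.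
have [d [d0 gE]] := same_ord_const F_sep F_size K_two g0 gu of2.
have lf P : lc P f = c * lc P f1 * lc P u ^+ 3.
  have cu : const_fun F c \is a GRing.unit by rewrite -poly_funC poly_unit polyC_eq0.
  by rewrite fE (lcM P cu fu) (lcM P f1_unit u3) (lcX P 3 uu) (lc_const F_sep F_size K_two) // mulrA.
have lg P : lc P g = d * lc P f2 * lc P v ^+ 3.
  have cu : const_fun F d \is a GRing.unit by rewrite -poly_funC poly_unit polyC_eq0.
  by rewrite gE (lcM P cu gu) (lcM P f2_unit v3) (lcX P 3 vu) (lc_const F_sep F_size K_two) // mulrA.
apply: (evprod_deform uu vu c0 d0).
apply: eq_evprod (evprodM (evprod_eval_div f B) (evprodV (evprod_eval_div g A))) => P.
rewrite -Au -Bv -lf -lg /symb; have [A0|B0] := disj P.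
  rewrite A0 mul0r !expr0z mul1r !invr1 value_ord0 // fA' A0 mul0r //.
by rewrite B0 mulr0 !expr0z !mul1r value_ord0 // gB' B0 mul0r.
Qed.

(** Without divisors of disjoint supports in the two classes [weil_pairing] would be its junk value
    0; [u] and [v] are to be chosen so as to separate the supports. *)
Lemma weil_exists u v : u \is a GRing.unit -> v \is a GRing.unit ->
  (forall P, a P + ord P u = 0 \/ b P + ord P v = 0) ->
  exists z, is_weil 3 (divclass (D1 - kappa)) (divclass (D2 - kappa)) z.
Proof.
move=> uu vu disj.
have u3 : u ^+ 3 \is a GRing.unit := unitrX 3 uu.
have v3 : v ^+ 3 \is a GRing.unit := unitrX 3 vu.
have fu : f1 * u ^+ 3 \is a GRing.unit by rewrite unitrM f1_unit u3.
have gu : f2 * v ^+ 3 \is a GRing.unit by rewrite unitrM f2_unit v3.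
have [A [SA Au]] := divclass_shift_exists D1_eq uu.
have [B [SB Bv]] := divclass_shift_exists D2_eq vu.
exists (eval_div (f1 * u ^+ 3) B / eval_div (f2 * v ^+ 3) A).
exists A, B, (f1 * u ^+ 3), (f2 * v ^+ 3); split=> //.
- by move=> P; rewrite Au Bv; exact: disj.
- split=> [|P]; first by rewrite -unitE.
  by rewrite coeffMn Au (ordM P f1_unit u3) (ordX P 3 uu) ord_f1 -[LHS]mulr_natr mulrDl.
- split=> [|P]; first by rewrite -unitE.
  by rewrite coeffMn Bv (ordM P f2_unit v3) (ordX P 3 vu) ord_f2 -[LHS]mulr_natr mulrDl.
Qed.

End WeilSymbol.

(** * The functions [y - G] *)

Section ThreeTorsion.
Variables (K : closedFieldType) (F : {poly K}).
Local Notation L := (funfield F).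
Hypothesis F_sep : separable_poly F.
Hypothesis F_size : size F = 7%N.
Hypothesis K_two : 2%:R != 0 :> K.
Variables (G H : {poly K}) (lambda : K).
Hypothesis H_monic : H \is monic.
Hypothesis H_size : size H = 3%N.
Hypothesis lambda_neq0 : lambda != 0.
Hypothesis F_eq : F = G ^+ 2 + lambda *: H ^+ 3.
Implicit Types (P : Defs.point F) (f : L) (r : K).

Opaque poly_fun const_fun x_fun y_fun conj_fun.

Local Notation poly_unit := (poly_fun_unit F_sep (F_gt1 F_size)).
Local Notation lead_ord := (lead_ord F_sep F_size K_two).
Local Notation ordM := (ordM F_sep F_size K_two).
Local Notation c1 P := (center P).1.
Local Notation c2 P := (center P).2.

Let f : L := y_fun F - poly_fun F G.

Lemma torsion_funE : f = affine_fun F (- G) 1.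
Proof. by rewrite /affine_fun poly_funN poly_fun1 mul1r addrC. Qed.

Lemma torsion_norm : norm_poly F (- G) 1 = (- lambda) *: H ^+ 3.
Proof.
by rewrite /norm_poly sqrrN expr1n mul1r {1}F_eq opprD addrA subrr sub0r scaleNr.
Qed.

Lemma torsion_unit : f \is a GRing.unit.
Proof.
rewrite torsion_funE affine_fun_unit // torsion_norm scaler_eq0 oppr_eq0 negb_or lambda_neq0.
by rewrite expf_neq0 // monic_neq0.
Qed.

Lemma size_H_cube : size (H ^+ 3) = 7%N.
Proof. by rewrite !exprS expr0 mulr1 !size_mul ?mulf_neq0 ?monic_neq0 // H_size. Qed.

Lemma size_G : (size G <= 4)%N.
Proof.
have : (size (G ^+ 2) <= 7)%N.
  have -> : G ^+ 2 = F - lambda *: H ^+ 3 by rewrite F_eq addrK.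
  by rewrite (leq_trans (size_polyD _ _)) // size_polyN size_scale // size_H_cube F_size.
have [->|G0] := eqVneq G 0; first by rewrite size_poly0.
rewrite expr2 size_mul //; move: (size G) => k; clear; lia.
Qed.

Lemma F_coef6 : F`_6 = G`_3 ^+ 2 + lambda.
Proof.
rewrite F_eq coefD coefZ.
have -> : (H ^+ 3)`_6 = 1.
  by have := monic_exp 3 H_monic; rewrite monicE lead_coefE size_H_cube => /eqP.
rewrite mulr1; congr (_ + _).
rewrite expr2 coefM (bigD1 (inord 3)) //= inordK // big1 ?addr0 ?expr2 // => i.
move=> i3; have sG := size_G.
have [i_lt|i_ge] := ltnP i 3; last have [i_gt|i_le] := ltnP 3 i.
- by rewrite [X in _ * X]nth_default ?mulr0 //; apply: (leq_trans sG); move: (nat_of_ord i) i_lt => j; clear; lia.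
- by rewrite nth_default ?mul0r // (leq_trans sG).
- case/eqP: i3; apply: val_inj; rewrite /= inordK //; apply/eqP; rewrite eqn_leq i_le; move: (nat_of_ord i) i_ge => j; clear; lia.
Qed.

Lemma F_eval r : F.[r] = G.[r] ^+ 2 + lambda * H.[r] ^+ 3.
Proof. by rewrite {1}F_eq hornerD hornerZ !horner_exp. Qed.

(** Otherwise [G] would vanish at [r] as well, and [r] would be a double root of [F]. Hence no zero
    of [y - G] is a ramification point. *)
Lemma torsion_root_neq0 r : H.[r] = 0 -> F.[r] != 0.
Proof.
move=> Hr; apply/negP => /eqP Fr.
have Gr : G.[r] = 0.
  by apply/eqP; rewrite -sqrf_eq0 -Fr F_eval Hr expr0n mulr0 addr0.
have := F_simple_root F_sep (_ : root F r); rewrite rootE Fr eqxx => /(_ isT)/negP; apply.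
rewrite rootE {1}F_eq derivD derivZ !expr2 !exprS expr0 mulr1 !derivM.
by rewrite !(hornerD, hornerZ, hornerM) Gr Hr !(mulr0, mul0r, addr0).
Qed.

(** The pole has order exactly 3 at both points at infinity: there [Y ^ 2] is the leading
    coefficient of [F], which is the square of the coefficient of [x ^ 3] in [G] plus [lambda], so
    [Y] is not that coefficient. *)
Lemma torsion_infinite P : ~~ is_affine P -> lead P f (- 3%:Z) (c2 P - G`_3).
Proof.
move=> iP; have xu := x_fun_unit F_sep F_size.
have rE : (reverse_poly 3 G).[0] = G`_3 by rewrite horner_coef0 coef_poly.
have vE : chart_val P ('X - (reverse_poly 3 G)%:P) = c2 P - G`_3.
  by rewrite chart_valB chart_valX chart_valC (c1_infinite iP) rE.
have -> : f = x_fun F ^+ 3 * chart_fun P ('X - (reverse_poly 3 G)%:P).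
  rewrite chart_funB chart_funX chart_funC /f -(xeval_xV F_sep F_size size_G) mulrBr.
  have -> : (coords P).1 = (x_fun F)^-1 by case: P iP {vE}.
  have -> : (coords P).2 = y_fun F / x_fun F ^+ 3 by case: P iP {vE}.
  by rewrite [X in _ = X - _]mulrC mulrVK // unitrX.
have := leadX F_sep F_size 3 (lead_x_infinite F_sep F_size K_two iP).
rewrite expr1n => l3.
rewrite -[X in lead _ _ X]addr0 -[X in lead _ _ _ X]mul1r -vE; apply: leadM => //.
apply: lead_regular; rewrite vE; apply: contra_neq lambda_neq0 => /eqP.
rewrite subr_eq0 => /eqP e.
have : c2 P ^+ 2 = F`_6 by case: P iP {l3 vE e} => // -[s /= /eqP].
by rewrite e F_coef6 => /eqP; rewrite eq_sym addrC -subr_eq0 addrK => /eqP.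
Qed.

Lemma torsion_value P : is_affine P -> f = chart_fun P ('X - G%:P) /\
  chart_val P ('X - G%:P) = c2 P - G.[c1 P].
Proof.
move=> aP; rewrite chart_valB chart_valX chart_valC chart_funB chart_funX chart_funC xeval_affine //.
by split=> //; case: P aP.
Qed.

Lemma torsion_lead P : is_affine P -> c2 P != G.[c1 P] -> lead P f 0 (c2 P - G.[c1 P]).
Proof.
move=> aP cG; have [-> <-] := torsion_value aP; apply: lead_regular.
by have [_ ->] := torsion_value aP; rewrite subr_eq0.
Qed.

Variable D : divisor F.
Hypothesis D_eq : common_zeros f (poly_fun F H) D.

Lemma torsion_divisor_zero P : is_affine P -> coeff P D != 0 -> c2 P = G.[c1 P] /\ H.[c1 P] = 0.
Proof.
move=> aP; rewrite D_eq => D0.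
have cG : c2 P = G.[c1 P].
  apply/eqP; apply: contraNT D0 => /(torsion_lead aP)/lead_ord ->.
  by rewrite maxxx minEle; case: ifP => //; rewrite le_max lexx.
split=> //; apply/eqP; suff : H.[c1 P] ^+ 3 == 0 by rewrite expf_eq0.
have := center_sqr P; have -> : chart_poly P = F by case: P aP {D0 cG}.
rewrite F_eval -cG => /eqP.
by rewrite -subr_eq0 opprD addNKr oppr_eq0 mulf_eq0 (negbTE lambda_neq0).
Qed.

Lemma torsion_div P : ord P f = (coeff P D - (if is_affine P then 0 else 1)) * 3.
Proof.
have fu := torsion_unit.
have Hu : poly_fun F H \is a GRing.unit by rewrite poly_unit monic_neq0.
rewrite D_eq; case: ifP => [aP|/negbT iP]; last first.
  rewrite (lead_ord (torsion_infinite iP)) maxElt /= minEle le_max lexx //=.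
have [fE vE] := torsion_value aP.
have H0 : 0 <= ord P (poly_fun F H).
  have := @ord_regular _ _ F_sep F_size K_two P H%:P.
  by rewrite chart_funC xeval_affine // => /(_ Hu).
have f0 : 0 <= ord P f.
  by have := @ord_regular _ _ F_sep F_size K_two P ('X - G%:P); rewrite -fE => /(_ fu).
(* Either [y - G] does not vanish at [P], and the minimum in [common_zeros] is 0; or it carries the
   whole order of its norm, [3 k] with [k] the order of [H], and the minimum of [3 k] and [k] is
   [k]. *)
have key : ord P f = 0 \/ ord P f = ord P (poly_fun F H) * 3.
  have [cG|cG] := eqVneq (c2 P) G.[c1 P]; last by left; apply: lead_ord (torsion_lead aP cG).
  right.
  have Hr : H.[c1 P] = 0.
    apply/eqP; suff : H.[c1 P] ^+ 3 == 0 by rewrite expf_eq0.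
    have := center_sqr P; have -> : chart_poly P = F by case: P aP {fE vE H0 f0 cG}.
    rewrite F_eval -cG => /eqP.
    by rewrite -subr_eq0 opprD addNKr oppr_eq0 mulf_eq0 (negbTE lambda_neq0).
  have c20 : c2 P != 0.
    rewrite -sqrf_eq0 center_sqr; have -> : chart_poly P = F by case: P aP {fE vE H0 f0 cG Hr}.
    exact: torsion_root_neq0.
  (* The conjugate [- y - G] has value [- 2 y] at a zero of [y - G]. *)
  have o : ord P (conj_fun f) = 0.
    rewrite torsion_funE conj_affine_fun (affine_fun_regular _ _ aP).
    have cv : chart_val P ((- G)%:P + (-1)%:P * 'X) = - (2%:R * c2 P).
      by rewrite chart_valD chart_valM chart_valX !chart_valC !hornerE -cG; ring.
    by apply: lead_ord (lead_regular _); rewrite cv oppr_eq0 mulf_neq0.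
  have := ordM P fu (conj_fun_unit fu); rewrite o addr0 => <-.
  rewrite torsion_funE affine_fun_norm torsion_norm -mul_polyC poly_funM poly_funC poly_funXn.
  have lu : const_fun F (- lambda) \is a GRing.unit by rewrite -poly_funC poly_unit polyC_eq0 oppr_eq0.
  rewrite (ordM P lu (unitrX 3 Hu)) (ordX F_sep F_size K_two P 3 Hu).
  by rewrite (ord_const F_sep F_size K_two) ?oppr_eq0 // add0r.
rewrite subr0; case: key => [->|->].
  by rewrite maxxx minEle; case: ifP => //; rewrite le_max lexx.
have -> : Num.max 0 (ord P (poly_fun F H)) = ord P (poly_fun F H) by apply/max_idPr.
have -> : Num.max 0 (ord P (poly_fun F H) * 3) = ord P (poly_fun F H) * 3.
  by apply/max_idPr; rewrite mulr_ge0.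
congr (_ * _); apply/esym/min_idPr; move: H0; move: (ord _ _) => k; clear; lia.
Qed.

Lemma torsion_divisor_ge0 P : 0 <= coeff P D.
Proof. by rewrite D_eq le_min !le_max lexx. Qed.

Lemma torsion_fiber (zs : seq K) r : H = \prod_(z <- zs) ('X - z%:P) ->
  \sum_(P <- fiber F r) coeff P D = (count_mem r zs)%:Z.
Proof.
move=> HE; have l0 : - lambda != 0 by rewrite oppr_eq0.
have E : norm_poly F (- G) 1 = (- lambda) *: \prod_(z <- zs ++ zs ++ zs) ('X - z%:P).
  by rewrite torsion_norm !big_cat /= -HE !exprS expr0 mulr1.
have := fiber_ord_count F_sep F_size K_two l0 E r; rewrite -torsion_funE !count_cat.
have -> : \sum_(P <- fiber F r) ord P f = (\sum_(P <- fiber F r) coeff P D) * 3.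
  rewrite mulr_suml big_seq [RHS]big_seq; apply: eq_bigr => P.
  by rewrite mem_fiber torsion_div => /andP[-> _]; rewrite subr0.
move: (\sum_(P <- _) _) (count_mem r zs) => s k; clear; lia.
Qed.

End ThreeTorsion.

(** * The product of the symbols for disjoint divisors *)

Lemma symb_disjoint (K : fieldType) (n1 n2 : int) (x y x' y' : K) :
  n1 = 0 \/ n2 = 0 -> (n2 != 0 -> x = x') -> (n1 != 0 -> y = y') ->
  x' ^ n2 / y' ^ n1 = symb n1 n2 x y.
Proof.
case=> -> xE yE; rewrite /symb ?mul0r ?mulr0 !expr0z mul1r.
  by have [->|/xE ->] := eqVneq n2 0; rewrite ?expr0z.
by have [->|/yE ->] := eqVneq n1 0; rewrite ?expr0z ?mul1r.
Qed.

Section PairingValue.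
Variables (K : closedFieldType) (F : {poly K}).
Local Notation L := (funfield F).
Hypothesis F_sep : separable_poly F.
Hypothesis F_size : size F = 7%N.
Hypothesis K_two : 2%:R != 0 :> K.
Variables (G1 H1 G2 H2 : {poly K}) (lambda1 lambda2 : K).
Hypothesis H1_monic : H1 \is monic.
Hypothesis H1_size : size H1 = 3%N.
Hypothesis lambda1_neq0 : lambda1 != 0.
Hypothesis F_eq1 : F = G1 ^+ 2 + lambda1 *: H1 ^+ 3.
Hypothesis H2_monic : H2 \is monic.
Hypothesis H2_size : size H2 = 3%N.
Hypothesis lambda2_neq0 : lambda2 != 0.
Hypothesis F_eq2 : F = G2 ^+ 2 + lambda2 *: H2 ^+ 3.
Implicit Types (P Q : Defs.point F) (g h : L) (r : K).

Opaque poly_fun const_fun x_fun y_fun conj_fun.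

Local Notation c1 P := (center P).1.
Local Notation c2 P := (center P).2.

Let f1 : L := y_fun F - poly_fun F G1.
Let f2 : L := y_fun F - poly_fun F G2.

Variables D1 D2 : divisor F.
Hypothesis D1_eq : common_zeros f1 (poly_fun F H1) D1.
Hypothesis D2_eq : common_zeros f2 (poly_fun F H2) D2.

Definition shifted (D : divisor F) P : int := coeff P D - (if is_affine P then 0 else 1).

(** As [D_i] is carried by the points [(r, G_i (r))] with [H_i (r) = 0], this makes the supports of
    [D1] and [D2] disjoint. *)
Definition disjoint_roots := forall r, H1.[r] = 0 -> H2.[r] = 0 -> (G2 - G1).[r] != 0.

Lemma difference_root r : (G2 - G1).[r] = 0 -> lambda1 * H1.[r] ^+ 3 = lambda2 * H2.[r] ^+ 3.
Proof.
rewrite hornerD hornerN => /eqP; rewrite subr_eq0 => /eqP E.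
by apply: (addrI (G1.[r] ^+ 2)); rewrite -(F_eval F_eq1) -[in RHS]E -(F_eval F_eq2).
Qed.

Lemma difference_root_eq0 r : (G2 - G1).[r] = 0 -> (H1.[r] == 0) = (H2.[r] == 0).
Proof.
move=> /difference_root E; apply/idP/idP => /eqP H0; move: E; rewrite H0 expr0n mulr0 => /eqP.
  by rewrite eq_sym mulf_eq0 (negbTE lambda2_neq0) /= expf_eq0.
by rewrite mulf_eq0 (negbTE lambda1_neq0) /= expf_eq0.
Qed.

Hypothesis disj : disjoint_roots.

Lemma difference_neq0 r : H1.[r] = 0 \/ H2.[r] = 0 -> (G2 - G1).[r] != 0.
Proof.
move=> Hr; apply/negP => /eqP h0; have := difference_root_eq0 h0.
case: Hr => /eqP Hr; rewrite Hr => e; [have Hr' := Hr; have := esym e | have := e] => Hr''.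
  by have := disj (eqP Hr) (eqP Hr''); rewrite h0 eqxx.
by have := disj (eqP Hr'') (eqP Hr); rewrite h0 eqxx.
Qed.

Lemma disjoint_divisors P : is_affine P -> coeff P D1 = 0 \/ coeff P D2 = 0.
Proof.
move=> aP; have [|D10] := eqVneq (coeff P D1) 0; [by left | right; apply/eqP].
apply/negPn/negP => D20.
have [e1 z1] := torsion_divisor_zero F_sep F_size K_two lambda1_neq0 F_eq1 D1_eq aP D10.
have [e2 z2] := torsion_divisor_zero F_sep F_size K_two lambda2_neq0 F_eq2 D2_eq aP D20.
by have := disj z1 z2; rewrite hornerD hornerN -e1 -e2 subrr eqxx.
Qed.

Variables zs1 zs2 : seq K.
Hypothesis H1_split : H1 = \prod_(z <- zs1) ('X - z%:P).
Hypothesis H2_split : H2 = \prod_(z <- zs2) ('X - z%:P).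

Lemma mem_root_split (zs : seq K) (H : {poly K}) z : H = \prod_(z <- zs) ('X - z%:P) ->
  z \in zs -> H.[z] = 0.
Proof. by move=> -> zz; apply/eqP; rewrite -rootE root_prod_XsubC. Qed.

Lemma pairing_value_disjoint :
  evprod (weil_symbol f1 f2 (shifted D1) (shifted D2))
    (lambda2 / lambda1 * \prod_(z <- zs2) (G2 - G1).[z] / \prod_(z <- zs1) (G2 - G1).[z]).
Proof.
have sz1 : size zs1 = 2%N by have := size_prod_XsubC zs1 id; rewrite -H1_split H1_size => -[].
pose h := G2 - G1.
have d1 := torsion_fiber F_sep F_size K_two H1_monic H1_size lambda1_neq0 F_eq1 D1_eq.
have d2 := torsion_fiber F_sep F_size K_two H2_monic H2_size lambda2_neq0 F_eq2 D2_eq.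
have nz2 z : z \in zs2 -> h.[z] != 0.
  by move=> zz; apply: difference_neq0; right; exact: mem_root_split H2_split zz.
have nz1 z : z \in zs1 -> - h.[z] != 0.
  by move=> zz; rewrite oppr_eq0; apply: difference_neq0; left; exact: mem_root_split H1_split zz.
have A2 := evprod_affine K_two (phi := fun r => h.[r]) (fun r => d2 _ r H2_split)
  (fun P _ => torsion_divisor_ge0 D2_eq P) nz2.
have A1 := evprod_affine K_two (phi := fun r => - h.[r]) (fun r => d1 _ r H1_split)
  (fun P _ => torsion_divisor_ge0 D1_eq P) nz1.
pose psi P := if is_affine P then 1 else weil_symbol f1 f2 (shifted D1) (shifted D2) P.
have := @evprod_fibers _ F K_two psi [::] isT.
rewrite big_nil mul1r => B; have {}B : evprod psi (\prod_(P <- infinite_fiber F) psi P).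
  by apply: B => P; rewrite /psi => ->.
(* At infinity both multiplicities are -1, so the symbol at [s] is [- (s - g2) / (s - g1)], with
   [g_i] the coefficient of [x ^ 3] in [G_i]. The product over [s] and [- s] is
   [(g2 ^ 2 - s ^ 2) / (g1 ^ 2 - s ^ 2)], where [s ^ 2 = g_i ^ 2 + lambda_i]. *)
have lE : \prod_(P <- infinite_fiber F) psi P = lambda2 / lambda1.
  have iP := xchooseP (infinite_point_exists F); rewrite /infinite_fiber; set P := xchoose _ in iP *.
  have iP' : ~~ is_affine (conj_point P) by case: P iP {B}.
  have c20 := c2_infinite F_size iP.
  have sq : c2 P ^+ 2 = F`_6 by case: P iP {B iP' c20} => // -[s /= /eqP].
  have D1inf Q : ~~ is_affine Q -> shifted D1 Q = -1.
    move=> iQ; have := torsion_div F_sep F_size K_two H1_monic H1_size lambda1_neq0 F_eq1 D1_eq Q.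
    rewrite (lead_ord F_sep F_size K_two (torsion_infinite F_sep F_size K_two H1_monic H1_size lambda1_neq0 F_eq1 iQ)).
    rewrite -/(shifted D1 Q); move: (shifted D1 Q) => k; clear; lia.
  have D2inf Q : ~~ is_affine Q -> shifted D2 Q = -1.
    move=> iQ; have := torsion_div F_sep F_size K_two H2_monic H2_size lambda2_neq0 F_eq2 D2_eq Q.
    rewrite (lead_ord F_sep F_size K_two (torsion_infinite F_sep F_size K_two H2_monic H2_size lambda2_neq0 F_eq2 iQ)).
    rewrite -/(shifted D2 Q); move: (shifted D2 Q) => k; clear; lia.
  have T1 Q (iQ : ~~ is_affine Q) := torsion_infinite F_sep F_size K_two H1_monic H1_size lambda1_neq0 F_eq1 iQ.
  have T2 Q (iQ : ~~ is_affine Q) := torsion_infinite F_sep F_size K_two H2_monic H2_size lambda2_neq0 F_eq2 iQ.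
  have psiE Q : ~~ is_affine Q -> psi Q = - ((c2 Q - G2`_3) / (c2 Q - G1`_3)).
    move=> iQ; rewrite /psi (negbTE iQ) /weil_symbol D1inf // D2inf //.
    rewrite (lead_lc F_sep F_size K_two (T1 Q iQ)) (lead_lc F_sep F_size K_two (T2 Q iQ)).
    by rewrite /symb mulrNN mulr1 expr1z -!invr_expz !expr1z invrK mulN1r mulNr [in RHS]mulrC.
  rewrite /orbit_of (negbTE c20) !big_cons big_nil mulr1 !psiE // center_conj /= mulrNN mulf_div.
  have E (g : K) : (c2 P - g) * (- c2 P - g) = g ^+ 2 - c2 P ^+ 2 by ring.
  rewrite !E sq {1}(F_coef6 F_size H2_monic H2_size lambda2_neq0 F_eq2) (F_coef6 F_size H1_monic H1_size lambda1_neq0 F_eq1).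
  by rewrite !opprD !addrA !subrr !sub0r invrN mulrNN.
rewrite lE in B.
have := evprodM B (evprodM A2 (evprodV A1)).
(* On [D2] the function [y - G1] takes the value of [h], on [D1] the function [y - G2] that of
   [- h]; the signs cancel because [H1] has two roots. *)
have -> : \prod_(z <- zs1) - h.[z] = \prod_(z <- zs1) h.[z].
  by case: (zs1) sz1 => [|z1 [|z2 [|]]] // _; rewrite !big_cons !big_nil; ring.
rewrite mulrA; apply: eq_evprod => P; rewrite /psi.
case: (boolP (is_affine P)) => aP; last by rewrite invr1 !mulr1.
rewrite mul1r /weil_symbol /shifted aP !subr0.
have T1 := @torsion_lead _ F G1 P aP.
have T2 := @torsion_lead _ F G2 P aP.
apply: symb_disjoint (disjoint_divisors aP) _ _ => [D20|D10].
  have [e2 z2] := torsion_divisor_zero F_sep F_size K_two lambda2_neq0 F_eq2 D2_eq aP D20.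
  have hE : c2 P - G1.[c1 P] = h.[c1 P] by rewrite e2 /h hornerD hornerN.
  have cG : c2 P != G1.[c1 P] by rewrite -subr_eq0 hE difference_neq0 //; right.
  by rewrite /f1 (lead_lc F_sep F_size K_two (T1 cG)) hE.
have [e1 z1] := torsion_divisor_zero F_sep F_size K_two lambda1_neq0 F_eq1 D1_eq aP D10.
have hE : c2 P - G2.[c1 P] = - h.[c1 P] by rewrite e1 /h hornerD hornerN opprB.
have cG : c2 P != G2.[c1 P] by rewrite -subr_eq0 hE oppr_eq0 difference_neq0 //; left.
by rewrite /f2 (lead_lc F_sep F_size K_two (T2 cG)) hE.
Qed.

End PairingValue.

(** * The pencil of [H1] and [H2] *)

(** For each of three members of the pencil, [ea] says that its parameter is 1, so that its degree
    drops because [H1] and [H2] are monic; [sa] is its size and [na] the number of finite roots of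
    [h] on it. The [4 - sh] roots at infinity of the cubic form [h] are counted on the member with
    parameter 1; the equation between the sizes, with [ss <= 4], bounds them by the roots at
    infinity of that member, and forces [sh = 4] if no parameter is 1. The final equivalences are
    about divisibility of forms: [h] contains all finite roots of the member, and the quotient has
    degree at most 1. *)
Lemma pencil_arith (ea eb ec : bool) (na nb nc sa sb sc sh ss n i j k : nat) :
  ~~ (ea && eb) -> ~~ (ea && ec) -> ~~ (eb && ec) -> (sh <= 4)%N -> (ss <= 4)%N ->
  (na < sa)%N -> (nb < sb)%N -> (nc < sc)%N -> (sh + ss).+1 = (sa + sb + sc)%N ->
  sh = n.+1 -> (na + nb + nc)%N = n ->
  (if ea then (sa <= 2)%N else sa == 3%N) -> (if eb then (sb <= 2)%N else sb == 3%N) ->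
  (if ec then (sc <= 2)%N else sc == 3%N) ->
  i = (na + if ea then 4 - sh else 0)%N -> j = (nb + if eb then 4 - sh else 0)%N ->
  k = (nc + if ec then 4 - sh else 0)%N ->
  [/\ (i + j + k = 3)%N, [/\ (i <= 2)%N, (j <= 2)%N & (k <= 2)%N] &
      [/\ (sa <= na.+1)%N /\ (sh <= sa.+1)%N <-> i = 2%N,
          (sb <= nb.+1)%N /\ (sh <= sb.+1)%N <-> j = 2%N &
          (sc <= nc.+1)%N /\ (sh <= sc.+1)%N <-> k = 2%N]].
Proof. by case: ea eb ec => [] [] [] //= *; (split; [lia | split; lia | split; lia]). Qed.

Section CubicForms.
Variables (K : closedFieldType) (H1 H2 h s : {poly K}) (lambda1 lambda2 : K).
Hypothesis H1_monic : H1 \is monic.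
Hypothesis H1_size : size H1 = 3%N.
Hypothesis H2_monic : H2 \is monic.
Hypothesis H2_size : size H2 = 3%N.
Hypothesis H1_neq_H2 : H1 != H2.
Hypothesis lambda1_neq0 : lambda1 != 0.
Hypothesis lambda2_neq0 : lambda2 != 0.
Hypothesis h_size : (size h <= 4)%N.
Hypothesis s_size : (size s <= 4)%N.
Hypothesis hs_eq : h * s = lambda1 *: H1 ^+ 3 - lambda2 *: H2 ^+ 3.
Let rho := lambda2 / lambda1.

Definition pencil (a : K) : {poly K} := H1 - a *: H2.

Lemma pencil_neq0 a : pencil a != 0.
Proof.
apply: contra_neq H1_neq_H2 => /eqP; rewrite subr_eq0 => /eqP E.
have := congr1 lead_coef E; rewrite lead_coefZ (monicP H1_monic) (monicP H2_monic) mulr1 => a1.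
by rewrite E -a1 scale1r.
Qed.

Lemma pencil_coef2 a : (pencil a)`_2 = 1 - a.
Proof.
rewrite coefB coefZ.
have lc (H : {poly K}) : H \is monic -> size H = 3%N -> H`_2 = 1.
  by move=> /monicP; rewrite lead_coefE => <- ->.
by rewrite !lc // mulr1.
Qed.

Lemma pencil_size_le a : (size (pencil a) <= 3)%N.
Proof.
rewrite (leq_trans (size_polyD _ _)) // size_polyN H1_size geq_max leqnn.
by rewrite (leq_trans (size_scale_leq _ _)) ?H2_size.
Qed.

Lemma pencil_size a : a != 1 -> size (pencil a) = 3%N.
Proof.
move=> a1; apply/eqP; rewrite eqn_leq pencil_size_le /= ltnNge; apply/negP => sz.
have := pencil_coef2 a; rewrite nth_default // => /esym/eqP.
by rewrite subr_eq0 eq_sym (negbTE a1).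
Qed.

Lemma pencil_size1 : (size (pencil 1) <= 2)%N.
Proof.
apply/leq_sizeP => j; rewrite leq_eqVlt => /predU1P[<-|j2]; first by rewrite pencil_coef2 subrr.
by rewrite nth_default // (leq_trans (pencil_size_le 1)).
Qed.

Section Root.
Variables a b c : K.
Hypothesis abc_uniq : uniq [:: a; b; c].
Hypothesis abc_prod : pencil a * pencil b * pencil c = H1 ^+ 3 - rho *: H2 ^+ 3.

Lemma hs_pencil : h * s = lambda1 *: (pencil a * pencil b * pencil c).
Proof. by rewrite abc_prod hs_eq scalerBr scalerA /rho mulrC divfK. Qed.

Lemma h_s_neq0 : h != 0 /\ s != 0.
Proof.
have : h * s != 0 by rewrite hs_pencil scaler_eq0 negb_or lambda1_neq0 !mulf_neq0 ?pencil_neq0.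
by rewrite mulf_eq0 negb_or => /andP[].
Qed.

Lemma size_pencils : (size h + size s).+1 = (size (pencil a) + size (pencil b) + size (pencil c))%N.
Proof.
have [h0 s0] := h_s_neq0.
have := congr1 (fun p : {poly K} => size p) hs_pencil; rewrite size_scale // !size_mul ?mulf_neq0 ?pencil_neq0 //.
have := pencil_neq0 a; have := pencil_neq0 b; have := pencil_neq0 c.
move: h0 s0; rewrite -!size_poly_gt0.
move: (size h) (size s) (size (pencil a)) (size (pencil b)) (size (pencil c)); clear; lia.
Qed.

Variables (rs : seq K) (c0 : K).
Hypothesis c0_neq0 : c0 != 0.
Hypothesis h_split : h = c0 *: \prod_(r <- rs) ('X - r%:P).
Hypothesis disj : forall r, r \in rs -> H2.[r] != 0.

Definition pencil_count a := count (fun r => (pencil a).[r] == 0) rs.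

Lemma pencil_root_uniq r u v : r \in rs -> u != v -> (pencil u).[r] = 0 -> (pencil v).[r] != 0.
Proof.
move=> /disj H2r uv; rewrite !hornerE => /eqP; rewrite subr_eq0 => /eqP ->.
by rewrite -mulrBl mulf_neq0 // subr_eq0.
Qed.

Definition pencil_part : {poly K} := \prod_(r <- rs | (pencil a).[r] == 0) ('X - r%:P).

Lemma size_pencil_part : size pencil_part = (pencil_count a).+1.
Proof. by rewrite /pencil_part -big_filter size_prod_XsubC size_filter. Qed.

Lemma pencil_part_h : pencil_part %| h.
Proof.
rewrite h_split (bigID (fun r => (pencil a).[r] == 0)) /= dvdpZr //.
exact: dvdp_mulr.
Qed.

(** The part divides [h * s], a multiple of the product of the three members. It is coprime to the
    two other members, because [H2] vanishes wherever two members do, and this is excluded on [rs].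
    So the roots of [h] on a member are bounded by its degree. *)
Lemma pencil_part_dvd : pencil_part %| pencil a.
Proof.
have [ab ac] : a != b /\ a != c.
  by move: abc_uniq; rewrite /= !inE negb_or => /andP[/andP[]].
have cop u : a != u -> coprimep pencil_part (pencil u).
  move=> au; rewrite /pencil_part big_seq_cond; apply: (big_ind (fun p => coprimep p (pencil u))) => [|p q|r /andP[rr /eqP ar]].
  - exact: coprime1p.
  - by rewrite coprimepMl => -> ->.
  - by rewrite coprimep_sym coprimep_XsubC rootE; apply: pencil_root_uniq ar.
have : pencil_part %| h * s by rewrite dvdp_mulr // pencil_part_h.
rewrite hs_pencil dvdpZr // Gauss_dvdpl; last exact: cop.
by rewrite Gauss_dvdpl; last exact: cop.
Qed.

Lemma pencil_count_le : (pencil_count a < size (pencil a))%N.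
Proof. by rewrite -size_pencil_part; apply: dvdp_leq pencil_part_dvd; apply: pencil_neq0. Qed.

Lemma size_rs : size h = (size rs).+1.
Proof. by rewrite h_split size_scale // size_prod_XsubC. Qed.

(** When [h] is [q] times the member, [rs] consists of the roots of [q] and those of the member with
    multiplicities, so the count reaches the degree of the member. The second inequality is the
    bound on the size of [q]. *)
Lemma form_dvd_count : form_dvd 2 3 (pencil a) h ->
  (size (pencil a) <= (pencil_count a).+1)%N /\ (size h <= (size (pencil a)).+1)%N.
Proof.
move=> [q [sq hE]]; have [h0 _] := h_s_neq0.
have q0 : q != 0 by apply: contra_neq h0 => q0; rewrite hE q0 mul0r.
have sh : size h = (size q + size (pencil a)).-1 by rewrite hE size_mul // pencil_neq0.
split; last first.
  rewrite sh; move: sq; rewrite /=.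
  by move: (size q) (size (pencil a)) => k l; clear; lia.
have [qs qE] := closed_field_poly_normal q.
have [ts tE] := closed_field_poly_normal (pencil a).
have st : size (pencil a) = (size ts).+1.
  by rewrite tE size_scale ?lead_coef_eq0 ?pencil_neq0 // size_prod_XsubC.
have pe : perm_eq rs (qs ++ ts).
  apply: prod_XsubC_eq; rewrite big_cat /=.
  have E : c0 *: \prod_(r <- rs) ('X - r%:P) = (lead_coef q * lead_coef (pencil a)) *:
      (\prod_(r <- qs) ('X - r%:P) * \prod_(r <- ts) ('X - r%:P)).
    by rewrite -h_split hE [in LHS]qE [in LHS]tE -scalerAl -scalerAr scalerA.
  have := congr1 lead_coef E; rewrite !lead_coefZ (monicP (monic_prod_XsubC _ _ _)).
  rewrite lead_coefM !(monicP (monic_prod_XsubC _ _ _)) !mulr1 => cE.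
  by move: E; rewrite -cE => /(scalerI c0_neq0).
rewrite /pencil_count (permP pe) count_cat st ltnS.
have -> : count (fun r => (pencil a).[r] == 0) ts = size ts.
  apply/eqP; rewrite -all_count; apply/allP => t tt.
  by rewrite tE hornerZ mulf_eq0 -rootE root_prod_XsubC tt orbT.
exact: leq_addl.
Qed.

Lemma count_form_dvd : (size (pencil a) <= (pencil_count a).+1)%N -> (size h <= (size (pencil a)).+1)%N ->
  form_dvd 2 3 (pencil a) h.
Proof.
move=> le1 le2; have [h0 _] := h_s_neq0.
have eqp : pencil_part %= pencil a.
  rewrite -dvdp_size_eqp ?pencil_part_dvd // size_pencil_part eqn_leq le1 andbT.
  exact: pencil_count_le.
have /dvdpP[q hE] : pencil a %| h by rewrite -(eqp_dvdl _ eqp) pencil_part_h.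
exists q; split=> //.
have q0 : q != 0 by apply: contra_neq h0 => q0; rewrite hE q0 mul0r.
move: le2; rewrite hE size_mul ?pencil_neq0 //.
have := pencil_neq0 a; rewrite -size_poly_gt0.
move: (size q) (size (pencil a)) => k l; clear; lia.
Qed.

End Root.

Lemma pencil_exists : 3%:R != 0 :> K -> exists a b c, [/\ uniq [:: a; b; c],
  pencil a * pencil b * pencil c = H1 ^+ 3 - rho *: H2 ^+ 3,
  a * b * c = rho & forall x, (x ^+ 3 == rho) = (x \in [:: a; b; c])].
Proof.
move=> K3; have r0 : rho != 0 by rewrite mulf_neq0 ?invr_eq0.
have [a aE] : exists a : K, a ^+ 3 = rho.
  have /closed_rootP[a] : size ('X^3 - rho%:P) != 1%N.
    by rewrite size_polyDl size_polyXn // size_polyN size_polyC; case: (_ != 0).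
  by rewrite rootE !hornerE subr_eq0 => /eqP; exists a.
(* A primitive cube root of unity: [z = 1] would give [3 = 0]. The cube roots of [rho] are then [a],
   [z a] and [z ^ 2 a]. *)
have [z zE] : exists z : K, z ^+ 2 + z + 1 = 0.
  have sz : size ('X + 1 : {poly K}) = 2%N by rewrite -polyC1 -[1%:P]opprK -polyCN size_XsubC.
  have /closed_rootP[z] : size ('X^2 + ('X + 1) : {poly K}) != 1%N.
    by rewrite size_polyDl size_polyXn // sz.
  by rewrite rootE !hornerD hornerXn hornerX hornerC addrA => /eqP; exists z.
have a0 : a != 0 by apply: contraNneq r0 => a0; rewrite -aE a0 expr0n.
have z1 : z != 1.
  by apply: contraNneq K3 => z1; rewrite -zE z1 expr1n; apply/eqP; ring.
have z3 : z ^+ 3 = 1.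
  by apply/eqP; rewrite -subr_eq0; apply/eqP; transitivity ((z - 1) * (z ^+ 2 + z + 1)); [ring | rewrite zE mulr0].
have z0 : z != 0 by apply: contraNneq (oner_neq0 K) => z0; rewrite -z3 z0 expr0n.
have z2 : z ^+ 2 = - z - 1 by apply/eqP; rewrite -subr_eq0 -zE; apply/eqP; ring.
exists a, (z * a), (z ^+ 2 * a); split.
- have neq (u v : K) : u != v -> u * a != v * a by rewrite (inj_eq (mulIf a0)).
  have e1 : 1 * a != z * a by apply: neq; rewrite eq_sym.
  have e2 : 1 * a != z ^+ 2 * a.
    by apply: neq; apply: contraNneq z1 => e; rewrite -z3 exprS -e mulr1.
  have e3 : z * a != z ^+ 2 * a.
    by apply: neq; apply: contraNneq z1 => e; apply/eqP/(mulfI z0); rewrite mulr1 -expr2 -e.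
  by rewrite mul1r in e1 e2; rewrite /= !inE negb_or e1 e2 e3.
- rewrite /pencil -aE -!mul_polyC (polyCM (z ^+ 2)) (polyCM z) !polyC_exp.
  have W : z%:P ^+ 2 + z%:P + 1 = 0 :> {poly K} by rewrite -polyC_exp -polyCD -polyC1 -polyCD zE.
  transitivity (H1 ^+ 3 - a%:P ^+ 3 * H2 ^+ 3 + (z%:P ^+ 2 + z%:P + 1) *
    (- (a%:P * H2 * H1 ^+ 2) + z%:P * (a%:P * H2) ^+ 2 * H1 - (z%:P - 1) * (a%:P * H2) ^+ 3)).
    by ring.
  by rewrite W mul0r addr0.
- by rewrite -aE; transitivity (z ^+ 3 * a ^+ 3); [ring | rewrite z3 mul1r].
- move=> x; apply/eqP/idP => [|]; last first.
    rewrite !inE -aE => /or3P[] /eqP -> //.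
      by transitivity (z ^+ 3 * a ^+ 3); [ring | rewrite z3 mul1r].
    by transitivity (z ^+ 3 * z ^+ 3 * a ^+ 3); [ring | rewrite z3 !mul1r].
  rewrite -aE => xE; have : (x - a) * (x - z * a) * (x - z ^+ 2 * a) = 0.
    transitivity (x ^+ 3 - z ^+ 3 * a ^+ 3 - (z ^+ 2 + z + 1) * (x ^+ 2 * a - z * a ^+ 2 * x)); first by ring.
    by rewrite z3 zE xE; ring.
  by move/eqP; rewrite !mulf_eq0 !subr_eq0 !inE -orbA.
Qed.

Lemma pencil_root a r : ((pencil a).[r] == 0) = (H1.[r] == a * H2.[r]).
Proof. by rewrite hornerD hornerN hornerZ subr_eq0. Qed.

(** At each [r] in [rs] the quotient [H1 / H2] is a cube root of [rho], and it is the parameter of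
    the only member through [r]. *)
Lemma prod_pencil_count a b c (rs : seq K) : uniq [:: a; b; c] ->
  (forall x, x ^+ 3 = rho -> x \in [:: a; b; c]) ->
  (forall r, r \in rs -> H2.[r] != 0 /\ H1.[r] ^+ 3 = rho * H2.[r] ^+ 3) ->
  \prod_(r <- rs) H1.[r] = \prod_(r <- rs) H2.[r] *
    (a ^+ pencil_count rs a * b ^+ pencil_count rs b * c ^+ pencil_count rs c) /\
  (pencil_count rs a + pencil_count rs b + pencil_count rs c = size rs)%N.
Proof.
move=> abcu cubes; have [ab [ac bc]] : a != b /\ a != c /\ b != c.
  by move: abcu; rewrite /= !inE negb_or andbT => /andP[/andP[-> ->] ->].
rewrite /pencil_count; elim: rs => [|r rs IH] H; first by rewrite !big_nil !expr0 !mulr1.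
have [|E S] := IH; first by move=> x xr; apply: H; rewrite inE xr orbT.
have [H2r H1r] := H r (mem_head _ _).
have : H1.[r] / H2.[r] \in [:: a; b; c].
  by apply: cubes; rewrite expr_div_n H1r mulfK // expf_neq0.
rewrite !big_cons /= E -S !pencil_root !inE.
have eqd u : (H1.[r] == u * H2.[r]) = (H1.[r] / H2.[r] == u).
  by apply/eqP/eqP => [->|<-]; rewrite ?mulfK ?divfK.
rewrite !eqd -[X in X * (_ * _) = _ /\ _](divfK H2r) => /or3P[] /eqP ->.
- rewrite eqxx (negbTE ab) (negbTE ac) !add0n add1n exprS; split; first ring.
  by [].
- rewrite eqxx eq_sym (negbTE ab) (negbTE bc) !add0n add1n exprS; split; first ring.
  by rewrite addnS addSn.
- rewrite eqxx eq_sym (negbTE ac) eq_sym (negbTE bc) !add0n add1n exprS; split; first ring.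
  by rewrite addnS.
Qed.

(** Both sides are the resultant of [H] and [h]; no sign appears because [H] has even degree. *)
Lemma prod_roots_exchange (H : {poly K}) (zs rs : seq K) (e : K) : size zs = 2%N ->
  H = \prod_(z <- zs) ('X - z%:P) -> h = e *: \prod_(r <- rs) ('X - r%:P) ->
  \prod_(z <- zs) h.[z] = e ^+ 2 * \prod_(r <- rs) H.[r].
Proof.
case: zs => [|z1 [|z2 [|]]] // _ HE hE; rewrite !big_cons big_nil mulr1.
have hz z : h.[z] = e * \prod_(r <- rs) (z - r).
  by rewrite hE hornerZ horner_prod; congr (_ * _); apply: eq_bigr => r _; rewrite hornerXsubC.
have -> : \prod_(r <- rs) H.[r] = \prod_(r <- rs) (z1 - r) * \prod_(r <- rs) (z2 - r).
  rewrite -big_split; apply: eq_bigr => r _.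
  by rewrite HE !big_cons big_nil mulr1 hornerM !hornerXsubC /=; ring.
by rewrite !hz; ring.
Qed.

Lemma pairing_value_form_dvd (zs1 zs2 : seq K) : 3%:R != 0 :> K ->
  H1 = \prod_(z <- zs1) ('X - z%:P) -> H2 = \prod_(z <- zs2) ('X - z%:P) ->
  (forall r, H1.[r] = 0 -> H2.[r] = 0 -> h.[r] != 0) ->
  rho * \prod_(z <- zs2) h.[z] / \prod_(z <- zs1) h.[z] = 1 <->
  (forall x, x ^+ 3 = rho -> ~ form_dvd 2 3 (H1 - x *: H2) h).
Proof.
move=> K3 H1E H2E disj.
have sz (H : {poly K}) zs : size H = 3%N -> H = \prod_(z <- zs) ('X - z%:P) -> size zs = 2%N.
  by move=> sH HE; have := size_prod_XsubC zs id; rewrite -HE sH => -[].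
have [a [b [c [abcu abcP abcr cubesE]]]] := pencil_exists K3.
have cubes x : x ^+ 3 = rho -> x \in [:: a; b; c] by move/eqP; rewrite cubesE.
have roots : a ^+ 3 = rho /\ b ^+ 3 = rho /\ c ^+ 3 = rho.
  by split; [|split]; apply/eqP; rewrite cubesE !inE eqxx ?orbT.
have r0 : rho != 0 by rewrite mulf_neq0 ?invr_eq0.
have [h0 s0] := h_s_neq0 abcP.
have [rs hE] := closed_field_poly_normal h; set e := lead_coef h in hE.
have e0 : e != 0 by rewrite lead_coef_eq0.
have cub r : r \in rs -> H2.[r] != 0 /\ H1.[r] ^+ 3 = rho * H2.[r] ^+ 3.
  move=> rr; have hr : h.[r] = 0.
    by rewrite hE hornerZ; apply/eqP; rewrite mulf_eq0 -rootE root_prod_XsubC rr orbT.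
  have := congr1 (fun p : {poly K} => p.[r]) hs_eq.
  rewrite hornerM hr mul0r hornerD hornerN !hornerZ !horner_exp => /esym/eqP.
  rewrite subr_eq0 => /eqP E.
  have H1r : H1.[r] ^+ 3 = rho * H2.[r] ^+ 3.
    by apply: (mulfI lambda1_neq0); rewrite E /rho; field; exact: lambda1_neq0.
  split=> //; apply/negP => /eqP H2r.
  have H1r0 : H1.[r] = 0.
    have : H1.[r] ^+ 3 = 0 by rewrite H1r H2r expr0n mulr0.
    by move/eqP; rewrite expf_eq0 => /eqP.
  by have := disj r H1r0 H2r; rewrite hr eqxx.
have disj' r : r \in rs -> H2.[r] != 0 by move=> /cub[].
have [PE NE] := prod_pencil_count abcu cubes cub.
have P2 : \prod_(r <- rs) H2.[r] != 0 by rewrite prodf_seq_neq0; apply/allP => r /disj'.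
have nz x : x \in [:: a; b; c] -> x != 0.
  have : a * b * c != 0 by rewrite abcr.
  by rewrite !mulf_eq0 !negb_or !inE => /andP[/andP[a0 b0] c0] /or3P[] /eqP ->.
have [a0 [b0 c0]] : a != 0 /\ b != 0 /\ c != 0 by rewrite !nz // !inE eqxx ?orbT.
rewrite (prod_roots_exchange (sz _ _ H2_size H2E) H2E hE) (prod_roots_exchange (sz _ _ H1_size H1E) H1E hE) PE.
set na := pencil_count rs a in PE NE *; set nb := pencil_count rs b in PE NE *; set nc := pencil_count rs c in PE NE *.
have valE : rho * (e ^+ 2 * \prod_(r <- rs) H2.[r]) /
    (e ^+ 2 * (\prod_(r <- rs) H2.[r] * (a ^+ na * b ^+ nb * c ^+ nc))) =
    rho / (a ^+ na * b ^+ nb * c ^+ nc).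
  by field; rewrite e0 P2 !expf_neq0.
rewrite valE.
have abcu2 : uniq [:: b; a; c] by rewrite -(perm_uniq (_ : perm_eq [:: a; b; c] _)) // (perm_catCA [:: a] [:: b]).
have abcu3 : uniq [:: c; a; b] by rewrite -(perm_uniq (_ : perm_eq [:: a; b; c] _)) // (perm_catC [:: a; b] [:: c]).
have abcP2 : pencil b * pencil a * pencil c = H1 ^+ 3 - rho *: H2 ^+ 3 by rewrite -abcP [pencil b * _]mulrC.
have abcP3 : pencil c * pencil a * pencil b = H1 ^+ 3 - rho *: H2 ^+ 3 by rewrite -abcP; ring.
have la := pencil_count_le abcu abcP e0 hE disj'.
have lb := pencil_count_le abcu2 abcP2 e0 hE disj'.
have lc := pencil_count_le abcu3 abcP3 e0 hE disj'.
have SS := size_pencils abcP.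
have sh := size_rs e0 hE.
have Fa : form_dvd 2 3 (pencil a) h <->
    (size (pencil a) <= na.+1)%N /\ (size h <= (size (pencil a)).+1)%N.
  by split=> [/(form_dvd_count abcP e0 hE)|[]] //; exact: (count_form_dvd abcu abcP e0 hE disj').
have Fb : form_dvd 2 3 (pencil b) h <->
    (size (pencil b) <= nb.+1)%N /\ (size h <= (size (pencil b)).+1)%N.
  by split=> [/(form_dvd_count abcP2 e0 hE)|[]] //; exact: (count_form_dvd abcu2 abcP2 e0 hE disj').
have Fc : form_dvd 2 3 (pencil c) h <->
    (size (pencil c) <= nc.+1)%N /\ (size h <= (size (pencil c)).+1)%N.
  by split=> [/(form_dvd_count abcP3 e0 hE)|[]] //; exact: (count_form_dvd abcu3 abcP3 e0 hE disj').
have [ab [ac bc]] : a != b /\ a != c /\ b != c.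
  by move: abcu; rewrite /= !inE negb_or andbT => /andP[/andP[-> ->] ->].
(* Roots of [h] at infinity belong to the member of the pencil that drops degree. *)
pose m (x : K) (n : nat) := (n + if x == 1%R then 4 - size h else 0)%N.
(* The roots at infinity only raise the exponent of the parameter 1, so including them changes no
   power. *)
have powE (x : K) n : x ^+ n = x ^+ m x n.
  by rewrite /m; case: eqP => [->|_]; rewrite ?expr1n ?addn0.
have sz1 x : if x == 1 then (size (pencil x) <= 2)%N else size (pencil x) == 3%N.
  by case: eqVneq => [->|/pencil_size ->]; rewrite ?pencil_size1.
have excl (x y : K) : x != y -> ~~ ((x == 1) && (y == 1)).
  by apply: contra => /andP[/eqP -> /eqP ->].
have [Sm [ma mb mc] [Da Db Dc]] := pencil_arith (excl _ _ ab) (excl _ _ ac) (excl _ _ bc)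
  h_size s_size la lb lc SS sh NE (sz1 a) (sz1 b) (sz1 c)
  (erefl (m a na)) (erefl (m b nb)) (erefl (m c nc)).
rewrite (powE a) (powE b) (powE c).
have -> : rho / (a ^+ m a na * b ^+ m b nb * c ^+ m c nc) = 1 <->
    a * b * c = a ^+ m a na * b ^+ m b nb * c ^+ m c nc.
  rewrite abcr; split=> [/(canRL (divfK _)) ->|->]; rewrite ?mul1r //.
    by rewrite !mulf_neq0 ?expf_neq0.
  by rewrite divff // !mulf_neq0 ?expf_neq0.
(* Apart from [(1, 1, 1)] the exponents are a permutation of [(2, 1, 0)], and for instance
   [a * b * c = a ^ 2 * b] would give [c = a]. *)
have powers i j k : (i + j + k = 3)%N -> (i <= 2)%N -> (j <= 2)%N -> (k <= 2)%N ->
    a * b * c = a ^+ i * b ^+ j * c ^+ k <-> [/\ i = 1%N, j = 1%N & k = 1%N].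
  move=> ijk i2 j2 k2; split=> [E|[-> -> ->]]; last by rewrite !expr1.
  have nu (u v w : K) : u != 0 -> v != 0 -> u != w -> u * v * w = u ^+ 2 * v -> False.
    move=> u0 v0 uw uvw; move/eqP: uw; apply; apply: (mulfI (mulf_neq0 u0 v0)).
    by rewrite uvw expr2 mulrAC.
  have [ba [ca cb]] : b != a /\ c != a /\ c != b by rewrite ![_ == a]eq_sym [c == b]eq_sym.
  have kE : k = (3 - i - j)%N by move: ijk; clear; lia.
  move: i2 j2 ijk k2 E; rewrite kE; case: i {kE} => [|[|[|]]] // _; case: j => [|[|[|]]] // _ _ _ E; exfalso.
  - by apply: (nu c b a c0 b0 ca); transitivity (a * b * c); [ring | rewrite E; ring].
  - by apply: (nu b c a b0 c0 ba); transitivity (a * b * c); [ring | rewrite E; ring].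
  - by apply: (nu c a b c0 a0 cb); transitivity (a * b * c); [ring | rewrite E; ring].
  - by apply: (nu b a c b0 a0 bc); transitivity (a * b * c); [ring | rewrite E; ring].
  - by apply: (nu a c b a0 c0 ab); transitivity (a * b * c); [ring | rewrite E; ring].
  - by apply: (nu a b c a0 b0 ac); transitivity (a * b * c); [ring | rewrite E; ring].
have := powers _ _ _ Sm ma mb mc => ->; split=> [[ma1 mb1 mc1] x /cubes xabc dvd|ndvd].
  move: xabc dvd; rewrite !inE => /or3P[] /eqP ->.
  - by move=> /Fa/Da; rewrite ma1.
  - by move=> /Fb/Db; rewrite mb1.
  - by move=> /Fc/Dc; rewrite mc1.
have acr : a ^+ 3 = rho /\ b ^+ 3 = rho /\ c ^+ 3 = rho by exact: roots.
have na2 : m a na <> 2%N by move=> /Da/Fa; apply: ndvd; apply: acr.1.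
have nb2 : m b nb <> 2%N by move=> /Db/Fb; apply: ndvd; apply: acr.2.1.
have nc2 : m c nc <> 2%N by move=> /Dc/Fc; apply: ndvd; apply: acr.2.2.
move: Sm ma mb mc na2 nb2 nc2; move: (m a na) (m b nb) (m c nc) => i j k; clear.
by move=> *; split; lia.
Qed.

Lemma common_root_triple a b c r : pencil a * pencil b * pencil c = H1 ^+ 3 - rho *: H2 ^+ 3 ->
  H1.[r] = 0 -> H2.[r] = 0 -> s.[r] != 0 -> ~ form_dvd 2 3 (pencil a) h.
Proof.
move=> abcP H1r H2r sr [q [sq hE]]; have [h0 s0] := h_s_neq0 abcP.
have q0 : q != 0 by apply: contra_neq h0 => q0; rewrite hE q0 mul0r.
have mu_gt0 u : (0 < mup r (pencil u))%N.
  by rewrite -XsubC_dvd ?pencil_neq0 // dvdp_XsubCl rootE pencil_root H1r H2r mulr0.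
have mq : (mup r q < 2)%N.
  rewrite mup_ltn //; apply/negP => /(dvdp_leq q0); rewrite size_exp_XsubC => sq3.
  by have := leq_trans sq3 sq.
have := congr1 (mup r) (hs_pencil abcP); rewrite mupMl ?rootE // hE -mul_polyC.
rewrite [mup r (lambda1%:P * _)]mupMr ?rootE ?hornerC // !mupM ?mulf_neq0 ?pencil_neq0 //.
have := mu_gt0 b; have := mu_gt0 c; move: mq.
by move: (mup r q) (mup r (pencil a)) (mup r (pencil b)) (mup r (pencil c)); clear; lia.
Qed.

Lemma common_root_form_dvd r : 3%:R != 0 :> K -> H1.[r] = 0 -> H2.[r] = 0 -> s.[r] != 0 ->
  forall x, x ^+ 3 = rho -> ~ form_dvd 2 3 (H1 - x *: H2) h.
Proof.
move=> K3 H1r H2r sr x /eqP; have [a [b [c [_ abcP _ ->]]]] := pencil_exists K3.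
rewrite !inE => /or3P[] /eqP ->.
- exact: common_root_triple abcP H1r H2r sr.
- by apply: (common_root_triple (b := a) (c := c)) H1r H2r sr; rewrite -abcP; ring.
- by apply: (common_root_triple (b := a) (c := b)) H1r H2r sr; rewrite -abcP; ring.
Qed.

End CubicForms.

(** * Evaluation of the pairing *)

Section SymbolOpposite.
Variable K : fieldType.

Lemma symbMr (a b b' : int) (x y y' : K) : x != 0 -> y != 0 -> y' != 0 ->
  symb a (b + b') x (y * y') = symb a b x y * symb a b' x y'.
Proof. by move=> x0 y0 y0'; rewrite symbC symbMl // invfM -!symbC. Qed.

(** By bimultiplicativity the symbols with [y] and [y'] multiply to a symbol with [c * z ^ 3], which
    is an honest tame symbol with [z] up to a power of [c]. Here [y] and [y'] stand for the leading
    coefficients of [y - G] and [y + G], whose product is [lambda * H ^ 3]. *)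
Lemma symb_opposite (a b b' m : int) (x y y' z c : K) : x != 0 -> y != 0 -> y' != 0 -> c != 0 ->
  b + b' = m -> y * y' = c * z ^+ 3 ->
  symb (a * 3) m x z / (symb a b' x y' * c ^ a) = symb a b x y.
Proof.
move=> x0 y0 y0' c0 bE yE; have S0 := symb_neq0 a b' x0 y0'.
have ca := expfz_neq0 a c0.
apply: (mulIf S0); rewrite -symbMr // bE yE.
have -> : symb a m x (c * z ^+ 3) = symb (a * 3) m x z / c ^ a.
  rewrite /symb; have -> : a * 3 * m = a * m * 3 by rewrite mulrAC.
  by rewrite N1z_mul3 expfzMl invfM exprnP exprz_exp [3%:Z * _]mulrC mulrA mulrAC.
move: S0 ca; move: (symb a b' _ _) (c ^ _) (symb (_ * 3) _ _ _); clear.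
by move=> A B C A0 B0; field; rewrite A0 B0.
Qed.

End SymbolOpposite.

Section WeilPairing.
Variables (K : closedFieldType) (F : {poly K}).
Local Notation L := (funfield F).
Hypothesis F_sep : separable_poly F.
Hypothesis F_size : size F = 7%N.
Hypothesis K_two : 2%:R != 0 :> K.
Hypothesis K_three : 3%:R != 0 :> K.
Implicit Types (P : Defs.point F) (f u v : L) (c r : K).

Opaque poly_fun const_fun x_fun y_fun conj_fun.

Local Notation poly_unit := (poly_fun_unit F_sep (F_gt1 F_size)).
Local Notation ordM := (ordM F_sep F_size K_two).
Local Notation lcM := (lcM F_sep F_size K_two).
Local Notation c1 P := (center P).1.

(** * The involution y -> - y and the opposite torsion class *)

Section Opposite.
Variables (G H : {poly K}) (lambda : K).
Hypothesis H_monic : H \is monic.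
Hypothesis H_size : size H = 3%N.
Hypothesis lambda_neq0 : lambda != 0.
Hypothesis F_eq : F = G ^+ 2 + lambda *: H ^+ 3.
Let f : L := y_fun F - poly_fun F G.
Let f' : L := y_fun F - poly_fun F (- G).

Lemma opposite_eq : F = (- G) ^+ 2 + lambda *: H ^+ 3.
Proof. by rewrite sqrrN. Qed.

Lemma torsion_opposite : f * f' = const_fun F lambda * poly_fun F H ^+ 3.
Proof.
have -> : f * f' = poly_fun F (F - G ^+ 2).
  by rewrite poly_funB poly_funXn -y_fun_sqr subr_sqr /f' poly_funN opprK.
have -> : F - G ^+ 2 = lambda%:P * H ^+ 3 by rewrite {1}F_eq addrC addKr mul_polyC.
by rewrite poly_funM poly_funC poly_funXn.
Qed.

Variables D D' : divisor F.
Hypothesis D_eq : common_zeros f (poly_fun F H) D.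
Hypothesis D'_eq : common_zeros f' (poly_fun F H) D'.

Lemma shifted_infinite P : ~~ is_affine P -> shifted D P = -1.
Proof.
move=> iP; have := torsion_div F_sep F_size K_two H_monic H_size lambda_neq0 F_eq D_eq P.
rewrite (lead_ord F_sep F_size K_two (torsion_infinite F_sep F_size K_two H_monic H_size lambda_neq0 F_eq iP)).
rewrite -/(shifted D P); move: (shifted D P) => k; clear; lia.
Qed.

Lemma opposite_ord P : shifted D P + shifted D' P = ord P (poly_fun F H).
Proof.
have Hu : poly_fun F H \is a GRing.unit by rewrite poly_unit monic_neq0.
have cu : const_fun F lambda \is a GRing.unit by rewrite -poly_funC poly_unit polyC_eq0.
have fu := torsion_unit F_sep F_size H_monic lambda_neq0 F_eq.
have fu' := torsion_unit F_sep F_size H_monic lambda_neq0 opposite_eq.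
have := congr1 (ord P) torsion_opposite.
rewrite (ordM P fu fu') (ordM P cu (unitrX 3 Hu)) (ordX F_sep F_size K_two P 3 Hu).
rewrite (ord_const F_sep F_size K_two) // add0r.
rewrite (torsion_div F_sep F_size K_two H_monic H_size lambda_neq0 F_eq D_eq).
rewrite (torsion_div F_sep F_size K_two H_monic H_size lambda_neq0 opposite_eq D'_eq).
rewrite -/(shifted D P) -/(shifted D' P).
by move: (shifted D P) (shifted D' P) (ord P _) => i j k; clear; lia.
Qed.

Lemma opposite_lc P : lc P f * lc P f' = lambda * lc P (poly_fun F H) ^+ 3.
Proof.
have Hu : poly_fun F H \is a GRing.unit by rewrite poly_unit monic_neq0.
have cu : const_fun F lambda \is a GRing.unit by rewrite -poly_funC poly_unit polyC_eq0.
have fu := torsion_unit F_sep F_size H_monic lambda_neq0 F_eq.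
have fu' := torsion_unit F_sep F_size H_monic lambda_neq0 opposite_eq.
rewrite -(lcM P fu fu') torsion_opposite (lcM P cu (unitrX 3 Hu)).
by rewrite (lcX F_sep F_size K_two P 3 Hu) (lc_const F_sep F_size K_two).
Qed.

End Opposite.

(** Take [1 / (x - c)] with [c] not a root of [H]. Its zeros cancel the points at infinity in a
    divisor [D - inf], and its poles over [c] stay away from the roots of [H]. *)
Lemma XsubC_inv_ord (H : {poly K}) : H != 0 -> exists v, v \is a GRing.unit /\
  forall P, if is_affine P then H.[c1 P] = 0 -> ord P v = 0 else ord P v = 1.
Proof.
move=> /closed_nonrootP[c cH]; have Xu : poly_fun F ('X - c%:P) \is a GRing.unit.
  by rewrite poly_unit polyXsubC_eq0.
exists (poly_fun F ('X - c%:P))^-1; split=> [|P]; first by rewrite unitrV.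
rewrite (ordV F_sep F_size K_two P Xu); case: ifP => [aP|/negbT iP].
  move=> HP; have cp : c1 P - c != 0.
    by rewrite subr_eq0; apply: contraNneq cH => <-; rewrite rootE HP.
  have cv : chart_val P ('X - c%:P)%:P = c1 P - c by rewrite chart_valC hornerXsubC.
  have := @lead_regular _ _ P ('X - c%:P)%:P; rewrite cv => /(_ cp)/(lead_ord F_sep F_size K_two).
  by rewrite chart_funC xeval_affine // => ->; rewrite oppr0.
by rewrite (lead_ord F_sep F_size K_two (lead_XsubC_infinite F_sep F_size K_two c iP)) opprK.
Qed.

(** * The case where H1, H2 and G2 - G1 have no common root *)

Section DisjointRoots.
Variables (G1 H1 G2 H2 : {poly K}) (lambda1 lambda2 : K).
Hypothesis lambda1_neq0 : lambda1 != 0.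
Hypothesis lambda2_neq0 : lambda2 != 0.
Hypothesis H1_monic : H1 \is monic.
Hypothesis H1_size : size H1 = 3%N.
Hypothesis H2_monic : H2 \is monic.
Hypothesis H2_size : size H2 = 3%N.
Hypothesis H1_neq_H2 : H1 != H2.
Hypothesis F_eq1 : F = G1 ^+ 2 + lambda1 *: H1 ^+ 3.
Hypothesis F_eq2 : F = G2 ^+ 2 + lambda2 *: H2 ^+ 3.

Let f1 : L := y_fun F - poly_fun F G1.
Let f2 : L := y_fun F - poly_fun F G2.

Variables D1 D2 : divisor F.
Hypothesis D1_eq : common_zeros f1 (poly_fun F H1) D1.
Hypothesis D2_eq : common_zeros f2 (poly_fun F H2) D2.

Lemma difference_product : (G2 - G1) * (G2 + G1) = lambda1 *: H1 ^+ 3 - lambda2 *: H2 ^+ 3.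
Proof.
rewrite -subr_sqr; have -> : G2 ^+ 2 = F - lambda2 *: H2 ^+ 3 by rewrite {1}F_eq2 addrK.
by rewrite F_eq1 addrAC [_ + _ *: _]addrC addrK.
Qed.

Lemma size_add4 (p q : {poly K}) : (size p <= 4)%N -> (size q <= 4)%N -> (size (p + q)%R <= 4)%N.
Proof. by move=> sp sq; rewrite (leq_trans (size_polyD _ _)) // geq_max sp sq. Qed.

Lemma monic_split (H : {poly K}) : H \is monic -> exists zs, H = \prod_(z <- zs) ('X - z%:P).
Proof.
by move=> /monicP lH; have [zs E] := closed_field_poly_normal H; exists zs; rewrite {1}E lH scale1r.
Qed.

Lemma disjoint_pairing : disjoint_roots G1 H1 G2 H2 -> exists e,
  evprod (weil_symbol f1 f2 (shifted D1) (shifted D2)) e /\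
  (e = 1 <-> forall x, x ^+ 3 = lambda2 / lambda1 -> ~ form_dvd 2 3 (H1 - x *: H2) (G2 - G1)).
Proof.
move=> disj; have [zs1 E1] := monic_split H1_monic; have [zs2 E2] := monic_split H2_monic.
have ev := pairing_value_disjoint F_sep F_size K_two H1_monic H1_size lambda1_neq0 F_eq1
  H2_monic H2_size lambda2_neq0 F_eq2 D1_eq D2_eq disj E1 E2.
exists (lambda2 / lambda1 * \prod_(z <- zs2) (G2 - G1).[z] / \prod_(z <- zs1) (G2 - G1).[z]).
split=> //.
have sG1 := size_G F_size H1_monic H1_size lambda1_neq0 F_eq1; have sG2 := size_G F_size H2_monic H2_size lambda2_neq0 F_eq2.
have hs : (size (G2 - G1)%R <= 4)%N by rewrite size_add4 ?size_polyN.
have ss : (size (G2 + G1)%R <= 4)%N by rewrite size_add4.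
exact: (pairing_value_form_dvd H1_monic H1_size H2_monic H2_size H1_neq_H2 lambda1_neq0 lambda2_neq0
  hs ss difference_product K_three E1 E2 disj).
Qed.

End DisjointRoots.

Lemma common_roots_eq (p q : {poly K}) r r' : p \is monic -> q \is monic ->
  size p = 3%N -> size q = 3%N -> r != r' ->
  p.[r] = 0 -> q.[r] = 0 -> p.[r'] = 0 -> q.[r'] = 0 -> p = q.
Proof.
move=> pm qm sp sq rr pr qr pr' qr'.
have E (u : {poly K}) : u \is monic -> size u = 3%N -> u.[r] = 0 -> u.[r'] = 0 ->
    u = \prod_(z <- [:: r; r']) ('X - z%:P).
  move=> um su ur ur'; rewrite [LHS](all_roots_prod_XsubC (rs := [:: r; r'])) //.
  - by rewrite (monicP um) scale1r.
  - by rewrite /= !rootE ur ur' eqxx.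
  - by rewrite uniq_rootsE /= inE rr.
by rewrite (E p) // (E q).
Qed.

Section Main.
Variables (G1 H1 G2 H2 : {poly K}) (lambda1 lambda2 : K).
Hypothesis lambda1_neq0 : lambda1 != 0.
Hypothesis lambda2_neq0 : lambda2 != 0.
Hypothesis H1_monic : H1 \is monic.
Hypothesis H1_size : size H1 = 3%N.
Hypothesis H2_monic : H2 \is monic.
Hypothesis H2_size : size H2 = 3%N.
Hypothesis H1_neq_H2 : H1 != H2.
Hypothesis F_eq1 : F = G1 ^+ 2 + lambda1 *: H1 ^+ 3.
Hypothesis F_eq2 : F = G2 ^+ 2 + lambda2 *: H2 ^+ 3.

Let f1 : L := y_fun F - poly_fun F G1.
Let f2 : L := y_fun F - poly_fun F G2.

Variables D1 D2 kappa : divisor F.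
Hypothesis D1_eq : common_zeros f1 (poly_fun F H1) D1.
Hypothesis D2_eq : common_zeros f2 (poly_fun F H2) D2.
Hypothesis kappa_canonical : canonical_divisor kappa.

Let f1_unit : f1 \is a GRing.unit := torsion_unit F_sep F_size H1_monic lambda1_neq0 F_eq1.
Let f2_unit : f2 \is a GRing.unit := torsion_unit F_sep F_size H2_monic lambda2_neq0 F_eq2.
Let ord_f1 P : ord P f1 = shifted D1 P * 3 :=
  torsion_div F_sep F_size K_two H1_monic H1_size lambda1_neq0 F_eq1 D1_eq P.
Let ord_f2 P : ord P f2 = shifted D2 P * 3 :=
  torsion_div F_sep F_size K_two H2_monic H2_size lambda2_neq0 F_eq2 D2_eq P.
Let pairing_exists := weil_exists F_sep F_size K_two f1_unit f2_unit ord_f1 ord_f2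
  (fun P => erefl (shifted D1 P)) (fun P => erefl (shifted D2 P)) kappa_canonical.

(** * The case of a common root of H1, H2 and G2 - G1 *)

Section CommonRoot.
Variable r0 : K.
Hypothesis H1_r0 : H1.[r0] = 0.
Hypothesis H2_r0 : H2.[r0] = 0.
Hypothesis G_r0 : (G2 - G1).[r0] = 0.

Lemma G1_neq0_common : G1.[r0] != 0.
Proof.
have := torsion_root_neq0 F_sep F_eq1 H1_r0.
by rewrite (F_eval F_eq1) H1_r0 expr0n mulr0 addr0 expf_eq0.
Qed.

Lemma sum_neq0_common : (G2 + G1).[r0] != 0.
Proof.
move: G_r0; rewrite hornerD hornerN => /eqP; rewrite subr_eq0 => /eqP e.
by rewrite hornerD e -mulr2n -mulr_natl mulf_neq0 // G1_neq0_common.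
Qed.

Lemma common_root_unique r : H1.[r] = 0 -> H2.[r] = 0 -> r = r0.
Proof.
move=> H1r H2r; apply/eqP; apply: contraNT H1_neq_H2 => rr.
by apply/eqP; apply: (common_roots_eq (r := r) (r' := r0)).
Qed.

Lemma disjoint_opposite : disjoint_roots G1 H1 (- G2) H2.
Proof.
move=> r H1r H2r; rewrite (common_root_unique H1r H2r) -opprD hornerN oppr_eq0.
exact: sum_neq0_common.
Qed.

Lemma common_root_symbol : evprod (weil_symbol f1 f2 (shifted D1) (shifted D2)) 1.
Proof.
have F_eq2' := opposite_eq F_eq2.
have f2'_unit := torsion_unit F_sep F_size H2_monic lambda2_neq0 F_eq2'.
have [D2' D2'_eq] := common_zeros_exists F_sep F_size K_two (poly_fun F H2) f2'_unit.
have [e [ev eP]] := disjoint_pairing lambda1_neq0 lambda2_neq0 H1_monic H1_size H2_monic H2_size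
  H1_neq_H2 F_eq1 F_eq2' D1_eq D2'_eq disjoint_opposite.
have e1 : e = 1.
  apply/eP => x _ [q [_ /(congr1 (fun p : {poly K} => p.[r0]))]].
  rewrite hornerM !hornerD !hornerN hornerZ H1_r0 H2_r0 mulr0 oppr0 addr0 mulr0 -opprD.
  move/eqP; rewrite oppr_eq0 -hornerD; exact/negP/sum_neq0_common.
rewrite {e eP}e1 in ev.
have Hu : poly_fun F H2 \is a GRing.unit by rewrite poly_unit monic_neq0.
(* The symbol with [f2] is the tame symbol with [H2], divided by the symbol with the opposite
   function and by a power of [lambda2]; each of these three families has product 1. *)
have rec := weil_reciprocity F_sep F_size K_two f1_unit Hu.
have con := evprod_const F_sep F_size K_two lambda2_neq0 f1_unit ord_f1.
have := evprodM rec (evprodV (evprodM ev con)).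
rewrite [X in evprod _ X](_ : _ = 1); last by rewrite !(mul1r, mulr1, invr1).
apply: eq_evprod => P.
have oE := opposite_ord H2_monic H2_size lambda2_neq0 F_eq2 D2_eq D2'_eq P.
have lE := opposite_lc H2_monic lambda2_neq0 F_eq2 P.
have lc0 := @lc_neq0 _ _ F_sep F_size K_two P.
have l1 := lc0 _ f1_unit; have l2 := lc0 _ f2_unit; have l2' := lc0 _ f2'_unit; have lh := lc0 _ Hu.
rewrite /weil_symbol /tame ord_f1; exact: (symb_opposite _ l1 l2 l2' lambda2_neq0 oE lE).
Qed.

(** Here [D1] meets [D2], so the first divisor is shifted by that of [1 / H1], which gives
    [inf - D1'] with [D1'] on the conjugate points [(r, - G1 (r))]. A point common to [D1'] and [D2]
    would lie over [r0] and give [G2 = - G1] there, but [G2 + G1] does not vanish at [r0]. The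
    function [v] takes infinity out of the second divisor. *)
Lemma common_root_exists : exists z, is_weil 3 (divclass (D1 - kappa)) (divclass (D2 - kappa)) z.
Proof.
have F_eq1' := opposite_eq F_eq1.
have f1'_unit := torsion_unit F_sep F_size H1_monic lambda1_neq0 F_eq1'.
have [D1' D1'_eq] := common_zeros_exists F_sep F_size K_two (poly_fun F H1) f1'_unit.
have Hu : poly_fun F H1 \is a GRing.unit by rewrite poly_unit monic_neq0.
have HVu : (poly_fun F H1)^-1 \is a GRing.unit by rewrite unitrV.
have [v [vu vE]] := XsubC_inv_ord (monic_neq0 H1_monic).
apply: (pairing_exists HVu vu) => P.
have := opposite_ord H1_monic H1_size lambda1_neq0 F_eq1 D1_eq D1'_eq P.
rewrite (ordV F_sep F_size K_two P Hu) => <-.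
have := vE P; rewrite /shifted; case: ifP => [aP|aP] vP.
  rewrite !subr0; have [->|D1'0] := eqVneq (coeff P D1') 0; first by left; rewrite addr0 subrr.
  right; have [e1 z1] := torsion_divisor_zero F_sep F_size K_two lambda1_neq0 F_eq1' D1'_eq aP D1'0.
  rewrite (vP z1) addr0; apply/eqP/negPn/negP => D20.
  have [e2 z2] := torsion_divisor_zero F_sep F_size K_two lambda2_neq0 F_eq2 D2_eq aP D20.
  have rr := common_root_unique z1 z2; have := sum_neq0_common.
  by rewrite -rr hornerD -e2 e1 hornerN addNr eqxx.
right; rewrite vP -/(is_affine P) -[coeff P D2 - 1]/(coeff P D2 - (if false then 0 else 1)) -aP -/(shifted D2 P).
by rewrite (shifted_infinite H2_monic H2_size lambda2_neq0 F_eq2 D2_eq) ?addNr // aP.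
Qed.

End CommonRoot.

(** As [D1] and [D2] do not meet, only infinity has to be removed from the second divisor; the
    points that [v] brings in do not lie over roots of [H1], hence not on [D1]. *)
Lemma disjoint_exists : disjoint_roots G1 H1 G2 H2 ->
  exists z, is_weil 3 (divclass (D1 - kappa)) (divclass (D2 - kappa)) z.
Proof.
move=> disj; have [v [vu vE]] := XsubC_inv_ord (monic_neq0 H1_monic).
apply: (pairing_exists (unitr1 L) vu) => P.
have o1 : ord P (1 : L) = 0 by exact: (lead_ord F_sep F_size K_two (lead1 P)).
rewrite o1 addr0; have := vE P; rewrite /shifted; case: ifP => aP vP.
  rewrite !subr0; have [|D10] := eqVneq (coeff P D1) 0; first by left.
  right; have [_ z1] := torsion_divisor_zero F_sep F_size K_two lambda1_neq0 F_eq1 D1_eq aP D10.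
  rewrite (vP z1) addr0.
  have [e|//] := disjoint_divisors F_sep F_size K_two lambda1_neq0 F_eq1 lambda2_neq0 F_eq2 D1_eq D2_eq disj aP.
  by rewrite e eqxx in D10.
right; have := shifted_infinite H2_monic H2_size lambda2_neq0 F_eq2 D2_eq (negbT aP).
by rewrite /shifted aP vP => ->; rewrite addNr.
Qed.

Theorem weil_pairing_eq1 :
  weil_pairing 3 (divclass (D1 - kappa)) (divclass (D2 - kappa)) = 1 <->
  (forall x, x ^+ 3 = lambda2 / lambda1 -> ~ form_dvd 2 3 (H1 - x *: H2) (G2 - G1)).
Proof.
have symbolE z := is_weil_symbol F_sep F_size K_two f1_unit f2_unit ord_f1 ord_f2
  (fun P => erefl (shifted D1 P)) (fun P => erefl (shifted D2 P)) kappa_canonical (z := z).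
have {symbolE} valueE e : evprod (weil_symbol f1 f2 (shifted D1) (shifted D2)) e ->
    (exists z, is_weil 3 (divclass (D1 - kappa)) (divclass (D2 - kappa)) z) ->
    weil_pairing 3 (divclass (D1 - kappa)) (divclass (D2 - kappa)) = e.
  by move=> ev [z wz]; apply: evprod_uniq ev; apply: symbolE; exact: (xgetPex 0 (ex_intro _ z wz)).
have [disj|/existsNP[r0 /not_implyP[z1 /not_implyP[z2 /negP/negPn/eqP z0]]]] :=
  pselect (disjoint_roots G1 H1 G2 H2).
  have [e [ev <-]] := disjoint_pairing lambda1_neq0 lambda2_neq0 H1_monic H1_size H2_monic H2_size
    H1_neq_H2 F_eq1 F_eq2 D1_eq D2_eq disj.
  by rewrite (valueE e ev (disjoint_exists disj)).
(* With a common root both sides of the equivalence are true. *)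
split=> [_|_].
  exact: (common_root_form_dvd H1_monic H2_monic H1_neq_H2 lambda1_neq0 lambda2_neq0
    (difference_product F_eq1 F_eq2) K_three z1 z2 (sum_neq0_common z1 z0)).
exact: (valueE 1 (common_root_symbol z1 z2 z0) (common_root_exists z1 z2 z0)).
Qed.

End Main.
End WeilPairing.

Lemma pchar_neq0 (k : fieldType) (K : fieldType) (iota : {rmorphism k -> K}) p :
  prime p -> p \notin [pchar k] -> p%:R != 0 :> K.
Proof. by move=> pr; rewrite inE pr -(fmorph_eq0 iota) rmorph_nat. Qed.

Theorem lemma5 (k : fieldType) (K : closedFieldType) (iota : {rmorphism k -> K})
    (K_algebraic : forall z : K, algebraicOver iota z)
    (char_not2 : 2%N \notin [pchar k]) (char_not3 : 3%N \notin [pchar k])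
    (F G1 G2 H1 H2 : {poly k}) (lambda1 lambda2 : k)
    (F_deg : size F = 7%N) (F_sep : separable_poly F)
    (lambda1_neq0 : lambda1 != 0) (lambda2_neq0 : lambda2 != 0)
    (H1_monic : H1 \is monic) (H1_deg : size H1 = 3%N)
    (H2_monic : H2 \is monic) (H2_deg : size H2 = 3%N)
    (H1_neq_H2 : H1 != H2)
    (F_eq1 : F = G1 ^+ 2 + lambda1 *: H1 ^+ 3)
    (F_eq2 : F = G2 ^+ 2 + lambda2 *: H2 ^+ 3)
    (FK := map_poly iota F)
    (G1K := map_poly iota G1) (G2K := map_poly iota G2)
    (H1K := map_poly iota H1) (H2K := map_poly iota H2)
    (D1 D2 kappa : divisor FK)
    (D1_def : common_zeros (y_fun FK - poly_fun FK G1K) (poly_fun FK H1K) D1)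
    (D2_def : common_zeros (y_fun FK - poly_fun FK G2K) (poly_fun FK H2K) D2)
    (kappa_effective : effective_divisor kappa) (kappa_canonical : canonical_divisor kappa) :
  weil_pairing 3 (divclass (D1 - kappa)) (divclass (D2 - kappa)) = 1 <->
  (forall alpha : K, alpha ^+ 3 = iota (lambda2 / lambda1) ->
     ~ form_dvd 2 3 (H1K - alpha *: H2K) (G2K - G1K)).
Proof.
have F_eqK (G H : {poly k}) lambda : F = G ^+ 2 + lambda *: H ^+ 3 ->
    FK = map_poly iota G ^+ 2 + iota lambda *: map_poly iota H ^+ 3.
  by rewrite /FK => ->; rewrite rmorphD /= map_polyZ !rmorphXn.
rewrite fmorph_div; apply: weil_pairing_eq1; rewrite ?fmorph_eq0 ?map_monic ?size_map_poly //.
- by rewrite separable_map.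
- exact: (pchar_neq0 iota).
- exact: (pchar_neq0 iota).
- by rewrite (inj_eq (map_poly_inj iota)).
- exact: F_eqK.
- exact: F_eqK.
Qed.
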